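(* Let $\Delta\subset M\otimes\mathbb{R}$ be a reflexive polytope of dimension $d$, let $\Sigma^*$ be the face fan of $\Delta$ (a fan in $M\otimes\mathbb{R}$), and let $\Sigma$ be the normal fan of $\Delta$ (a fan in $N\otimes\mathbb{R}$). If the cones in $\Sigma^*$ of dimension $e$ are $\mathbb{Z}_2$ regular, then (1) $H_{pq}(\Sigma)=0$ for $q<p<e-1$; (2) $H_{qq}(\Sigma)\cong\mathbb{Z}_2$ for $q<e-1$.
   Context: $N\cong\mathbb{Z}^d$ and $M=\mathrm{Hom}(N,\mathbb{Z})$ are dual lattices with pairing $\langle\cdot,\cdot\rangle$; $\mathbb{Z}_2=\mathbb{Z}/2\mathbb{Z}$. A lattice polytope $\Delta\subset M\otimes\mathbb{R}$ of dimension $d$ is reflexive if $0\in\mathrm{int}\,\Delta$ and the polar polytope $\Delta^*=\{n\in N\otimes\mathbb{R}: \langle m,n\rangle\ge -1 \text{ for all } m\in\Delta\}$ is a lattice polytope (with respect to $N$). The face fan of $\Delta$ consists of $\{0\}$ and the cones over proper nonempty faces of $\Delta$. The normal fan $\Sigma$ of $\Delta$ is the inner normal fan; for $\Delta$ reflexive it equals the face fan of $\Delta^*$. For a cone $\sigma$ in a fan in $N\otimes \mathbb{R}$ set $N_\sigma=(N\cap\mathrm{span}\,\sigma)/(2N\cap\mathrm{span}\,\sigma)$, a subspace of $N/2N$ of rank $\dim\sigma$. The cone $\sigma$ is $\mathbb{Z}_2$ regular if the images in $N/2N$ of the primitive lattice generators of its rays form a basis of $N_\sigma$. For cones in $M\otimes\mathbb{R}$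 (such as those of $\Sigma^*$) the definition is the same with $M$ in place of $N$. Cosheaf homology: a cosheaf $\mathscr{F}$ of $\mathbb{Z}_2$ vector spaces on a fan $\Sigma$ of dimension $d$ is a collection of $\mathbb{Z}_2$ vector spaces $F_\sigma$, $\sigma\in\Sigma$, with linear maps $\rho_{\tau,\sigma}:F_\sigma\to F_\tau$ for faces $\sigma<\tau$ satisfying $\rho_{\beta,\tau}\rho_{\tau,\sigma}=\rho_{\beta,\sigma}$ and $\rho_{\sigma,\sigma}=\mathrm{id}$. Put $C_p(\mathscr{F})=\bigoplus_{\dim\sigma=d-p}F_\sigma$, with boundary $C_p\to C_{p-1}$ the direct sum over $\sigma$ of the maps $\sum_{\sigma<\tau,\ \dim\tau=d-p+1}\rho_{\tau,\sigma}$; $H_p(\mathscr{F})$ is the $p$th homology group. The cosheaf $\mathscr{E}$ on $\Sigma$ has stalks $E_\sigma=N(\sigma):=(N/2N)/N_\sigma$ and the natural quotient maps $N(\sigma)\to N(\tau)$ for $\sigma<\tau$. The $\mathbb{Z}_2$ Hodge spaces are $H_{pq}(\Sigma):=H_p(\wedge^q\mathscr{E})$, $0\le q\le p\le d$, where $\wedge^q\mathscr{E}$ is the stalkwise exterior power. *)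

(* Defs.v *)
From HB Require Import structures.
From mathcomp Require Import all_boot all_order all_algebra all_field.
From mathcomp Require Import finmap.
From mathcomp Require Import all_classical all_reals all_analysis.

Set Implicit Arguments.
Unset Strict Implicit.
Unset Printing Implicit Defensive.

Import Order.TTheory GRing.Theory Num.Theory.
Import numFieldNormedType.Exports.

Local Open Scope classical_set_scope.
Local Open Scope ring_scope.

(** * Linear algebra: span of a set, quotients, direct sums *)

(* The smallest subspace containing A; it exists by [lspanP]. *)
Definition lspan (K : fieldType) (vT : vectType K) (A : set vT) : {vspace vT} :=
  xget 0%VS [set U : {vspace vT} | A `<=` [set` U] /\
                    forall W : {vspace vT}, A `<=` [set` W] -> (U <= W)%VS].

Lemma lspanP (K : fieldType) (vT : vectType K) (A : set vT) :
  A `<=` [set` lspan A] /\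
  forall W : {vspace vT}, A `<=` [set` W] -> (lspan A <= W)%VS.
Proof.
rewrite /lspan; case: xgetP => [U _ //|none]; exfalso.
pose P n := `[< exists U : {vspace vT}, A `<=` [set` U] /\ \dim U = n >].
have exP : exists n, P n.
  by exists (\dim {:vT}); apply/asboolP; exists fullv; split=> // x _; exact: memvf.
case: (ex_minnP exP) => n /asboolP[U [AU dimU]] nmin.
apply: (none U); split=> // W AW.
have /eqP UW : (U :&: W)%VS == U.
  rewrite eqEdim capvSl dimU; apply: nmin; apply/asboolP; exists (U :&: W)%VS.
  by split=> // x Ax; rewrite /= memv_cap; apply/andP; split; [exact: AU|exact: AW].
by rewrite -UW capvSr.
Qed.

Lemma lspanS (K : fieldType) (vT : vectType K) (A B : set vT) :
  A `<=` B -> (lspan A <= lspan B)%VS.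
Proof. by move=> AB; apply: (lspanP A).2 => x /AB /(lspanP B).1. Qed.

(* The quotient vT / U, carried by a chosen complement of U; [quot_pi] is the
   canonical surjection. *)
Definition quotv (K : fieldType) (vT : vectType K) (U : {vspace vT}) :
  vectType K := subvs_of (U^C)%VS.

Definition quot_pi (K : fieldType) (vT : vectType K) (U : {vspace vT}) :
    'Hom(vT, quotv U) :=
  (linfun (vsproj (U^C)%VS) \o daddv_pi (U^C)%VS U)%VF.

Lemma quot_piE (K : fieldType) (vT : vectType K) (U : {vspace vT}) (v : vT) :
  v - vsval (quot_pi U v) \in U.
Proof.
rewrite comp_lfunE lfunE /= vsprojK ?memv_pi //.
have dis : ((U^C)%VS :&: U = 0)%VS by rewrite capvC capv_compl.
have vE : daddv_pi (U^C)%VS U v + daddv_pi U (U^C)%VS v = v.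
  by apply: daddv_pi_add => //; rewrite addvC addv_complf memvf.
by rewrite -[X in X - _]vE addrC addKr memv_pi.
Qed.

Lemma capv_compl0 (K : fieldType) (vT : vectType K) (U : {vspace vT}) v :
  v \in U -> v \in (U^C)%VS -> v = 0.
Proof.
move=> vU vUC; apply/eqP; rewrite -memv0 -(capv_compl U) memv_cap.
by apply/andP; split.
Qed.

Lemma lker_quot_pi (K : fieldType) (vT : vectType K) (U : {vspace vT}) :
  lker (quot_pi U) = U.
Proof.
apply/vspaceP => v; rewrite memv_ker; apply/eqP/idP => [v0|vU].
  by have := quot_piE U v; rewrite v0 /= subr0.
apply/val_inj/(@capv_compl0 _ _ U); last exact: subvsP.
have := quot_piE U v; set w := vsval _ => vw.
by rewrite -[X in X \in _](subKr v w) memvB.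
Qed.

Lemma quot_piK (K : fieldType) (vT : vectType K) (U : {vspace vT})
  (x : quotv U) : quot_pi U (vsval x) = x.
Proof.
apply/val_inj/eqP; rewrite -subr_eq0; apply/eqP/(@capv_compl0 _ _ U).
  by rewrite -opprB rpredN quot_piE.
by apply: memvB; exact: subvsP.
Qed.

(* The map induced on quotients by f; meaningful when f maps U into W. *)
Definition quot_map (K : fieldType) (vT wT : vectType K) (U : {vspace vT})
    (W : {vspace wT}) (f : 'Hom(vT, wT)) : 'Hom(quotv U, quotv W) :=
  (quot_pi W \o f \o linfun (vsval : quotv U -> vT))%VF.

Lemma quot_mapE (K : fieldType) (vT wT : vectType K) (U : {vspace vT})
    (W : {vspace wT}) (f : 'Hom(vT, wT)) (x : quotv U) :
  quot_map U W f x = quot_pi W (f (vsval x)).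
Proof. by rewrite /quot_map 2!comp_lfunE [X in f X]lfunE. Qed.

Lemma quot_map_pi (K : fieldType) (vT wT : vectType K) (U : {vspace vT})
    (W : {vspace wT}) (f : 'Hom(vT, wT)) :
  (f @: U <= W)%VS -> forall v, quot_map U W f (quot_pi U v) = quot_pi W (f v).
Proof.
move=> fUW v; rewrite quot_mapE; apply/eqP.
rewrite -subr_eq0 -linearB -linearB -memv_ker lker_quot_pi.
apply: (subvP fUW); apply: memv_img.
by rewrite -opprB rpredN quot_piE.
Qed.

Lemma quot_map_id (K : fieldType) (vT : vectType K) (U : {vspace vT}) :
  quot_map U U \1%VF = \1%VF.
Proof. by apply/lfunP => x; rewrite quot_mapE !id_lfunE quot_piK. Qed.

Lemma quot_map_comp (K : fieldType) (vT1 vT2 vT3 : vectType K)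
    (U1 : {vspace vT1}) (U2 : {vspace vT2}) (U3 : {vspace vT3})
    (f : 'Hom(vT1, vT2)) (g : 'Hom(vT2, vT3)) :
  (f @: U1 <= U2)%VS -> (g @: U2 <= U3)%VS ->
  (quot_map U2 U3 g \o quot_map U1 U2 f = quot_map U1 U3 (g \o f))%VF.
Proof.
move=> fU gU; apply/lfunP => x; rewrite -(quot_piK x) comp_lfunE.
rewrite !quot_map_pi ?comp_lfunE //.
by rewrite limg_comp (subv_trans (limgS g fU)).
Qed.

(* The direct sum of a finite family of vector spaces. *)
Definition dsum (K : fieldType) (I : finType) (V : I -> vectType K) : Type :=
  {dffun forall i, V i}.

HB.instance Definition _ (K : fieldType) (I : finType) (V : I -> vectType K) :=
  Choice.on (dsum V).

Section DirectSum.
Import VectorInternalTheory.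
Variables (K : fieldType) (I : finType) (V : I -> vectType K).
Implicit Types f g h : dsum V.

Let zero : dsum V := [ffun i => 0 : V i].
Let opp f : dsum V := [ffun i => - f i].
Let add f g : dsum V := [ffun i => f i + g i].
Let scale (a : K) f : dsum V := [ffun i => a *: f i].

Fact dsum_addA : associative add.
Proof. by move=> f g h; apply/ffunP => i; rewrite !ffunE addrA. Qed.
Fact dsum_addC : commutative add.
Proof. by move=> f g; apply/ffunP => i; rewrite !ffunE addrC. Qed.
Fact dsum_add0 : left_id zero add.
Proof. by move=> f; apply/ffunP => i; rewrite !ffunE add0r. Qed.
Fact dsum_addN : left_inverse zero opp add.
Proof. by move=> f; apply/ffunP => i; rewrite !ffunE addNr. Qed.

HB.instance Definition _ := GRing.isZmodule.Build (dsum V)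
  dsum_addA dsum_addC dsum_add0 dsum_addN.

Fact dsum_scaleA a b f : scale a (scale b f) = scale (a * b) f.
Proof. by apply/ffunP => i; rewrite !ffunE scalerA. Qed.
Fact dsum_scale1 : left_id 1 scale.
Proof. by move=> f; apply/ffunP => i; rewrite !ffunE scale1r. Qed.
Fact dsum_scaleDr : right_distributive scale +%R.
Proof. by move=> a f g; apply/ffunP => i; rewrite !ffunE scalerDr. Qed.
Fact dsum_scaleDl f : {morph scale^~ f : a b / a + b}.
Proof. by move=> a b; apply/ffunP => i; rewrite !ffunE scalerDl. Qed.

HB.instance Definition _ := GRing.Zmodule_isLmodule.Build K (dsum V)
  dsum_scaleA dsum_scale1 dsum_scaleDr dsum_scaleDl.

Lemma dsum0E i : (0 : dsum V) i = 0.
Proof. by rewrite ffunE. Qed.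
Lemma dsumDE f g i : (f + g) i = f i + g i.
Proof. by rewrite ffunE. Qed.
Lemma dsumZE a f i : (a *: f) i = a *: f i.
Proof. by rewrite ffunE. Qed.

Let coords : vectType K := {ffun {i : I & 'I_(dim (V i))} -> K^o}.

Fact dsum_vect_iso : Vector.axiom (dim coords) (dsum V).
Proof.
pose to (f : dsum V) : coords :=
  [ffun u => v2r (f (tag u)) 0 (tagged u)].
pose from (c : coords) : dsum V :=
  [ffun i => r2v (\row_j c (Tagged _ j)) : V i].
have toK : cancel to from.
  move=> f; apply/ffunP => i; rewrite ffunE.
  rewrite -[RHS]v2rK; congr r2v.
  by apply/rowP => j; rewrite !(mxE, ffunE).
have fromK : cancel from to.
  move=> c; apply/ffunP => -[i j].
  by rewrite !ffunE /= r2vK mxE.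
exists (fun f => v2r (to f)) => [a f g|].
  have -> : to (a *: f + g) = a *: to f + to g.
    by apply/ffunP => u; rewrite !ffunE linearP !mxE.
  exact: linearP.
exists (fun r => from (r2v r)) => [f|r].
  by rewrite v2rK toK.
by rewrite fromK r2vK.
Qed.

HB.instance Definition _ := Lmodule_hasFinDim.Build K (dsum V) dsum_vect_iso.

Lemma dsumP f g : (forall i, f i = g i) <-> f = g.
Proof. exact: ffunP. Qed.
End DirectSum.

(** * Exterior powers over a finite field *)

Section ExteriorPower.
Variables (F : finFieldType) (q : nat).

(* q-tuples of vectors form a finite type, so that the free vector space on
   them is finite-dimensional and can be divided by the usual relations. *)
Definition tuples (vT : vectType F) : finType :=
  {ffun 'I_q -> finvect_type vT}.

Definition free_on (vT : vectType F) : vectType F := {ffun tuples vT -> F^o}.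

Definition gen (vT : vectType F) (t : tuples vT) : free_on vT :=
  [ffun s => (s == t)%:R].

Definition upd (vT : vectType F) (t : tuples vT) (i : 'I_q) (v : vT) :
  tuples vT := [ffun j => if j == i then v else t j].

Definition multilinear_rel (vT : vectType F) : {vspace free_on vT} :=
  (\sum_(t : tuples vT) \sum_(i < q) \sum_(a : F)
    \sum_(u : finvect_type vT) \sum_(v : finvect_type vT)
      <[ gen (upd t i (a *: (u : vT) + v))
         - (a *: gen (upd t i u) + gen (upd t i v)) ]>)%VS.

Definition alternating_rel (vT : vectType F) : {vspace free_on vT} :=
  (\sum_(t : tuples vT | [exists i, exists j, (i != j) && (t i == t j)])
     <[ gen t ]>)%VS.

Definition ext_rel (vT : vectType F) : {vspace free_on vT} :=
  (multilinear_rel vT + alternating_rel vT)%VS.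

Definition ext (vT : vectType F) : vectType F := quotv (ext_rel vT).

Definition wedge (vT : vectType F) (t : tuples vT) : ext vT :=
  quot_pi (ext_rel vT) (gen t).

Definition map_tuples (vT wT : vectType F) (f : 'Hom(vT, wT)) (t : tuples vT) :
  tuples wT := [ffun i => f (t i)].

Definition free_map_fun (vT wT : vectType F) (f : 'Hom(vT, wT))
    (x : free_on vT) : free_on wT :=
  \sum_(t : tuples vT) x t *: gen (map_tuples f t).

Definition free_map (vT wT : vectType F) (f : 'Hom(vT, wT)) :
  'Hom(free_on vT, free_on wT) := linfun (free_map_fun f).

Definition ext_map (vT wT : vectType F) (f : 'Hom(vT, wT)) :
    'Hom(ext vT, ext wT) :=
  quot_map (ext_rel vT) (ext_rel wT) (free_map f).

Fact free_map_linear (vT wT : vectType F) (f : 'Hom(vT, wT)) :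
  linear (free_map_fun f).
Proof.
move=> a x y; rewrite /free_map_fun scaler_sumr -big_split /=.
by apply: eq_bigr => t _; rewrite !ffunE scalerDl scalerA.
Qed.

HB.instance Definition _ (vT wT : vectType F) (f : 'Hom(vT, wT)) :=
  GRing.isLinear.Build F (free_on vT) (free_on wT) _ (free_map_fun f)
    (free_map_linear f).

Lemma free_map_gen (vT wT : vectType F) (f : 'Hom(vT, wT)) t :
  free_map f (gen t) = gen (map_tuples f t).
Proof.
rewrite /free_map lfunE /= /free_map_fun (bigD1 t) //= big1 ?addr0 => [|s st].
  by rewrite ffunE eqxx scale1r.
by rewrite ffunE (negPf st) scale0r.
Qed.

Lemma map_upd (vT wT : vectType F) (f : 'Hom(vT, wT)) t i v :
  map_tuples f (upd t i v) = upd (map_tuples f t) i (f v).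
Proof. by apply/ffunP => j; rewrite !ffunE; case: eqP. Qed.

Lemma limg_free_map (vT wT : vectType F) (f : 'Hom(vT, wT)) :
  (free_map f @: ext_rel vT <= ext_rel wT)%VS.
Proof.
rewrite limgD; apply: addvS.
  rewrite limg_sum; apply/subv_sumP => t _.
  rewrite limg_sum; apply/subv_sumP => i _.
  rewrite limg_sum; apply/subv_sumP => a _.
  rewrite limg_sum; apply/subv_sumP => u _.
  rewrite limg_sum; apply/subv_sumP => v _.
  rewrite limg_line linearB linearD linearZ /= !free_map_gen !map_upd linearP.
  rewrite /multilinear_rel.
  apply: (sumv_sup (map_tuples f t)) => //; apply: (sumv_sup i) => //.
  apply: (sumv_sup a) => //; apply: (sumv_sup (f u : finvect_type wT)) => //.
  exact: (sumv_sup (f v : finvect_type wT)).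
rewrite limg_sum; apply/subv_sumP => t /existsP[i /existsP[j /andP[ij tij]]].
rewrite limg_line free_map_gen; apply: (sumv_sup (map_tuples f t)) => //.
apply/existsP; exists i; apply/existsP; exists j.
by rewrite ij !ffunE (eqP tij) eqxx.
Qed.

Lemma ext_map_wedge (vT wT : vectType F) (f : 'Hom(vT, wT)) t :
  ext_map f (wedge t) = wedge (map_tuples f t).
Proof. by rewrite /ext_map quot_map_pi ?limg_free_map // free_map_gen. Qed.

Lemma free_on_ext (vT : vectType F) (wT : vectType F)
    (f g : 'Hom(free_on vT, wT)) : (forall t, f (gen t) = g (gen t)) -> f = g.
Proof.
move=> fg; apply/lfunP => x.
have -> : x = \sum_(t : tuples vT) x t *: gen t.
  apply/ffunP => s; rewrite sum_ffunE (bigD1 s) //= big1 => [|t ts].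
    by rewrite !ffunE eqxx addr0 [_ *: _]mulr1.
  by rewrite !ffunE eq_sym (negPf ts) scaler0.
by rewrite !linear_sum; apply: eq_bigr => t _; rewrite !linearZ /= fg.
Qed.

Lemma ext_map_id (vT : vectType F) : ext_map (\1%VF : 'Hom(vT, vT)) = \1%VF.
Proof.
rewrite /ext_map -[RHS]quot_map_id; congr quot_map.
apply: free_on_ext => t; rewrite free_map_gen lfunE /=; congr gen.
by apply/ffunP => i; rewrite !ffunE lfunE.
Qed.

Lemma ext_map_comp (vT1 vT2 vT3 : vectType F)
    (f : 'Hom(vT1, vT2)) (g : 'Hom(vT2, vT3)) :
  (ext_map g \o ext_map f = ext_map (g \o f))%VF.
Proof.
rewrite /ext_map quot_map_comp ?limg_free_map //; congr quot_map.
apply: free_on_ext => t; rewrite comp_lfunE !free_map_gen; congr gen.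
by apply/ffunP => i; rewrite !ffunE comp_lfunE.
Qed.

End ExteriorPower.

(** * Lattices, polytopes and fans *)

(* Dual bases identify both N and M with the integral row vectors, N (x) R and
   M (x) R with the real ones, N/2N and M/2M with those over 'F_2, and the
   pairing with the standard dot product. *)

Definition lat_real (R : realType) (d : nat) (n : 'rV[int]_d) : 'rV[R]_d :=
  map_mx intr n.

Definition lat_mod2 (d : nat) (n : 'rV[int]_d) : 'rV['F_2]_d := map_mx intr n.

Definition pairing (R : realType) (d : nat) (m n : 'rV[R]_d) : R :=
  \sum_(i < d) m 0 i * n 0 i.

Definition lattice_hull (R : realType) (d : nat) (A : {fset 'rV[int]_d}) :
    set 'rV[R]_d :=
  [set x | exists w : 'rV[int]_d -> R,
     [/\ forall a, a \in A -> 0 <= w a,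
         \sum_(a <- A) w a = 1 &
         x = \sum_(a <- A) w a *: lat_real R a]].

Definition lattice_polytope (R : realType) (d : nat) (P : set 'rV[R]_d) :=
  exists A : {fset 'rV[int]_d}, P = @lattice_hull R d A.

Definition polar (R : realType) (d : nat) (P : set 'rV[R]_d) : set 'rV[R]_d :=
  [set n | forall m, P m -> -1 <= pairing m n].

(* 0 being an interior point forces P to have dimension d. *)
Definition reflexive_polytope (R : realType) (d : nat) (P : set 'rV[R]_d) :=
  [/\ lattice_polytope P, interior P 0 & lattice_polytope (polar P)].

(* F is a face of the polyhedron P: the locus where some valid affine
   inequality on P is an equality. It may be empty or all of P. *)
Definition is_face (R : realType) (d : nat) (F P : set 'rV[R]_d) :=
  exists (u : 'rV[R]_d) (c : R),
    (forall x, P x -> c <= pairing x u) /\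
    F = [set x | P x /\ pairing x u = c].

Definition cone_over (R : realType) (d : nat) (F : set 'rV[R]_d) :
    set 'rV[R]_d :=
  [set y | exists2 x, F x & exists2 t : R, 0 <= t & y = t *: x].

Definition inner_normal_cone (R : realType) (d : nat) (P F : set 'rV[R]_d) :
    set 'rV[R]_d :=
  [set n | forall m m', P m -> F m' -> pairing m' n <= pairing m n].

Definition face_fan_cones (R : realType) (d : nat) (P : set 'rV[R]_d) :
    set (set 'rV[R]_d) :=
  [set s | s = [set 0] \/
     exists F, [/\ is_face F P, F !=set0, F <> P & s = cone_over F]].

Definition normal_fan_cones (R : realType) (d : nat) (P : set 'rV[R]_d) :
    set (set 'rV[R]_d) :=
  [set s | exists F, [/\ is_face F P, F !=set0 & s = inner_normal_cone P F]].

(* [fset_set] is the identity on finite sets; see [face_fanE] and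
   [normal_fanE]. *)
Definition face_fan (R : realType) (d : nat) (P : set 'rV[R]_d) :
  {fset set 'rV[R]_d} := fset_set (face_fan_cones P).

Definition normal_fan (R : realType) (d : nat) (P : set 'rV[R]_d) :
  {fset set 'rV[R]_d} := fset_set (normal_fan_cones P).

Lemma pairing_suml (R : realType) (d : nat) (I : Type) (r : seq I)
    (w : I -> R) (x : I -> 'rV[R]_d) u :
  pairing (\sum_(i <- r) w i *: x i) u = \sum_(i <- r) w i * pairing (x i) u.
Proof.
rewrite /pairing; under eq_bigr => j _ do rewrite summxE mulr_suml.
rewrite exchange_big /=; apply: eq_bigr => i _; rewrite mulr_sumr.
by apply: eq_bigr => j _; rewrite mxE mulrA.
Qed.

Lemma finite_faces (R : realType) (d : nat) (P : set 'rV[R]_d) :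
  lattice_polytope P -> finite_set [set F | is_face F P].
Proof.
case=> A ->; pose hull := @lattice_hull R d.
apply: (@sub_finite_set _ _ (hull @` [set` fpowerset A])); last first.
  exact/finite_image/finite_fset.
move=> F [u [c [cP ->]]] /=.
pose B := [fset a in A | pairing (lat_real R a) u == c]%fset.
have BA : (B `<=` A)%fset by apply/fsubsetP => a; rewrite !inE => /andP[].
exists B; first by rewrite /= fpowersetE.
have ge a : a \in A -> c <= pairing (lat_real R a) u.
  move=> aA; apply: cP; exists (fun b => (b == a)%:R); split=> [b _||].
  - exact: ler0n.
  - rewrite (big_fsetD1 a) //= eqxx big_seq big1 ?addr0 // => b.
    by rewrite !inE => /andP[/negPf-> _].
  - rewrite (big_fsetD1 a) //= eqxx scale1r big_seq big1 ?addr0 // => b.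
    by rewrite !inE => /andP[/negPf-> _]; rewrite scale0r.
have BE (V : zmodType) (h : 'rV[int]_d -> V) :
    (forall a, a \in A -> a \notin B -> h a = 0) ->
    \sum_(a <- A) h a = \sum_(a <- B) h a.
  by move=> h0; apply/esym/big_fset_incl.
apply/seteqP; split=> x /=.
  case=> w [w0 w1 ->]; pose w' a : R := if a \in B then w a else 0.
  have w'0 a : a \in A -> a \notin B -> w' a = 0 by rewrite /w' => _ /negPf->.
  have w'E (V : zmodType) (h : R -> 'rV[int]_d -> V) :
      \sum_(a <- B) h (w' a) a = \sum_(a <- B) h (w a) a.
    by rewrite big_seq [RHS]big_seq; apply: eq_bigr => a aB; rewrite /w' aB.
  split.
    exists w'; split=> [a aA||].
    - by rewrite /w'; case: ifP => // /w0.
    - by rewrite BE // (w'E _ (fun r _ => r)).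
    - rewrite BE ?(w'E _ (fun r a => r *: _)) // => a aA aB.
      by rewrite w'0 // scale0r.
  rewrite pairing_suml -[RHS]mul1r -w1 mulr_suml big_seq [RHS]big_seq.
  by apply: eq_bigr => a; rewrite !inE => /andP[_ /eqP->].
case=> -[w [w0 w1 ->]]; rewrite pairing_suml => wc.
have wz : \sum_(a <- A) w a * (pairing (lat_real R a) u - c) = 0.
  under eq_bigr => a _ do rewrite mulrBr.
  by rewrite big_split sumrN /= -mulr_suml w1 mul1r wc subrr.
have w0B a : a \in A -> a \notin B -> w a = 0.
  move=> aA aB; move: wz; rewrite big_seq => /eqP.
  rewrite psumr_eq0 => [/allP/(_ a aA)|b bA]; last first.
    by rewrite mulr_ge0 ?w0 // subr_ge0 ge.
  rewrite aA mulf_eq0 subr_eq0 => /orP[/eqP //|ac].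
  by move: aB; rewrite !inE aA ac.
exists w; split=> [a /(fsubsetP BA)/w0 //||].
  by rewrite -w1 BE.
by rewrite BE // => a aA aB; rewrite w0B // scale0r.
Qed.

Lemma face_fanE (R : realType) (d : nat) (P : set 'rV[R]_d) :
  lattice_polytope P -> [set` face_fan P] = face_fan_cones P.
Proof.
move=> polyP; apply: fset_setK.
apply: (@sub_finite_set _ _
  ([set [set 0]] `|` (@cone_over R d) @` [set F | is_face F P])).
  by move=> s [->|[F [FP _ _ ->]]]; [left|right; exists F].
by rewrite finite_setU; split; [exact: finite_set1|
  exact/finite_image/finite_faces].
Qed.

Lemma normal_fanE (R : realType) (d : nat) (P : set 'rV[R]_d) :
  lattice_polytope P -> [set` normal_fan P] = normal_fan_cones P.
Proof.
move=> polyP; apply: fset_setK.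
apply: (@sub_finite_set _ _
  ((@inner_normal_cone R d P) @` [set F | is_face F P])).
  by move=> s [F [FP _ ->]]; exists F.
exact/finite_image/finite_faces.
Qed.

(** * Cones modulo 2 *)

Definition cone_dim (R : realType) (d : nat) (s : set 'rV[R]_d) : nat :=
  \dim (lspan s).

(* N_s as the image of N /\ span s in N/2N (the kernel of the reduction on
   N /\ span s is 2N /\ span s); this image is already a subspace, see
   [mem_cone_mod2]. *)
Definition cone_mod2 (R : realType) (d : nat) (s : set 'rV[R]_d) :
    {vspace 'rV['F_2]_d} :=
  lspan [set lat_mod2 n | n in [set n | lat_real R n \in lspan s]].

Lemma mem_cone_mod2 (R : realType) (d : nat) (s : set 'rV[R]_d) v :
  v \in cone_mod2 s <->
  exists2 n : 'rV[int]_d, lat_real R n \in lspan s & lat_mod2 n = v.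
Proof.
set I := [set lat_mod2 n | n in [set n | lat_real R n \in lspan s]].
split; last by move=> vI; apply: (lspanP I).1.
have I0 : I 0 by exists 0; rewrite /= ?/lat_real ?/lat_mod2 map_mx0 ?mem0v.
have ID x y : I x -> I y -> I (x + y).
  case=> m ms <- [n ns <-]; exists (m + n) => /=.
    by rewrite /lat_real map_mxD memvD.
  by rewrite /lat_mod2 map_mxD.
have IZ (a : 'F_2) x : I x -> I (a *: x).
  case=> m ms <-; exists (m *+ a) => /=.
    by rewrite /lat_real raddfMn /= rpredMn.
  by rewrite /lat_mod2 raddfMn /= -scaler_nat natr_Zp.
pose X := [seq x <- enum {: 'rV['F_2]_d} | `[< I x >]].
have IX x : I x -> x \in X.
  by move=> Ix; rewrite mem_filter mem_enum andbT; apply/asboolP.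
have sub : (cone_mod2 s <= <<X>>)%VS.
  by apply: (lspanP I).2 => x /IX xX; exact: memv_span.
move=> /(subvP sub) vX; rewrite (@coord_span _ _ _ (in_tuple X) _ vX).
elim/big_ind: _ => //= i _; apply: IZ.
by have := mem_nth 0 (ltn_ord i); rewrite mem_filter => /andP[/asboolP].
Qed.

Lemma cone_mod2S (R : realType) (d : nat) (s t : set 'rV[R]_d) :
  s `<=` t -> (cone_mod2 s <= cone_mod2 t)%VS.
Proof.
move=> st; apply: lspanS => v [n ns <-]; exists n => //=.
exact: subvP (lspanS st) _ ns.
Qed.

Definition primitive (d : nat) (v : 'rV[int]_d) :=
  forall (k : nat) (w : 'rV[int]_d), v = w *+ k -> k = 1%N.

Definition is_ray (R : realType) (d : nat) (r s : set 'rV[R]_d) :=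
  is_face r s /\ cone_dim r = 1%N.

Definition primitive_ray_generators (R : realType) (d : nat)
    (s : set 'rV[R]_d) : set 'rV[int]_d :=
  [set v | primitive v /\ exists2 r, is_ray r s & r (lat_real R v)].

(* X lists the primitive generators of the rays without repetition, so
   that [basis_of] speaks of the family of their images indexed by the rays. *)
Definition Z2_regular (R : realType) (d : nat) (s : set 'rV[R]_d) :=
  exists X : seq 'rV[int]_d,
    [/\ uniq X, [set` X] = primitive_ray_generators s &
        basis_of (cone_mod2 s) [seq lat_mod2 v | v <- X]].

(** * Cosheaves on a fan and their homology *)

(* A fan is given by its finite set of cones. The map [res s t] is given for
   all pairs of cones, but only matters when s is a face of t. *)
Record cosheaf (R : realType) (d : nat) (Sigma : {fset set 'rV[R]_d}) :=
  Cosheaf {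
    stalk : Sigma -> vectType 'F_2;
    res : forall s t : Sigma, 'Hom(stalk s, stalk t);
    res_id : forall s : Sigma, res s s = \1%VF;
    res_comp : forall s t b : Sigma,
      is_face (val s) (val t) -> is_face (val t) (val b) ->
      (res t b \o res s t)%VF = res s b }.

Section Homology.
Variables (R : realType) (d : nat) (Sigma : {fset set 'rV[R]_d}).
Variable F : cosheaf Sigma.

(* All the C_p are realised as subspaces of the direct sum of all stalks, on
   which the boundary operator is defined at once. *)
Definition total_chains : vectType 'F_2 := dsum (stalk F).

Definition facet_of (s t : Sigma) : bool :=
  `[< is_face (val s) (val t) >] &&
  (cone_dim (val t) == (cone_dim (val s)).+1).

Definition boundary_fun (x : total_chains) : total_chains :=
  [ffun t => \sum_(s | facet_of s t) res F s t (x s)].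

Fact boundary_linear : linear boundary_fun.
Proof.
move=> a x y; apply/ffunP => t; rewrite !ffunE scaler_sumr -big_split /=.
by apply: eq_bigr => s _; rewrite !ffunE linearP.
Qed.

HB.instance Definition _ := GRing.isLinear.Build 'F_2 total_chains total_chains
  _ boundary_fun boundary_linear.

Definition boundary : 'End(total_chains) := linfun boundary_fun.

Definition off_degree_fun (p : nat) (x : total_chains) : total_chains :=
  [ffun s => if (cone_dim (val s) + p == d)%N then 0 else x s].

Fact off_degree_linear p : linear (off_degree_fun p).
Proof.
move=> a x y; apply/ffunP => s; rewrite !ffunE.
by case: ifP => // _; rewrite scaler0 addr0.
Qed.

HB.instance Definition _ p := GRing.isLinear.Build 'F_2
  total_chains total_chains _ (off_degree_fun p) (off_degree_linear p).

Definition chains (p : nat) : {vspace total_chains} :=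
  lker (linfun (off_degree_fun p)).

Lemma mem_chains p x :
  x \in chains p <-> forall s, (cone_dim (val s) + p != d)%N -> x s = 0.
Proof.
rewrite memv_ker lfunE /=; split=> [/eqP/ffunP x0 s /negPf sp|x0].
  by have := x0 s; rewrite !ffunE sp.
by apply/eqP/ffunP => s; rewrite !ffunE; case: ifPn => // /x0.
Qed.

Definition cycles (p : nat) : {vspace total_chains} :=
  (chains p :&: lker boundary)%VS.

Definition boundaries (p : nat) : {vspace total_chains} :=
  (boundary @: chains p.+1)%VS.

(* cycles modulo boundaries, the latter seen inside the space of cycles *)
Definition homology (p : nat) : vectType 'F_2 :=
  quotv (linfun (vsval : subvs_of (cycles p) -> total_chains)
           @^-1: boundaries p)%VS.

End Homology.

(** * The cosheaf E and the Hodge spaces *)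

Definition E_stalk (R : realType) (d : nat) (s : set 'rV[R]_d) :
  vectType 'F_2 := quotv (cone_mod2 s).

Definition E_res (R : realType) (d : nat) (s t : set 'rV[R]_d) :
    'Hom(E_stalk s, E_stalk t) :=
  quot_map (cone_mod2 s) (cone_mod2 t) \1%VF.

Fact E_res_comp (R : realType) (d : nat) (s t b : set 'rV[R]_d) :
  is_face s t -> is_face t b -> (E_res t b \o E_res s t)%VF = E_res s b.
Proof.
have faceS (x y : set 'rV[R]_d) : is_face x y ->
    (\1%VF @: cone_mod2 x <= cone_mod2 y)%VS.
  by case=> u [c [_ ->]]; rewrite lim1g; apply: cone_mod2S => z [].
by move=> st tb; rewrite /E_res quot_map_comp ?faceS // comp_lfun1l.
Qed.

Definition E_cosheaf (R : realType) (d : nat) (Sigma : {fset set 'rV[R]_d}) :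
    cosheaf Sigma :=
  @Cosheaf R d Sigma (fun s => E_stalk (val s))
    (fun s t => E_res (val s) (val t))
    (fun s => quot_map_id (cone_mod2 (val s)))
    (fun s t b => @E_res_comp R d (val s) (val t) (val b)).

Fact ext_res_id (R : realType) (d : nat) (Sigma : {fset set 'rV[R]_d})
    (q : nat) (F : cosheaf Sigma) (s : Sigma) : ext_map q (res F s s) = \1%VF.
Proof. by rewrite res_id ext_map_id. Qed.

Fact ext_res_comp (R : realType) (d : nat) (Sigma : {fset set 'rV[R]_d})
    (q : nat) (F : cosheaf Sigma) (s t b : Sigma) :
  is_face (val s) (val t) -> is_face (val t) (val b) ->
  (ext_map q (res F t b) \o ext_map q (res F s t))%VF = ext_map q (res F s b).
Proof. by move=> st tb; rewrite ext_map_comp res_comp. Qed.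

Definition ext_cosheaf (R : realType) (d : nat) (Sigma : {fset set 'rV[R]_d})
    (q : nat) (F : cosheaf Sigma) : cosheaf Sigma :=
  @Cosheaf R d Sigma (fun s => ext q (stalk F s))
    (fun s t => ext_map q (res F s t))
    (@ext_res_id R d Sigma q F) (@ext_res_comp R d Sigma q F).

Definition Hodge_space (R : realType) (d : nat) (Sigma : {fset set 'rV[R]_d})
    (p q : nat) : vectType 'F_2 :=
  homology (ext_cosheaf q (E_cosheaf Sigma)) p.

(* Main.v *)
Require Import Defs.
From HB Require Import structures.
From mathcomp Require Import all_boot all_order all_algebra all_field.
From mathcomp Require Import perm boolp.

(* Write V(F) for the set of vertices of a face F of Delta. Dually to N_sigma,
   the stalk of E at the normal cone of F is the dual of the direction space of
   F mod 2. If the face cone of F is Z_2 regular, then V(F) is independent mod 2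
   and this stalk is F_2^V(F) / (1,...,1); its q-th exterior power is then the
   space of simplicial q-cocycles of the full simplex on V(F), that is, of
   functions on the (q+1)-subsets of V(F) killed by the coboundary Dl. Up to
   dimension e - 1 the chains of wedge^q E are therefore the Dl-closed functions
   x(F, S), S a (q+1)-subset of V(F), and the boundary Bd acts on F alone.
   Rows of this double complex (F fixed) are exact by coning off a vertex.
   Columns (S fixed) are the complexes of faces of Delta containing S, which are
   exact below dimension d - 1. If x = Dl y is a cycle then Bd y is a closed
   cycle of bidegree one less, so H_p(wedge^q E) = H_{p-1}(wedge^{q-1} E), and
   one descends to the empty face; the surviving class is detected by the sum
   of all coefficients.

   Column exactness is proved for the face complex of any polyhedral cone by
   induction on the number of inequalities: a chain on the cone cut by a
   half-space is first pushed off the faces that are genuinely cut, then lifted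
   to the uncut cone, and what is left lives on the cutting hyperplane. The cone
   used is that of affine functions nonnegative on Delta, whose faces are
   those of Delta in reverse order; the complex of Delta is its transpose. *)

Set Implicit Arguments.
Unset Strict Implicit.
Unset Printing Implicit Defensive.

Import Order.TTheory GRing.Theory Num.Theory.

Local Open Scope ring_scope.

(** * Faces of a polyhedral cone as zero sets *)

(** The bound on [p] comes from a shift: chains of degree [p] live on faces of rank [p.+1]
    (dimension plus one), so a filling lives in rank [p.+2], which must not exceed [e] for the
    simplex description of the stalks to hold. An element of a stalk pairs with the vertices of a
    face only up to a common constant, so its vertex coordinates depend on a representative. Minors
    bordered by a row of ones ignore this constant, and that is why a q-th exterior power is
    described by (q+1)-subsets. Exactness for a cone is stated relative to a set [B] of constraints
    kept tight, both because a column consists of the faces containing [S] and because the induction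
    either drops a constraint or makes one tight; the number of constraints outside [B] decreases in
    both cases. Reflexivity enters through the vertices: each pairs to -1 with a lattice point of
    the polar, hence is primitive, and so belongs to the ray generators whose independence mod 2 is
    assumed. The empty face has no cone in the normal fan, but the double complex includes it as the
    bottom of the descent. *)

Lemma separate_vector (K : fieldType) (V : vectType K) (U : {vspace V})
    (v : V) :
  v \notin U ->
  exists w : 'Hom(V, K^o), (forall u, u \in U -> w u = 0) /\ w v = 1.
Proof.
move=> vU; pose p := daddv_pi (U^C)%VS U.
have dis : (U^C :&: U = 0)%VS by rewrite capvC capv_compl.
have pU u : u \in U -> p u = 0.
  move=> uU; have : p u + daddv_pi U (U^C)%VS u = u.
    by apply: daddv_pi_add => //; rewrite addvC addv_complf memvf.
  rewrite [X in _ + X]daddv_pi_id ?capv_compl // => /eqP.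
  by rewrite addrC -subr_eq0 addrAC subrr add0r => /eqP.
have pv : p v != 0.
  apply: contra vU => /eqP pv0; have <- : p v + daddv_pi U (U^C)%VS v = v.
    by apply: daddv_pi_add => //; rewrite addvC addv_complf memvf.
  by rewrite pv0 add0r memv_pi.
have [j cj] : exists j, coord (vbasis {:V}) j (p v) != 0.
  apply/existsP; apply: contraNT pv => /existsPn c0.
  rewrite (coord_vbasis (memvf (p v))) big1 // => j _.
  by have := c0 j; rewrite negbK => /eqP->; rewrite scale0r.
pose f u : K^o := (coord (vbasis {:V}) j (p v))^-1 * coord (vbasis {:V}) j (p u).
have fL : linear f.
  by move=> a x y; rewrite /f !linearP /= mulrDr mulrCA.
pose fl := GRing.isLinear.Build K V K^o _ f fL.
pose F : {linear V -> K^o} := HB.pack f fl.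
exists (linfun F); split=> [u uU|]; rewrite lfunE /= /f; last exact: mulVf.
by rewrite (pU _ uU) [X in _ * X]linear0 mulr0.
Qed.

Section Covectors.
Variables (R : realFieldType) (V : vectType R) (I : finType) (l : I -> V).
Implicit Types (A B X Y Z : {set I}) (i j a b : I) (w y : 'Hom(V, R^o)).

Definition fspan Z : {vspace V} := (\sum_(i in Z) <[l i]>)%VS.
Definition rk Z := \dim (fspan Z).
Definition ev w i : R := w (l i).

Lemma evD w y i : ev (w + y) i = ev w i + ev y i.
Proof. by rewrite /ev add_lfunE. Qed.
Lemma evZ c w i : ev (c *: w) i = c * ev w i.
Proof. by rewrite /ev scale_lfunE. Qed.
Lemma evN w i : ev (- w) i = - ev w i.
Proof. by rewrite /ev opp_lfunE. Qed.
Definition evE := (evD, evZ, evN).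

Definition nonneg A w := forall i, i \in A -> 0 <= ev w i.

(** A relative interior point of the face on which exactly the constraints in [Z] are tight. *)
Definition covector A Z w :=
  [/\ Z \subset A, forall i, i \in Z -> ev w i = 0 &
      forall i, i \in A -> i \notin Z -> 0 < ev w i].

(* A face of the cone of functionals nonnegative on [A] is represented by the
   set [Z] of constraints tight along it: the larger [Z], the smaller the face,
   whose codimension is [rk Z]. *)
Definition key A Z : bool := `[< exists w, covector A Z w >].

Definition covers X Y := (X \subset Y) && (rk Y == (rk X).+1).

Lemma ev_app w i : ev w i = w (l i).
Proof. by []. Qed.

Lemma rkE Z : rk Z = \dim (fspan Z).
Proof. by []. Qed.

Lemma coversE X Y : covers X Y = (X \subset Y) && (rk Y == (rk X).+1).
Proof. by []. Qed.

Lemma keyP A Z : reflect (exists w, covector A Z w) (key A Z).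
Proof. exact: asboolP. Qed.

Lemma key_sub A Z : key A Z -> Z \subset A.
Proof. by case/keyP => w []. Qed.

Lemma covector_zeros A w : nonneg A w ->
  covector A [set i in A | ev w i == 0] w.
Proof.
move=> w0; split=> [|i|i iA].
- by apply/subsetP => i; rewrite inE => /andP[].
- by rewrite inE => /andP[_ /eqP].
- by rewrite inE iA /= => wi; rewrite lt_def wi w0.
Qed.

Lemma covector_nonneg A Z w : covector A Z w -> nonneg A w.
Proof.
case=> _ w0 w1 i iA; case: (boolP (i \in Z)) => [/w0->//|iZ].
exact/ltW/w1.
Qed.

Lemma covector_eq0 A Z w i : covector A Z w -> i \in A ->
  (ev w i == 0) = (i \in Z).
Proof.
case=> _ w0 w1 iA; case: (boolP (i \in Z)) => [/w0->//|iZ]; first exact: eqxx.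
by apply/negbTE; rewrite gt_eqF ?w1.
Qed.

Lemma mem_fspan Z i : i \in Z -> l i \in fspan Z.
Proof. by move=> iZ; rewrite memvE (sumv_sup i). Qed.

Lemma fspanS X Y : X \subset Y -> (fspan X <= fspan Y)%VS.
Proof.
move=> XY; apply/subv_sumP => i iX.
by rewrite -memvE mem_fspan ?(subsetP XY).
Qed.

Lemma rkS X Y : X \subset Y -> (rk X <= rk Y)%N.
Proof. by move=> /fspanS/dimvS. Qed.

Lemma span_ev0 Z w v : (forall i, i \in Z -> ev w i = 0) -> v \in fspan Z ->
  w v = 0.
Proof.
move=> w0 /memv_sumP[f fZ ->]; rewrite linear_sum big1 // => i iZ.
have /vlineP[c ->] := fZ i iZ; rewrite linearZ /= -/(ev w i).
by rewrite w0 // scaler0.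
Qed.

Lemma fspanU1 a Z : fspan (a |: Z) = (<[l a]> + fspan Z)%VS.
Proof.
apply/eqP; rewrite eqEsubv subv_add -memvE mem_fspan ?setU11 //=.
rewrite [X in _ && X]fspanS ?subsetUr // andbT.
apply/subv_sumP => i /setU1P[->|iZ]; first exact: addvSl.
by apply: subv_trans (addvSr _ _); rewrite -memvE mem_fspan.
Qed.

Lemma rkU1_in a Z : l a \in fspan Z -> rk (a |: Z) = rk Z.
Proof. by move=> aZ; rewrite /rk fspanU1; congr (\dim _); apply/addv_idPr. Qed.

Lemma rkU1_notin a Z : l a \notin fspan Z -> rk (a |: Z) = (rk Z).+1.
Proof.
move=> aZ; rewrite /rk fspanU1 dimv_disjoint_sum ?dim_vline.
  have -> : l a != 0 by apply: contra aZ => /eqP->; exact: mem0v.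
  by rewrite add1n.
apply/eqP; rewrite -subv0; apply/subvP => v; rewrite memv_cap.
case/andP => /vlineP[c ->] cZ; case: (eqVneq c 0) => [->|c0].
  by rewrite scale0r mem0v.
by case/negP: aZ; rewrite -[l a]scale1r -(mulVf c0) -scalerA memvZ.
Qed.

Lemma rkU1_le a Z : (rk (a |: Z) <= (rk Z).+1)%N.
Proof.
case: (boolP (l a \in fspan Z)) => [/rkU1_in->|/rkU1_notin->] //.
Qed.

Lemma rk_eq_fspan X Y : X \subset Y -> (rk Y <= rk X)%N -> fspan X = fspan Y.
Proof. by move=> /fspanS XY dYX; apply/eqP; rewrite eqEdim XY. Qed.

Lemma covector_span A Z w i : covector A Z w -> i \in A -> l i \in fspan Z ->
  i \in Z.
Proof.
move=> wZ iA; case: (wZ) => _ w0 _ /(span_ev0 w0) wi.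
by rewrite -(covector_eq0 wZ iA) /ev wi.
Qed.

Lemma key_rk_eq A X Y : key A X -> Y \subset A -> X \subset Y ->
  (rk Y <= rk X)%N -> X = Y.
Proof.
case/keyP => w wX YA XY rXY; apply/eqP; rewrite eqEsubset XY /=.
apply/subsetP => i iY; apply: (covector_span wX); first exact: (subsetP YA).
by rewrite (rk_eq_fspan XY rXY) mem_fspan.
Qed.

Lemma key_rk_lt A X Y : key A X -> Y \subset A -> X \proper Y ->
  (rk X < rk Y)%N.
Proof.
move=> kX YA /properP[XY [i iY iX]]; rewrite ltnNge; apply/negP => rXY.
by move: iX; rewrite (key_rk_eq kX YA XY rXY) iY.
Qed.

(** The source of all perturbations below: [c *: w + y] is positive where [w] is, and agrees with
    [y] where [w] vanishes. *)
Lemma dominate Z w y : (forall i, i \in Z -> 0 < ev w i) ->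
  exists2 c, 0 < c & forall i, i \in Z -> 0 < ev (c *: w + y) i.
Proof.
(* The sum bounds each ratio and makes sense for empty [Z]; the [+ 1] added below makes the
   inequality strict. *)
move=> w0; pose c := \sum_(i in Z) `|ev y i| / ev w i.
have c0 : 0 <= c.
  by apply: sumr_ge0 => i iZ; rewrite divr_ge0 // ltW // w0.
exists (c + 1) => [|i iZ]; first by rewrite ltr_wpDl.
have wi := w0 _ iZ.
have ci : `|ev y i| / ev w i <= c.
  rewrite /c (bigD1 i) //= lerDl; apply: sumr_ge0 => j /andP[jZ _].
  by rewrite divr_ge0 // ltW // w0.
rewrite !evE mulrDl mul1r; move: ci; rewrite ler_pdivrMr // => ci.
have yi : - ev y i <= `|ev y i| by rewrite -normrN ler_norm.
have : 0 <= c * ev w i + ev y i.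
  by rewrite -lerBlDr sub0r (le_trans yi).
by move=> h; rewrite addrAC ltr_wpDl.
Qed.

Lemma covector_dominate A X Y w y : covector A Y w -> X \subset Y ->
  covector Y X y -> exists2 c, 0 < c & covector A X (c *: w + y).
Proof.
case=> YA w0 w1 XY [_ y0 y1].
have [|c c0 cP] := @dominate (A :\: Y) w y.
  by move=> i; rewrite inE => /andP[iY iA]; exact: w1.
exists c => //; split=> [|i iX|i iA iX]; first exact: subset_trans YA.
  by rewrite !evE y0 // w0 ?mulr0 ?addr0 // (subsetP XY).
case: (boolP (i \in Y)) => iY; last by apply: cP; rewrite inE iY.
by rewrite !evE w0 // mulr0 add0r y1.
Qed.

Lemma key_trans A X Y : key A Y -> key Y X -> key A X.
Proof.
case/keyP => w wY /keyP[y yX]; apply/keyP.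
have [|c _ cP] := covector_dominate wY _ yX; first by case: yX.
by exists (c *: w + y).
Qed.

Lemma key_restrict A X Y : key A X -> Y \subset A -> X \subset Y -> key Y X.
Proof.
case/keyP => w [XA w0 w1] YA XY; apply/keyP; exists w; split=> // i iY.
exact/w1/(subsetP YA).
Qed.

Lemma key_self A : key A A.
Proof.
apply/keyP; exists 0; split=> // [i _|i -> //]; first by rewrite /ev zero_lfunE.
Qed.

(* Move from [w] along the ray of [y] until a constraint of [A] is hit. *)
Lemma hit_boundary A Z y w a : covector A Z y -> a \in A -> a \notin Z ->
  (forall i, i \in Z -> ev w i = 0) ->
  exists c, nonneg A (c *: y + w) /\
    exists2 b, b \in A /\ b \notin Z & ev (c *: y + w) b = 0.
Proof.
case=> ZA y0 y1 aA aZ w0; pose D := A :\: Z.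
have aD : a \in D by rewrite inE aZ.
have yD i : i \in D -> 0 < ev y i by rewrite inE => /andP[iZ iA]; exact: y1.
case: (@arg_maxP _ R I a (mem D) (fun i => - ev w i / ev y i) aD) => b bD bmax.
exists (- ev w b / ev y b); split=> [i iA|].
  case: (boolP (i \in Z)) => iZ; first by rewrite !evE (y0 i) // (w0 i) // mulr0 addr0.
  have iD : i \in D by rewrite inE iZ.
  have := bmax _ iD; rewrite /= ler_pdivrMr ?yD // => le.
  by rewrite !evE -lerBlDr sub0r.
have {}bD : b \in D by [].
exists b; first by move: bD; rewrite inE => /andP[].
by rewrite !evE mulNr mulNr mulfVK ?addNr // gt_eqF ?yD.
Qed.

(** A rank jump of two leaves room for a second direction: besides [y], positive at [a], there is a
    functional [w] that also vanishes on [X], is zero at [a] and is 1 at [b]. The lines [c *: y + w]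
    are then swept. *)
Lemma two_directions A X Y : key A X -> Y \subset A -> X \subset Y ->
  (rk X + 2 <= rk Y)%N ->
  exists a b y w, [/\ covector Y X y, a \in Y, a \notin X, b \in Y &
    [/\ l b \notin fspan (a |: X), forall i, i \in a |: X -> ev w i = 0 & ev w b = 1]].
Proof.
move=> kX YA XY rXY; have /keyP[y yX] := key_restrict kX YA XY.
have /subsetPn[a aY aX] : ~~ (Y \subset X).
  apply/negP => /rkS h; move: (leq_trans rXY h).
  by rewrite addn2 ltnNge leqnSn.
have [b bY bX] : exists2 b, b \in Y & l b \notin fspan (a |: X).
  apply/exists_inP; apply: contraLR rXY => /exists_inPn h; rewrite -ltnNge.
  rewrite addn2 ltnS (leq_trans _ (rkU1_le a X)) // dimvS //.
  by apply/subv_sumP => i iY; rewrite -memvE; have := h i iY; rewrite negbK.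
have [w [w0 w1]] := separate_vector bX.
exists a, b, y, w; split=> //; split=> // i iX.
exact/w0/mem_fspan.
Qed.

(** The face lattice is graded by [rk]. Sliding [c *: y + w] to the boundary gives more zeros than
    [X], but not all of [Y]: the functional is nonzero at [b] if [c = 0], and at [a] otherwise. *)
Lemma key_between A X Y : key A X -> key A Y -> X \subset Y ->
  (rk X + 2 <= rk Y)%N ->
  exists Z, [/\ key A Z, X \proper Z & Z \proper Y].
Proof.
move=> kX kY XY rXY.
have [a [b [y [w [yX aY aX bY [bX w0 wb]]]]]] :=
  two_directions kX (key_sub kY) XY rXY.
have [|c [cnn [e [eY eX] ce]]] := hit_boundary yX aY aX (w := w).
  by move=> i iX; rewrite w0 // setU1r.
have cv := covector_zeros cnn; case: yX => _ y0 y1.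
set Z := [set i in Y | _] in cv; exists Z; split.
- by apply: key_trans kY _; apply/keyP; exists (c *: y + w).
- apply/properP; split; last by exists e; rewrite // inE eY ce /=.
  apply/subsetP => i iX; rewrite inE (subsetP XY) // !evE y0 //.
  by rewrite w0 ?setU1r // mulr0 addr0 eqxx.
- apply/properP; split; first by case: cv.
  case: (eqVneq c 0) => [c0|c0].
    by exists b; rewrite // inE bY c0 scale0r add0r wb oner_eq0.
  exists a; rewrite // inE aY !evE w0 ?setU11 // addr0 mulf_eq0 negb_or c0.
  by rewrite gt_eqF // y1.
Qed.
End Covectors.

(** * The diamond property and the boundary mod 2 *)

Lemma F2_addrr (x : 'F_2) : x + x = 0.
Proof. by apply: val_inj; case: x => [[|[|]]]. Qed.

Lemma F2_opp (x : 'F_2) : - x = x.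
Proof. by apply/eqP; rewrite eq_sym -addr_eq0 F2_addrr. Qed.

Section Diamond.
Variables (R : realFieldType) (V : vectType R) (I : finType) (l : I -> V).
Implicit Types (A B X Y Z : {set I}) (i j a b : I) (w y : 'Hom(V, R^o)).
Local Notation ev := (ev l).
Local Notation covector := (covector l).
Local Notation key := (key l).
Local Notation rk := (rk l).
Local Notation covers := (covers l).
Local Notation nonneg := (nonneg l).

(** Values on [Z :\: X] increase strictly with [c] along the line [c *: y + w], so the boundary is
    met only once. *)
Lemma hit_unique Z X y w c c' b b' : covector Z X y ->
  nonneg Z (c *: y + w) -> nonneg Z (c' *: y + w) ->
  b \in Z -> b \notin X -> ev (c *: y + w) b = 0 ->
  b' \in Z -> b' \notin X -> ev (c' *: y + w) b' = 0 -> c = c'.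
Proof.
move=> [_ _ y1]; wlog lecc : c c' b b' / c <= c'.
  move=> wl n1 n2 h1 h2 h3 h4 h5 h6; case: (leP c c') => [le|/ltW le].
    exact: (wl _ _ b b').
  by apply/esym; apply: (wl _ _ b' b).
move=> cn _ bZ bX _ b'Z b'X; rewrite !evE => c'b.
apply/eqP; rewrite eq_le lecc /=; have := cn _ b'Z.
by rewrite !evE -c'b lerD2r ler_pM2r // y1.
Qed.

Lemma covers_proper X Y : covers X Y -> X \proper Y.
Proof.
case/andP => XY /eqP rY; rewrite properEneq XY andbT.
by apply: contra_eq_neq rY => ->; rewrite neq_ltn ltnSn.
Qed.

(** Exactly two faces lie in between. Restricted to [Z], the functionals vanishing on [X] form a
    plane, and the nonnegative ones a pointed cone in it; its two edges are reached by sliding from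
    [w] and from [- w] along [y]. *)
Lemma diamond A X Z : key A X -> key A Z -> X \subset Z -> rk Z = (rk X).+2 ->
  \sum_(Y | [&& key A Y, covers X Y & covers Y Z]) (1 : 'F_2) = 0.
Proof.
move=> kX kZ XZ rZ; have ZA := key_sub kZ.
have [|a [b [y [w [yX aZ aX bZ [bX w0 wb]]]]]] :=
  two_directions kX ZA XZ; first by rewrite rZ addn2.
case: (yX) => _ y0 y1; have ya := y1 _ aZ aX.
have w0X i : i \in X -> ev w i = 0 by move=> iX; rewrite w0 // setU1r.
have nw0X i : i \in X -> ev (- w) i = 0 by move=> iX; rewrite evN w0X ?oppr0.
have wa : ev w a = 0 by rewrite w0 // setU11.
have [c1 [n1 [e1 [e1Z e1X] h1]]] := hit_boundary yX aZ aX w0X.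
have [c2 [n2 [e2 [e2Z e2X] h2]]] := hit_boundary yX aZ aX nw0X.
have fZ : fspan l (b |: (a |: X)) = fspan l Z.
  apply: rk_eq_fspan.
    by apply/subsetP => i /setU1P[->//|/setU1P[->//|/(subsetP XZ)]].
  rewrite rZ rkU1_notin // rkU1_notin //.
  by apply: contra aX; exact: (covector_span yX).
(* Since the rank jump is two, [y] and [w] span on [Z] the functionals vanishing on [X]; the values
   at [a] and [b] give the coordinates. *)
have combo z : (forall i, i \in X -> ev z i = 0) ->
    exists s t, forall i, i \in Z -> ev z i = s * ev y i + t * ev w i.
  move=> z0; pose s := ev z a / ev y a; pose t := ev z b - s * ev y b.
  exists s, t => i iZ; pose u := z - (s *: y + t *: w).
  suff : ev u i = 0 by rewrite !evE => /subr0_eq.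
  have := mem_fspan l iZ; rewrite -fZ; apply: (span_ev0 (l := l)) => j.
  rewrite !evE; case/setU1P => [->|/setU1P[->|jX]].
  - by rewrite wb mulr1 /t [X in _ - X]addrC subrK subrr.
  - by rewrite wa mulr0 addr0 /s mulfVK ?subrr // gt_eqF.
  - by rewrite z0 // y0 // w0X // !mulr0 !addr0 subrr.
pose Y1 := [set i in Z | ev (c1 *: y + w) i == 0].
pose Y2 := [set i in Z | ev (c2 *: y - w) i == 0].
have valid c v e : ev v a = 0 -> ev v b != 0 ->
    (forall i, i \in X -> ev v i = 0) -> nonneg Z (c *: y + v) ->
    e \in Z -> e \notin X -> ev (c *: y + v) e = 0 ->
    forall Y, Y = [set i in Z | ev (c *: y + v) i == 0] ->
    [&& key A Y, covers X Y & covers Y Z].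
  move=> va vb vX cn eZ eX ce Y ->; set Y' := [set i in Z | _]; have cv := covector_zeros cn.
  have kY : key A Y' by apply: key_trans kZ _; apply/keyP; exists (c *: y + v).
  have XY : X \proper Y'.
    apply/properP; split; last by exists e; rewrite // inE eZ ce /=.
    apply/subsetP => i iX; rewrite inE (subsetP XZ) // !evE y0 //.
    by rewrite vX // mulr0 addr0 eqxx.
  have YZ : Y' \proper Z.
    apply/properP; split; first by case: cv.
    case: (eqVneq c 0) => [c0|c0].
      by exists b; rewrite // inE bZ c0 scale0r add0r.
    exists a; rewrite // inE aZ !evE va addr0 mulf_eq0 negb_or c0.
    by rewrite gt_eqF.
  have r1 := key_rk_lt kX (key_sub kY) XY.
  have r2 := key_rk_lt kY ZA YZ.
  have rY : rk Y' = (rk X).+1 by apply/eqP; rewrite eqn_leq r1 andbT -ltnS -rZ.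
  by rewrite kY /covers rY rZ !eqxx !proper_sub.
(* Equal zero sets would force [c2 = - c1], hence two opposite functionals, both nonnegative on [Z];
   vanishing at [a] gives [c1 = 0], and vanishing at [b] contradicts [wb]. *)
have Y12 : Y1 != Y2.
  apply/eqP => Y12; have : e1 \in Y2 by rewrite -Y12 inE e1Z h1 /=.
  rewrite inE e1Z /= !evE => /eqP h2'.
  have c12 : c2 = - c1.
    apply/eqP; rewrite -addr_eq0; have := h1; rewrite !evE => h1'.
    have : (c2 + c1) * ev y e1 = 0.
      by rewrite mulrDl -[RHS](addr0 0) -{1}h2' -h1' addrACA addNr addr0.
    by move/eqP; rewrite mulf_eq0 (gt_eqF (y1 _ e1Z e1X)) orbF.
  have opp i : ev (c2 *: y - w) i = - ev (c1 *: y + w) i.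
    by rewrite c12 !evE mulNr opprD.
  have z i : i \in Z -> ev (c1 *: y + w) i = 0.
    move=> iZ; apply/eqP; rewrite eq_le n1 // andbT -oppr_ge0 -opp; exact: n2.
  have := z a aZ; rewrite !evE wa addr0 => /eqP.
  rewrite mulf_eq0 (gt_eqF ya) orbF => /eqP c10.
  by have := z b bZ; rewrite !evE c10 mul0r add0r wb => /eqP; rewrite oner_eq0.
have YE Y : [&& key A Y, covers X Y & covers Y Z] = (Y == Y1) || (Y == Y2).
  apply/idP/idP; last first.
    case/orP => /eqP->.
      by apply: (valid c1 w e1 _ _ _ _ _ _ _ Y1) => //; rewrite wb oner_eq0.
    apply: (valid c2 (- w) e2 _ _ _ _ _ _ _ Y2) => //; rewrite evN ?wa ?oppr0 //.
    by rewrite wb oppr_eq0 oner_eq0.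
  case/and3P => kY cXY cYZ; have /properP[XY [e eY eX]] := covers_proper cXY.
  have /properP[YZ [d dZ dY]] := covers_proper cYZ.
  have /keyP[z zY] := key_restrict kY ZA YZ; case: (zY) => _ z0 z1.
  have eZ : e \in Z by exact: (subsetP YZ).
  have [i iX|s [t zst]] := combo z; first exact/z0/(subsetP XY).
  have ze : s * ev y e + t * ev w e = 0 by rewrite -zst // z0.
  (* With [t = 0] the zero at [e] gives [s = 0], and then [z] would vanish at [d], outside [Y]. *)
  have t0 : t != 0.
    apply: contra dY => /eqP t0; move: ze; rewrite t0 mul0r addr0 => /eqP.
    rewrite mulf_eq0 (gt_eqF (y1 _ eZ eX)) orbF => /eqP s0.
    by rewrite -(covector_eq0 zY dZ) zst // s0 t0 !mul0r addr0.
  (* Dividing [z] by the absolute value of [t] puts it on one of the two lines, where [hit_unique]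
     identifies it; the sign of [t] selects the line. *)
  have aux r v c e' : r > 0 -> ev v a = 0 ->
      (forall i, i \in Z -> ev z i = s * ev y i + r * ev v i) ->
      nonneg Z (c *: y + v) ->
      e' \in Z -> e' \notin X -> ev (c *: y + v) e' = 0 ->
      Y = [set i in Z | ev (c *: y + v) i == 0].
    move=> r0 va zsr cn e'Z e'X ce'.
    have zE i : i \in Z -> ev ((s / r) *: y + v) i = r^-1 * ev z i.
      by move=> iZ; rewrite !evE zsr // mulrDr mulKf ?gt_eqF // mulrA [_^-1 * s]mulrC.
    have sr : s / r = c.
      apply: (@hit_unique Z X y v _ _ e e') => // [i iZ|].
        by rewrite zE // mulr_ge0 ?(covector_nonneg zY) // invr_ge0 ltW.
      by rewrite zE // z0 // mulr0.
    apply/setP => i; rewrite inE -sr; case: (boolP (i \in Z)) => iZ.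
      by rewrite zE // mulf_eq0 invr_eq0 gt_eqF //= (covector_eq0 zY).
    by apply/negbTE; apply: contra iZ => /(subsetP YZ).
  have [tp|tn|tz] := ltgtP t 0; last by rewrite tz eqxx in t0.
  - apply/orP; right; apply/eqP; apply: (aux (- t) (- w) c2 e2) => //.
    + by rewrite oppr_gt0.
    + by rewrite evN wa oppr0.
    + by move=> i iZ; rewrite zst // evN mulrNN.
  - by apply/orP; left; apply/eqP; apply: (aux t w c1 e1).
rewrite (eq_bigl _ _ YE) (bigD1 Y1) ?eqxx //= (bigD1 Y2); last first.
  by rewrite eqxx orbT eq_sym.
rewrite big1 => [|Y]; first exact: val_inj.
by case/andP => /andP[/orP[/eqP->|/eqP->]]; rewrite ?eqxx.
Qed.

(** The cellular boundary of the cone mod 2. It sends larger faces to smaller ones, hence smaller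
    keys to larger ones. Chains are functions on all sets, but only their values at keys matter. *)
Definition bd A (f : {set I} -> 'F_2) Z := \sum_(Y | key A Y && covers Y Z) f Y.

Lemma bdE A f Z : bd A f Z = \sum_(Y | key A Y && covers Y Z) f Y.
Proof. by []. Qed.

Lemma bdD A f g Z : bd A (fun X => f X + g X) Z = bd A f Z + bd A g Z.
Proof. by rewrite /bd big_split. Qed.

Lemma eq_bd A f g Z : (forall X, key A X -> f X = g X) -> bd A f Z = bd A g Z.
Proof. by move=> fg; apply: eq_bigr => X /andP[/fg]. Qed.

(** After exchanging the sums, the coefficient of each [f X] is the number of keys between [X] and
    [Z], even by [diamond]. *)
Lemma bd_bd A f Z : key A Z -> bd A (bd A f) Z = 0.
Proof.
move=> kZ; rewrite /bd (exchange_big_dep (key A)) => [|Y X _ /andP[]] //=.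
apply: big1 => X kX.
rewrite (eq_bigl (fun Y => [&& key A Y, covers X Y & covers Y Z])); last first.
  by move=> Y; rewrite kX /= -andbA; congr (_ && _); rewrite andbC.
case: (boolP [exists Y, [&& key A Y, covers X Y & covers Y Z]]).
  case/existsP => Y /and3P[kY XY YZ].
  have rZ : rk Z = (rk X).+2.
    by case/andP: XY YZ => _ /eqP rY /andP[_ /eqP->]; rewrite rY.
  have XZ : X \subset Z.
    by case/andP: XY YZ => XY _ /andP[YZ _]; exact: subset_trans YZ.
  have := diamond kX kZ XZ rZ => /(congr1 ( *%R (f X))).
  rewrite mulr0 big_distrr /= => e; apply: etrans e.
  by apply: eq_bigr => W _; rewrite mulr1.
by move/existsPn => h; rewrite big1 // => Y; rewrite (negPf (h Y)).
Qed.
End Diamond.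

(** * Exactness of the face complex *)

Section Exactness.
Variables (R : realFieldType) (V : vectType R) (I : finType) (l : I -> V).
Implicit Types (A B X Y Z : {set I}) (i j b : I) (w y : 'Hom(V, R^o)).
Implicit Types (f g h : {set I} -> 'F_2).
Local Notation ev := (ev l).
Local Notation covector := (covector l).
Local Notation key := (key l).
Local Notation rk := (rk l).
Local Notation covers := (covers l).
Local Notation nonneg := (nonneg l).
Local Notation bd := (bd l).

Section OneMoreConstraint.
Variables (a : I) (A : {set I}).
Hypothesis aA : a \notin A.
Local Notation A' := (a |: A).

Lemma key_drop Z : a \notin Z -> key A' Z -> key A Z.
Proof.
move=> aZ /keyP[w [ZA w0 w1]]; apply/keyP; exists w; split=> //.
  apply/subsetP => i iZ; have /setU1P[ia|//] := subsetP ZA i iZ.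
  by rewrite -ia iZ in aZ.
by move=> i iA; apply: w1; rewrite setU1r.
Qed.

Lemma key_dropU1 Z : a \notin Z -> key A' (a |: Z) -> key A Z.
Proof.
move=> aZ /keyP[w [ZA w0 w1]]; apply/keyP; exists w; split.
- apply/subsetP => i iZ; have /setU1P[ia|//] := subsetP ZA i (setU1r a iZ).
  by rewrite -ia iZ in aZ.
- by move=> i iZ; rewrite w0 // setU1r.
- move=> i iA iZ; apply: w1; first by rewrite setU1r.
  by apply/setU1P => -[ia|iZ']; [by move: aA; rewrite -ia iA|rewrite iZ' in iZ].
Qed.

(* A face [Z] of the old cone is cut by the new hyperplane when [Z] and
   [a |: Z] are both keys, and lies in it when only the latter is. *)
Lemma key_cut_notin Z : a \notin Z -> key A' Z -> l a \notin fspan l Z.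
Proof.
move=> aZ /keyP[w wZ]; apply: contra aZ; apply: (covector_span wZ).
exact: setU11.
Qed.

Lemma key_cut_rk Z : a \notin Z -> key A' Z -> rk (a |: Z) = (rk Z).+1.
Proof. by move=> aZ kZ; rewrite rkU1_notin ?key_cut_notin. Qed.

(** Otherwise some functional vanishes on [Z] and is 1 at [a]; added to a large multiple of an
    interior point of the trace, it produces an interior point of [Z] on the positive side. *)
Lemma key_flat_in Z : a \notin Z -> key A' (a |: Z) -> ~~ key A' Z ->
  l a \in fspan l Z.
Proof.
move=> aZ kaZ; apply: contraNT => /separate_vector[w [w0 wa]].
have kZ := key_dropU1 aZ kaZ; case/keyP: kaZ => y [ZA y0 y1].
have [i|c c0 cP] := @dominate _ _ _ l (A :\: Z) y w.
  rewrite inE => /andP[iZ iA]; apply: y1; first by rewrite setU1r.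
  by apply/setU1P => -[ia|iZ']; [by move: aA; rewrite -ia iA|rewrite iZ' in iZ].
apply/keyP; exists (c *: y + w); split.
- by apply: subset_trans ZA; exact: subsetUr.
- move=> i iZ; rewrite !evE y0 ?setU1r // mulr0 add0r.
  exact/w0/mem_fspan.
- move=> i /setU1P[-> _|iA iZ]; last by apply: cP; rewrite inE iZ.
  by rewrite !evE y0 ?setU11 // mulr0 add0r [ev w a]wa ltr01.
Qed.

(** The positive side is open: if the smaller face [Z] has points there, so does every face [Y]
    having [Z] in its closure. *)
Lemma key_up Y Z : a \notin Z -> key A' Z -> key A Y -> Y \subset Z ->
  key A' Y.
Proof.
move=> aZ /keyP[x [ZA x0 x1]] /keyP[y yY] YZ; case: (yY) => YA y0 y1.
have [i|c c0 cP] := @dominate _ _ _ l [set a] x y.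
  by move/set1P->; rewrite x1 ?setU11.
apply/keyP; exists (c *: x + y); split.
- exact: subset_trans YZ ZA.
- by move=> i iY; rewrite !evE y0 // x0 ?mulr0 ?addr0 ?(subsetP YZ).
- move=> i /setU1P[-> _|iA iY]; first by apply: cP; exact: set11.
  rewrite !evE ltr_wpDl ?y1 // mulr_ge0 ?(ltW c0) //.
  case: (boolP (i \in Z)) => [/x0->//|iZ]; apply/ltW/x1 => //.
  by rewrite setU1r.
Qed.

Lemma key_split Z : key A Z ->
  [\/ key A' Z, key A' (a |: Z) | exists2 y, covector A Z y & ev y a < 0].
Proof.
case/keyP => y yZ; case: (yZ) => ZA y0 y1.
case: (ltgtP (ev y a) 0) => ya.
- by constructor 3; exists y.
- constructor 1; apply/keyP; exists y; split=> //.
    by apply: subset_trans ZA _; exact: subsetUr.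
  by move=> i /setU1P[->|iA] //; exact: y1.
- constructor 2; apply/keyP; exists y; split; first exact: setUS.
    by move=> i /setU1P[->|/y0].
  move=> i /setU1P[->|iA]; first by rewrite setU11.
  by move=> iaZ; apply: y1 => //; apply: contra iaZ; exact: setU1r.
Qed.

(** [Y] has a point positive at [a] and its closure one negative at [a]; their combination vanishing
    at [a] is interior to the trace of [Y] on the hyperplane. *)
Lemma key_cross Y Z y : a \notin Y -> key A' Y -> Y \subset Z ->
  covector A Z y -> ev y a < 0 -> key A' (a |: Y).
Proof.
move=> aY kY YZ yZ ya; case/keyP: (kY) => x [YA x0 x1].
have xa : 0 < ev x a by rewrite x1 // setU11.
apply/keyP; exists ((- ev y a) *: x + ev x a *: y); split.
- apply/subsetP => i /setU1P[->|/(subsetP YA)//]; exact: setU11.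
- move=> i /setU1P[->|iY].
    by rewrite !evE mulNr [ev x a * _]mulrC addNr.
  rewrite !evE x0 // mulr0 add0r; case: yZ => _ y0 _.
  by rewrite y0 ?mulr0 // (subsetP YZ).
- move=> i /setU1P[->|iA iaY]; first by rewrite setU11.
  rewrite !evE ltr_wpDr //.
    by rewrite mulr_ge0 ?(covector_nonneg yZ) // ltW.
  rewrite mulr_gt0 ?oppr_gt0 // x1 ?setU1r //.
  by apply: contra iaY; exact: setU1r.
Qed.

Lemma bd_split f Z : bd A' f Z = \sum_(Y : {set I}) if a \notin Y then
    (if key A' Y && covers Y Z then f Y else 0) +
    (if key A' (a |: Y) && covers (a |: Y) Z then f (a |: Y) else 0) else 0.
Proof.
rewrite bdE big_mkcond (bigID (fun Y : {set I} => a \notin Y)) /=.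
rewrite -[RHS]big_mkcond big_split /=; congr (_ + _).
rewrite (reindex_onto (fun Y => a |: Y) (fun Y => Y :\ a)) /=; last first.
  by move=> Y; rewrite negbK => aY; exact: setD1K.
apply: eq_bigl => Y; rewrite negbK setU11 /=.
apply/eqP/idP => [<-|aY]; last exact: setU1K.
by rewrite !inE eqxx.
Qed.

Lemma covers_U1r Y Z : a \notin Y -> a \notin Z -> rk (a |: Z) = rk Z ->
  covers Y (a |: Z) = covers Y Z.
Proof.
move=> aY aZ rZ; rewrite /covers rZ; congr (_ && _).
apply/idP/idP => /subsetP YZ; apply/subsetP => i iY.
  by have /setU1P[ia|//] := YZ i iY; rewrite -ia iY in aY.
by rewrite setU1r // YZ.
Qed.

Lemma subU1_notin Y Z : a \notin Y -> Y \subset a |: Z -> Y \subset Z.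
Proof.
move=> aY /subsetP YZ; apply/subsetP => i iY.
by have /setU1P[ia|//] := YZ i iY; rewrite -ia iY in aY.
Qed.

Lemma covers_U1l Y Z : a \notin Z -> covers (a |: Y) Z = false.
Proof.
move=> aZ; apply/negbTE; apply: contra aZ => /andP[/subsetP h _].
by rewrite h ?setU11.
Qed.

Lemma bd_above f g Z : a \notin Z -> key A' Z ->
  (forall Y, a \notin Y -> key A' Y -> f Y = g Y) ->
  (forall Y, a \in Y -> g Y = 0) -> bd A' f Z = bd A g Z.
Proof.
move=> aZ kZ fg g0; rewrite bd_split [RHS]bdE [RHS]big_mkcond.
apply: eq_bigr => Y _; case: (boolP (a \in Y)) => aY /=.
  by rewrite g0 //; case: ifP.
rewrite covers_U1l // andbF addr0.
case: (boolP (covers Y Z)) => cYZ; rewrite ?andbF // !andbT.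
case: (boolP (key A' Y)) => kY; first by rewrite (key_drop aY) // fg.
case: ifP => // kAY; case/negP: kY; apply: (key_up aZ kZ kAY).
exact: proper_sub (covers_proper cYZ).
Qed.

(** Turns a chain on the cut cone into one on the old cone: a face meeting the positive side keeps
    its coefficient, a face inside the hyperplane takes that of [a |: Y], and a face on the negative
    side gets 0. *)
Definition flatten f Y : 'F_2 := if a \in Y then 0 else
  if key A' Y then f Y else if key A' (a |: Y) then f (a |: Y) else 0.

Hypotheses (f : {set I} -> 'F_2)
  (fcut : forall Y, a \notin Y -> key A' Y -> key A' (a |: Y) ->
    f Y = 0 /\ f (a |: Y) = 0)
  (fcycle : forall Z, key A' Z -> bd A' f Z = 0).

Lemma bd_flatten_on Z : a \notin Z -> key A' (a |: Z) -> ~~ key A' Z ->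
  bd A' f (a |: Z) = bd A (flatten f) Z.
Proof.
move=> aZ kaZ kZ; have laZ := key_flat_in aZ kaZ kZ.
have rZ := rkU1_in laZ.
rewrite bd_split [RHS]bdE [RHS]big_mkcond.
apply: eq_bigr => Y _; rewrite /flatten; case: (boolP (a \in Y)) => aY /=.
  by case: ifP.
rewrite covers_U1r //.
have cU1 : ~~ key A' Y -> key A' (a |: Y) ->
    covers (a |: Y) (a |: Z) = covers Y Z.
  move=> nkY kaY; rewrite /covers rZ (rkU1_in (key_flat_in aY kaY nkY)).
  congr (_ && _); apply/idP/idP => [|/setUS->//] YZ.
  by apply: subU1_notin => //; apply: subset_trans YZ; exact: subsetUr.
case: (boolP (key A' Y)) => kY.
  rewrite (key_drop aY kY) /=.
  case: (boolP (key A' (a |: Y))) => kaY /=; last by rewrite addr0.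
  by have [-> ->] := fcut aY kY kaY; rewrite !if_same addr0.
rewrite add0r; case: (boolP (key A' (a |: Y))) => kaY; last by rewrite if_same.
by rewrite cU1 // (key_dropU1 aY kaY).
Qed.

(** Only faces [Z] on the negative side are new. A larger face [Y] that survives is cut, by
    [key_cross], and [fcut] kills its coefficient; it cannot lie in the hyperplane, because [y]
    would then vanish at [a]. *)
Lemma flatten_cycle Z : key A Z -> bd A (flatten f) Z = 0.
Proof.
move=> kZ; have aZ : a \notin Z by apply: contra aA; exact/subsetP/key_sub/kZ.
case: (boolP (key A' Z)) => kA'Z.
  rewrite -(@bd_above f) ?fcycle // => Y aY; last by rewrite /flatten aY.
  by rewrite /flatten (negPf aY) => ->.
case: (boolP (key A' (a |: Z))) => kaZ; first by rewrite -bd_flatten_on ?fcycle.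
case: (key_split kZ) => [h|h|[y yZ ya]]; first by rewrite h in kA'Z.
  by rewrite h in kaZ.
rewrite bdE big1 // => Y /andP[kY /covers_proper/proper_sub YZ].
have aY : a \notin Y by apply: contra aZ; exact: (subsetP YZ).
rewrite /flatten (negPf aY); case: ifPn => kA'Y.
  by have [-> _] := fcut aY kA'Y (key_cross aY kA'Y YZ yZ ya).
case: ifPn => // kaY; move: ya; rewrite /ev (@span_ev0 _ _ _ l Z) ?ltxx //.
  by case: yZ.
exact: (subvP (fspanS l YZ)) _ (key_flat_in aY kaY kA'Y).
Qed.
End OneMoreConstraint.

(** The set [B] restricts the complex to the face of the cone on which [B] is tight. *)
Definition exact_at A B := forall f,
  (forall Z, ~~ (B \subset Z) -> f Z = 0) ->
  (forall Z, key A Z -> bd A f Z = 0) ->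
  exists g, (forall Z, ~~ (B \subset Z) -> g Z = 0) /\
    forall Z, key A Z -> f Z = bd A g Z.

(** Excludes the case where, for [B] inside [A], the only key containing [B] is [A]: the chain
    concentrated at [A] is then a cycle but not a boundary. *)
Definition nontrivial_cone A B := exists w,
  [/\ nonneg A w, forall i, i \in B -> ev w i = 0 &
      exists2 i, i \in A & ev w i != 0].

Lemma bd_supported A B f : (forall Z, ~~ (B \subset Z) -> f Z = 0) ->
  forall Z, ~~ (B \subset Z) -> bd A f Z = 0.
Proof.
move=> f0 Z BZ; apply: big1 => Y /andP[_ /covers_proper/proper_sub YZ].
by apply: f0; apply: contra BZ => BY; exact: subset_trans YZ.
Qed.

(* On each cut face, [g] takes the coefficient of [f] on the trace of that face
   in the hyperplane of [a]. *)
Lemma clear_cut a A B f : a \notin A -> a \notin B ->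
  (forall Z, ~~ (B \subset Z) -> f Z = 0) ->
  (forall Z, key (a |: A) Z -> bd (a |: A) f Z = 0) ->
  exists g, (forall Z, ~~ (B \subset Z) -> g Z = 0) /\
    forall Y, a \notin Y -> key (a |: A) Y -> key (a |: A) (a |: Y) ->
      f Y + bd (a |: A) g Y = 0 /\ f (a |: Y) + bd (a |: A) g (a |: Y) = 0.
Proof.
set A' := a |: A => aA aB fB fcyc.
pose g Y := if [&& a \notin Y, key A' Y & key A' (a |: Y)]
  then f (a |: Y) else 0.
have cov Y Z : a \notin Y -> a \notin Z -> key A' Y -> key A' Z ->
    covers Y (a |: Z) = (Y == Z).
  move=> aY aZ kY kZ; have rZ := key_cut_rk aZ kZ.
  apply/idP/eqP => [/andP[YZ]|->]; last by rewrite /covers rZ eqxx subsetUr.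
  rewrite rZ eqSS => /eqP rYZ; apply: (key_rk_eq kY (key_sub kZ)).
    exact: subU1_notin YZ.
  by rewrite rYZ.
have on Y : a \notin Y -> key A' Y -> key A' (a |: Y) ->
    f (a |: Y) + bd A' g (a |: Y) = 0.
  move=> aY kY kaY; rewrite [bd _ _ _](_ : _ = f (a |: Y)) ?F2_addrr //.
  rewrite bdE (bigD1 Y) /=; last by rewrite kY cov ?eqxx.
  rewrite big1 ?addr0 => [|Z /andP[/andP[kZ cZ] ZY]].
    by rewrite /g aY kY kaY.
  rewrite /g; case: ifP => // /and3P[aZ _ _].
  by rewrite cov // (negPf ZY) in cZ.
exists g; split=> [Z BZ|Y aY kY kaY].
  rewrite /g; case: ifP => // /and3P[aZ _ _]; apply: fB.
  by apply: contra BZ => /(subU1_notin aB).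
split; last exact: on.
have : bd A' (fun X => f X + bd A' g X) (a |: Y) = 0.
  by rewrite bdD fcyc // bd_bd // addr0.
rewrite bdE  (bigD1 Y) /=; last by rewrite kY cov ?eqxx.
rewrite big1 ?addr0 // => Z /andP[/andP[kZ cZ] ZY].
case: (boolP (a \in Z)) => aZ; last by rewrite cov // (negPf ZY) in cZ.
have aZD : a \notin Z :\ a by rewrite !inE eqxx.
have ZE : a |: (Z :\ a) = Z by exact: setD1K.
have kZD : key A (Z :\ a) by apply: (key_dropU1 aA aZD); rewrite ZE.
rewrite -ZE on ?ZE //; apply: (key_up aY kY kZD).
apply: (@subU1_notin a) => //; apply: subset_trans (subD1set _ _) _.
exact: proper_sub (covers_proper cZ).
Qed.

(* If only the full key survives, any maximal proper key covers it. *)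
Lemma exact_top A B B' f : nontrivial_cone A B -> ~ nontrivial_cone A B' ->
  B \subset A ->
  (forall Z, ~~ (B' \subset Z) -> f Z = 0) ->
  exists g, (forall Z, ~~ (B \subset Z) -> g Z = 0) /\
    forall Z, key A Z -> f Z = bd A g Z.
Proof.
move=> [w [wA wB [i iA wi]]] triv BA fB'.
pose P Z := [&& key A Z, B \subset Z & Z != A].
have P0 : P [set i in A | ev w i == 0].
  apply/and3P; split.
  - by apply/keyP; exists w; exact: covector_zeros.
  - by apply/subsetP => j jB; rewrite inE (subsetP BA) //= wB.
  - by apply/eqP => /setP/(_ i); rewrite inE iA (negPf wi).
case: (@arg_maxnP _ _ P (fun Z : {set I} => #|Z|) P0) => Y /and3P[kY BY YA] Ymax.
have above Z : key A Z -> Y \proper Z -> Z = A.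
  move=> kZ YZ; apply/eqP; apply: contraT => ZA.
  have := Ymax Z; rewrite /P kZ ZA (subset_trans BY (proper_sub YZ)).
  by move/(_ isT); rewrite /= leqNgt proper_card.
have YpA : Y \proper A by rewrite properEneq YA (key_sub kY).
have cYA : covers Y A.
  rewrite /covers proper_sub //= eqn_leq (key_rk_lt kY) // andbT leqNgt.
  apply/negP => r2; have [|Z [kZ YZ ZA]] := key_between kY (key_self l A) (proper_sub YpA).
    by rewrite addn2.
  by move: ZA; rewrite (above Z kZ YZ) properxx.
exists (fun Z => if Z == Y then f A else 0); split=> [Z BZ|Z kZ].
  by case: eqP => // ZY; rewrite ZY BY in BZ.
rewrite bdE big_mkcond (bigD1 Y) //= kY eqxx /= big1 ?addr0; last first.
  by move=> X /negPf->; rewrite if_same.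
case: ifPn => cYZ.
  by rewrite (above Z kZ (covers_proper cYZ)).
have ZA : Z != A by apply: contra cYZ => /eqP->.
apply: fB'; apply/negP => B'Z; apply: triv.
case/keyP: (kZ) => y yZ; exists y; split.
- exact: covector_nonneg yZ.
- by move=> j /(subsetP B'Z); case: yZ => _ y0 _; exact: y0.
- have /properP[_ [j jA jZ]] : Z \proper A by rewrite properEneq ZA (key_sub kZ).
  by exists j => //; rewrite (covector_eq0 yZ).
Qed.

(** Both recursive calls, dropping [a] from [A] and adding [a] to [B], lower [#|A :\: B|]. Either
    may lead to a trivial cone, which is treated directly. *)
Theorem cone_exact A B : B \subset A -> nontrivial_cone A B -> exact_at A B.
Proof.
have [n] := ubnP #|A :\: B|; elim: n A B => // n IH A' B le BA' nt f fB fcyc.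
have [a aA' aB] : exists2 a, a \in A' & a \notin B.
  case: nt => w [_ wB [i iA wi]]; exists i => //.
  by apply: contra wi => /wB->.
pose A := A' :\ a; have aA : a \notin A by rewrite !inE eqxx.
have A'E : A' = a |: A by rewrite setD1K.
have BA : B \subset A.
  by apply/subsetP => i iB; rewrite !inE (subsetP BA') // andbT; apply: contraNneq aB => <-.
rewrite A'E ltnS in fcyc nt BA' le *.
have [g1 [g1B g1cut]] := clear_cut aA aB fB fcyc.
pose f1 X := f X + bd (a |: A) g1 X.
have f1B Z : ~~ (B \subset Z) -> f1 Z = 0.
  by move=> BZ; rewrite /f1 fB // (bd_supported _ g1B) // addr0.
have f1cyc Z : key (a |: A) Z -> bd (a |: A) f1 Z = 0.
  by move=> kZ; rewrite bdD fcyc // bd_bd // addr0.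
pose f2 := flatten a A f1.
have f2B Z : ~~ (B \subset Z) -> f2 Z = 0.
  move=> BZ; rewrite /f2 /flatten f1B // f1B ?if_same //.
  by apply: contra BZ => /(subU1_notin aB).
have f2cyc Z : key A Z -> bd A f2 Z = 0 by exact: flatten_cycle.
have [g2 [g2B g2E]] : exists g, (forall Z, ~~ (B \subset Z) -> g Z = 0) /\
    forall Z, key A Z -> f2 Z = bd A g Z.
  case: (pselect (nontrivial_cone A B)) => [ntA|triv].
    apply: IH => //; apply: leq_trans le; apply: proper_card.
    apply/properP; split; first by apply: setSD; exact: subsetUr.
    by exists a; rewrite !inE ?eqxx ?aB //= negb_and aA orbT.
  (* If the old cone is trivial, only the key [A] can carry [f2]. Nontriviality of the new cone
     makes this face one that is cut by [a], and [f1] has been cleared there. *)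
  exists (fun=> 0); split=> // Z kZ; rewrite bdE big1 //.
  case: (boolP (B \subset Z)) => BZ; last exact: f2B.
  have triv0 w : nonneg A w -> (forall i, i \in B -> ev w i = 0) ->
      forall i, i \in A -> ev w i = 0.
    move=> wA wB i iA; apply/eqP; apply: contra_notT triv => wi.
    by exists w; split=> //; exists i.
  have ZA : Z = A.
    apply/eqP; rewrite eqEsubset (key_sub kZ); apply/subsetP => i iA.
    case/keyP: kZ => y yZ; rewrite -(covector_eq0 yZ iA); apply/eqP.
    apply: triv0 => //; first exact: covector_nonneg yZ.
    by move=> j /(subsetP BZ); case: yZ => _ y0 _; exact: y0.
  case: nt => w [wA wB [i iA wi]].
  have wA0 j : j \in A -> ev w j = 0.
    by apply: triv0 => // k kA; apply: wA; rewrite setU1r.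
  have wa : 0 < ev w a.
    rewrite lt_def wA ?setU11 // andbT; apply: contra wi => /eqP wa0.
    by case/setU1P: iA => [->|/wA0->//]; rewrite wa0.
  have kA' : key (a |: A) A.
    apply/keyP; exists w; split=> //; first exact: subsetUr.
    by move=> j /setU1P[->|->].
  rewrite ZA /f2 /flatten (negPf aA) kA'.
  by have [] := g1cut A aA kA' (key_self _ _).
(* Carries [g2] back to the cut cone: a face in the hyperplane is looked up without [a], and the
   trace of a cut face gets 0. *)
pose g3 Y := if a \in Y then
  if key (a |: A) (Y :\ a) then 0 else g2 (Y :\ a) else g2 Y.
have g3B Z : ~~ (B \subset Z) -> g3 Z = 0.
  move=> BZ; rewrite /g3 (g2B Z BZ) g2B ?if_same //.
  by apply: contra BZ => BZ; apply: subset_trans BZ (subD1set _ _).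
(* Off the hyperplane [f1] already is the boundary of [g3] (next claim), so [h] is the whole
   remaining error and it is supported on keys containing [a]. *)
pose h Z := if a \in Z then f1 Z + bd (a |: A) g3 Z else 0.
have hE Z : key (a |: A) Z -> h Z = f1 Z + bd (a |: A) g3 Z.
  move=> kZ; rewrite /h; case: ifPn => // aZ.
  have kAZ := key_drop aZ kZ.
  have g3E : bd (a |: A) g3 Z = bd A g2 Z.
    rewrite (@bd_above a A g3 (fun Y => if a \in Y then 0 else g2 Y)) //.
    - apply: eq_bd => X kX; case: ifP => // aX.
      by case/negP: aA; exact: subsetP (key_sub kX) a aX.
    - by move=> Y /negPf aY _; rewrite /g3 aY.
    - by move=> Y ->.
  by rewrite g3E -g2E // /f2 /flatten (negPf aZ) kZ F2_addrr.
have hcyc Z : key (a |: A) Z -> bd (a |: A) h Z = 0.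
  by move=> kZ; rewrite (eq_bd _ hE) bdD f1cyc // bd_bd // addr0.
have hB Z : ~~ (a |: B \subset Z) -> h Z = 0.
  rewrite /h; case: ifP => // aZ aBZ; have BZ : ~~ (B \subset Z).
    by apply: contra aBZ => BZ; rewrite subUset sub1set aZ.
  by rewrite f1B // (bd_supported _ g3B) // addr0.
have [k [kB kE]] : exists g, (forall Z, ~~ (B \subset Z) -> g Z = 0) /\
    forall Z, key (a |: A) Z -> h Z = bd (a |: A) g Z.
  case: (pselect (nontrivial_cone (a |: A) (a |: B))) => [ntB|triv].
    have [||k [kB kE]] := IH (a |: A) (a |: B) _ _ ntB h hB hcyc.
    - apply: leq_trans le; apply: proper_card.
      apply/properP; split; first by apply: setDS; exact: subsetUr.
      by exists a; rewrite !inE ?eqxx ?aB //=.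
    - exact: setUS.
    exists k; split=> // Z BZ; apply: kB; apply: contra BZ => aBZ.
    by apply: subset_trans aBZ; exact: subsetUr.
  exact: exact_top nt triv BA' hB.
exists (fun Z => k Z + (g3 Z + g1 Z)); split=> [Z BZ|Z kZ].
  by rewrite kB // g3B // g1B // !addr0.
by rewrite !bdD -kE // hE // -addrA [X in _ + X]addrA F2_addrr add0r /f1
  -addrA F2_addrr addr0.
Qed.
End Exactness.

(** * Transposition and the complex of cofaces *)

Lemma sum_involution (T : finType) (P : pred T) (t : T -> T) (F : T -> 'F_2) :
  (forall x, P x -> P (t x)) -> (forall x, P x -> t (t x) = x) ->
  (forall x, P x -> t x != x) -> (forall x, P x -> F (t x) = F x) ->
  \sum_(x | P x) F x = 0.
Proof.
move=> tP tK tN tF.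
(* Comparing [enum_rank] picks one element of each orbit, and the two halves have equal sums. *)
rewrite (bigID (fun x => enum_rank x < enum_rank (t x))%N) /=.
rewrite [X in _ + X](_ : _ = \sum_(x | P x && (enum_rank x < enum_rank (t x))%N) F x).
  exact: F2_addrr.
rewrite (reindex_onto t t) => [|x /andP[/tK]//].
have E x : P x -> (~~ (enum_rank (t x) < enum_rank (t (t x)))%N)
    = (enum_rank x < enum_rank (t x))%N.
  move=> Px; rewrite tK // -leqNgt leq_eqVlt; case: eqP => //= /val_inj/enum_rank_inj.
  by move=> e; have := tN x Px; rewrite -e eqxx.
rewrite (eq_bigl (fun x => P x && (enum_rank x < enum_rank (t x))%N)).
  by apply: eq_bigr => x /andP[/tF].
move=> x; apply/idP/idP => [/andP[/andP[Ptx] h /eqP tx]|/andP[Px h]].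
  have Px : P x by rewrite -tx; exact: tP.
  by rewrite Px /= -E.
by rewrite tP // E // h tK // eqxx.
Qed.

(** By duality [f] is in the image of [m] as soon as it is orthogonal to every [phi] with
    [phi m = 0]. Such a [phi] has the form [g m] by hypothesis, and its pairing with [f] is
    [g (m f) = 0]. *)
Lemma transpose_exact (K : fieldType) (T : finType) (P : pred T)
    (m : T -> T -> K) :
  (forall f, (forall j, P j -> \sum_(i | P i) f i * m i j = 0) ->
     exists g, forall j, P j -> f j = \sum_(i | P i) g i * m i j) ->
  forall f, (forall i, P i -> \sum_(j | P j) m i j * f j = 0) ->
     exists g, forall i, P i -> f i = \sum_(j | P j) m i j * g j.
Proof.
move=> ex f f0; pose e (i : 'I_#|T|) : T := enum_val i.
pose N : 'M[K]_#|T| := \matrix_(i < #|T|, j < #|T|) if P (e i) && P (e j) then m (e j) (e i) else 0.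
pose F : 'rV[K]_#|T| := \row_i if P (e i) then f (e i) else 0.
have sumE (G : T -> K) : \sum_(i < #|T|) G (e i) = \sum_i G i.
  rewrite [RHS](reindex_onto e enum_rank) /=; last first.
    by move=> x _; exact: enum_rankK.
  rewrite [RHS](eq_bigl xpredT) // => i.
  by rewrite /e enum_valK eqxx.
have /submxP[D FD] : (F <= N)%MS.
  rewrite submxE; move: (cokermx N) (mulmx_coker N) => C NC.
  apply/eqP/rowP => k; rewrite !mxE; pose phi i := C (enum_rank i) k.
  have phi0 j : P j -> \sum_(i | P i) phi i * m i j = 0.
    move=> Pj; have /matrixP/(_ (enum_rank j) k) := NC.
    rewrite !mxE => e0; apply: etrans e0.
    rewrite big_mkcond -(sumE (fun i => if P i then phi i * m i j else 0)).
    apply: eq_bigr => i _.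
    rewrite !mxE /e enum_rankK Pj /=; case: ifP => Pi; last by rewrite mul0r.
    by rewrite /phi enum_valK mulrC.
  have [g gE] := ex _ phi0.
  transitivity (\sum_(i | P i) f i * \sum_(j | P j) g j * m j i).
    rewrite [RHS]big_mkcond.
    rewrite -(sumE (fun i => if P i then f i * \sum_(j | P j) g j * m j i else 0)).
    apply: eq_bigr => i _.
    rewrite !mxE; case: ifP => Pi; last by rewrite mul0r.
    by rewrite -gE // /phi enum_valK.
  under eq_bigr do rewrite mulr_sumr; rewrite exchange_big /= big1 // => j Pj.
  have /(congr1 ( *%R (g j))) := f0 j Pj; rewrite mulr0 mulr_sumr => e0.
  by apply: etrans e0; apply: eq_bigr => i _; rewrite mulrCA [f i * _]mulrC.
exists (fun j => D 0 (enum_rank j)) => i Pi.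
have /rowP/(_ (enum_rank i)) := FD; rewrite !mxE /e enum_rankK Pi => ->.
rewrite [RHS]big_mkcond.
rewrite -(sumE (fun j => if P j then m i j * D 0 (enum_rank j) else 0)).
apply: eq_bigr => j _.
rewrite !mxE /e enum_rankK enum_valK Pi andbT; case: ifP => _.
  by rewrite mulrC.
by rewrite mulr0.
Qed.

Section Cofaces.
Variables (R : realFieldType) (V : vectType R) (I : finType) (l : I -> V).
Implicit Types (A B X Y Z S : {set I}).
Local Notation key := (key l).
Local Notation rk := (rk l).
Local Notation covers := (covers l).

(** The keys containing [B] are closed under passing to larger keys, so transposing the restricted
    boundary gives the sum over all cofaces of [Z]. *)
Lemma coface_exact A B (f : {set I} -> 'F_2) :
  B \subset A -> nontrivial_cone l A B ->
  (forall Z, key A Z -> B \subset Z ->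
     \sum_(Y | key A Y && covers Z Y) f Y = 0) ->
  exists g : {set I} -> 'F_2, forall Z, key A Z -> B \subset Z ->
     f Z = \sum_(Y | key A Y && covers Z Y) g Y.
Proof.
move=> BA nt f0; pose P Z := key A Z && (B \subset Z).
pose m Y Z : 'F_2 := (covers Y Z)%:R.
have E (G : {set I} -> 'F_2) Z : P Z ->
    \sum_(Y | P Y) m Z Y * G Y = \sum_(Y | key A Y && covers Z Y) G Y.
  case/andP => kZ BZ; rewrite big_mkcond [RHS]big_mkcond.
  apply: eq_bigr => Y _; rewrite /P /m; case: (boolP (covers Z Y)) => cZY.
    have -> : B \subset Y.
      exact: subset_trans BZ (proper_sub (covers_proper cZY)).
    by rewrite !andbT mul1r.
  by rewrite mul0r andbF if_same.
have [||g gE] := @transpose_exact _ _ P m _ f.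
- move=> h h0.
  have [||g [gB gE]] := cone_exact BA nt (f := fun Z => if B \subset Z then h Z else 0).
  + by move=> Z /negPf->.
  + move=> Z kZ; case: (boolP (B \subset Z)) => BZ; last first.
      by apply: bd_supported BZ => X /negPf->.
    have PZ : P Z by rewrite /P kZ.
    rewrite -[RHS](h0 Z PZ) bdE big_mkcond [RHS]big_mkcond; apply: eq_bigr => Y _.
    rewrite /P /m; case: (key A Y); case: (B \subset Y); case: (covers Y Z) => //=.
    * by rewrite mulr1.
    * by rewrite mulr0.
  + exists g => Z PZ; have /andP[kZ BZ] := PZ; have := gE Z kZ; rewrite BZ => ->.
    rewrite bdE big_mkcond [RHS]big_mkcond; apply: eq_bigr => Y _.
    rewrite /P /m; case: (boolP (B \subset Y)) => BY; last first.
      by rewrite gB // andbF if_same.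
    by case: (key A Y); case: (covers Y Z); rewrite //= ?mulr1 ?mulr0.
- by move=> Z PZ; rewrite E //; case/andP: PZ; exact: f0.
by exists g => Z kZ BZ; rewrite gE ?E // /P kZ.
Qed.

Lemma coface_coface A (f : {set I} -> 'F_2) Z : key A Z ->
  \sum_(Y | key A Y && covers Z Y) \sum_(W | key A W && covers Y W) f W = 0.
Proof.
move=> kZ; rewrite (exchange_big_dep (key A)) => [|Y X _ /andP[]] //=.
apply: big1 => X kX.
rewrite (eq_bigl (fun Y => [&& key A Y, covers Z Y & covers Y X])); last first.
  by move=> Y; rewrite kX /= andbA.
case: (boolP [exists Y, [&& key A Y, covers Z Y & covers Y X]]).
  case/existsP => Y /and3P[kY ZY YX].
  have rX : rk X = (rk Z).+2.
    by case/andP: ZY YX => _ /eqP rY /andP[_ /eqP->]; rewrite rY.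
  have ZX : Z \subset X.
    by case/andP: ZY YX => ZY _ /andP[YX _]; exact: subset_trans YX.
  have := diamond kZ kX ZX rX => /(congr1 ( *%R (f X))).
  rewrite mulr0 big_distrr /= => e; apply: etrans e.
  by apply: eq_bigr => W _; rewrite mulr1.
by move/existsPn => h; rewrite big1 // => Y; rewrite (negPf (h Y)).
Qed.

Lemma key_cover A X Y : key A X -> key A Y -> X \proper Y ->
  exists W, [/\ key A W, covers X W & W \subset Y].
Proof.
move=> kX kY XY; pose P W := [&& key A W, X \proper W & W \subset Y].
have PY : P Y by rewrite /P kY XY subxx.
case: (@arg_minnP _ Y P (fun W => rk W) PY) => W /and3P[kW XW WY] Wmin.
exists W; split=> //; rewrite /covers proper_sub //= eqn_leq.
rewrite (key_rk_lt kX (key_sub kW)) // andbT leqNgt; apply/negP => r2.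
have [|Z [kZ XZ ZW]] := key_between kX kW (proper_sub XW).
  by rewrite addn2.
have := Wmin Z; rewrite /P kZ XZ (subset_trans (proper_sub ZW) WY) => /(_ isT).
by rewrite leqNgt (key_rk_lt kZ (key_sub kW)).
Qed.

Lemma key_extend A X r : key A X -> (rk X <= r <= rk A)%N ->
  exists Y, [/\ key A Y, X \subset Y & rk Y = r].
Proof.
move=> kX /andP[Xr rA]; pose P W := [&& key A W, X \subset W & (rk W <= r)%N].
have PX : P X by rewrite /P kX subxx Xr.
case: (@arg_maxnP _ X P (fun W => rk W) PX) => W /and3P[kW XW Wr] Wmax.
exists W; split=> //; apply/eqP; rewrite eqn_leq Wr leqNgt /=; apply/negP => lt.
have WA : W \proper A.
  rewrite properEneq (key_sub kW) andbT; apply: contraTneq lt => ->.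
  by rewrite -leqNgt.
have [Z [kZ /andP[WZ /eqP rZ] ZA]] := key_cover kW (key_self l A) WA.
have := Wmax Z; rewrite /P kZ (subset_trans XW WZ) rZ lt => /(_ isT).
by rewrite /= ltnn.
Qed.
End Cofaces.

(** * Vertices and the double complex *)

Section Vertices.
Variables (R : realFieldType) (V : vectType R) (I : finType) (l : I -> V).
Variable h : 'Hom(V, R^o).
Hypotheses (h1 : forall i, ev l h i = 1) (l_inj : injective l).
Implicit Types (X Y Z S T : {set I}) (i j v : I) (w y : 'Hom(V, R^o)).
Local Notation ev := (ev l).
Local Notation face := (key l setT).
Local Notation rk := (rk l).
Local Notation covers := (covers l).

(** The family [l] may contain points that are not vertices, so a face, as a set of indices, can be
    larger than its vertex set. *)
Definition vertices : {set I} := [set v | face [set v]].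
Definition vert Z := Z :&: vertices.

Lemma min_face Z w : face Z -> Z != set0 ->
  exists m Y, [/\ face Y, Y \subset Z, Y != set0,
    forall i, i \in Z -> m <= ev w i &
    forall i, i \in Z -> (i \in Y) = (ev w i == m)].
Proof.
move=> kZ /set0Pn[i0 i0Z].
case: (@arg_minP _ R I i0 (mem Z) (fun i => ev w i) i0Z) => i iZ imin.
have {}iZ : i \in Z by [].
(* [h] plays the constant function 1: subtracting the minimum turns the minimizers into a zero set,
   hence a key. *)
pose u := w - ev w i *: h.
have uE j : ev u j = ev w j - ev w i by rewrite !evE h1 mulr1.
have u0 : nonneg l Z u.
  by move=> j jZ; rewrite uE subr_ge0; apply: imin.
exists (ev w i), [set j in Z | ev u j == 0]; split.
- by apply: key_trans kZ _; apply/keyP; exists u; exact: covector_zeros.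
- by apply/subsetP => j; rewrite inE => /andP[].
- by apply/set0Pn; exists i; rewrite inE iZ uE subrr eqxx.
- by move=> j jZ; apply: imin.
- by move=> j jZ; rewrite inE jZ uE subr_eq0.
Qed.

(** Two distinct points of height 1 are independent, so some functional separates them; the face
    where it is minimal is smaller and nonempty. *)
Lemma face_vertex Z : face Z -> Z != set0 -> vert Z != set0.
Proof.
have [n] := ubnP #|Z|; elim: n Z => // n IH Z; rewrite ltnS => le kZ Z0.
have /set0Pn[a aZ] := Z0.
case: (eqVneq Z [set a]) => [Za|Za].
  by apply/set0Pn; exists a; rewrite !inE aZ -Za.
have [b bZ ba] : exists2 b, b \in Z & b != a.
  apply/exists_inP; apply: contraT => /exists_inPn hb; case/eqP: Za.
  apply/setP => i; rewrite inE; apply/idP/eqP => [iZ|->//].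
  by have := hb i iZ; rewrite negbK => /eqP.
have lab : l b \notin <[l a]>%VS.
  apply/negP => /vlineP[c lbc]; have := h1 b; rewrite ev_app lbc linearZ /=.
  rewrite -/(ev h a) h1 [_ *: _]mulr1 => c1; case/eqP: ba; apply: l_inj.
  by rewrite lbc c1 scale1r.
have [w [w0 wb]] := separate_vector lab.
have wa : ev w a = 0 by apply: w0; exact: memv_line.
have [m [Y [kY YZ Y0 mZ mY]]] := min_face w kZ Z0.
have YpZ : Y \proper Z.
  rewrite properEneq YZ andbT; apply/eqP => YE.
  have := mY a aZ; have := mY b bZ; rewrite YE aZ bZ wa [ev w b]wb.
  move/esym/eqP=> <- /esym; by rewrite eq_sym oner_eq0.
have /set0Pn[v vY] : vert Y != set0.
  by apply: IH => //; apply: leq_trans le; exact: proper_card.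
by apply/set0Pn; exists v; move: vY; rewrite !inE => /andP[/(subsetP YZ)->].
Qed.

Lemma nonneg_vertices Z w : face Z -> nonneg l (vert Z) w -> nonneg l Z w.
Proof.
move=> kZ w0 i iZ; have Z0 : Z != set0 by apply/set0Pn; exists i.
have [m [Y [kY YZ Y0 mZ mY]]] := min_face w kZ Z0.
have /set0Pn[v] := face_vertex kY Y0; rewrite inE => /andP[vY vv].
apply: le_trans (mZ i iZ); have vZ := subsetP YZ v vY.
have /eqP <- : ev w v == m by rewrite -mY.
by apply: w0; rewrite inE vZ.
Qed.

(** A functional zero on the vertices and negative at another point of the face would contradict
    [nonneg_vertices]. *)
Lemma fspan_vert Z : face Z -> fspan l (vert Z) = fspan l Z.
Proof.
move=> kZ; apply/eqP; rewrite eqEsubv fspanS ?subsetIl //=.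
apply/subv_sumP => i iZ; rewrite -memvE; apply: contraT => /separate_vector.
case=> w [w0 wi]; have : nonneg l Z (- w).
  by apply: nonneg_vertices => // v vv; rewrite evN [ev w v]w0 ?oppr0 ?mem_fspan.
by move/(_ i iZ); rewrite evN [ev w i]wi oppr_ge0 ler10.
Qed.

Lemma rk_card Z : (rk Z <= #|Z|)%N.
Proof.
rewrite -sum1_card; apply: leq_trans (dimv_leq_sum _ _ _) _; apply: leq_sum.
by move=> i _; rewrite dim_vline leq_b1.
Qed.

Lemma rk_vert Z : face Z -> rk (vert Z) = rk Z.
Proof. by move=> kZ; rewrite !rkE fspan_vert. Qed.

(** Closure in the linear matroid of [l]; it recovers a face from its vertices. *)
Definition closure S := [set i | l i \in fspan l S].

Lemma face_closure Z : face Z -> closure (vert Z) = Z.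
Proof.
move=> kZ; apply/setP => i; rewrite inE fspan_vert //; apply/idP/idP.
  by case/keyP: kZ => w wZ; apply: (covector_span wZ); rewrite inE.
exact: mem_fspan.
Qed.

Lemma vertS Y Z : Y \subset Z -> vert Y \subset vert Z.
Proof. exact: setSI. Qed.

Lemma sub_vert S Z : (S \subset vert Z) = (S \subset Z) && (S \subset vertices).
Proof. exact: subsetI. Qed.

Lemma rk0 : rk set0 = 0%N.
Proof. by rewrite rkE /fspan big_set0 dimv0. Qed.

(** The functional that is 1 at the missing vertex and 0 on [S] is nonnegative on the simplex [Y],
    so its zeros form the opposite facet. *)
Lemma simplex_facet Y S : face Y -> #|vert Y| = rk Y -> S \subset vert Y ->
  rk Y = #|S|.+1 ->
  [/\ face (closure S), covers (closure S) Y & rk (closure S) = #|S|].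
Proof.
move=> kY sY SY rY.
have [t tY tS] : exists2 t, t \in vert Y & t \notin S.
  apply/subsetPn; apply/negP => /subset_leq_card; rewrite sY rY.
  by rewrite ltnn.
have VE : vert Y = t |: S.
  apply/eqP; rewrite eq_sym eqEcard subUset sub1set tY SY /= cardsU1 tS sY rY.
  by rewrite add1n.
have rS : rk S = #|S|.
  apply/eqP; rewrite eqn_leq rk_card -ltnS -rY -rk_vert // VE; exact: rkU1_le.
have tn : l t \notin fspan l S.
  apply/negP => /rkU1_in; rewrite -VE rk_vert // rY rS => /eqP.
  by rewrite -[X in _ == X]addn0 -addn1 eqn_add2l.
have [w [w0 wt]] := separate_vector tn.
have wS i : i \in S -> ev w i = 0 by move=> iS; apply/w0/mem_fspan.
have wY : nonneg l Y w.
  apply: nonneg_vertices => // v; rewrite VE => /setU1P[->|/wS->//].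
  by rewrite [ev w t]wt ler01.
pose Z := [set i in Y | ev w i == 0].
have kZ : face Z.
  by apply: key_trans kY _; apply/keyP; exists w; exact: covector_zeros.
have ZY : Z \subset Y by apply/subsetP => i; rewrite inE => /andP[].
have vZ : vert Z = S.
  apply/eqP; rewrite eqEsubset; apply/andP; split; apply/subsetP => i.
    move=> iZ; have : i \in vert Y by apply: subsetP (vertS ZY) i iZ.
    rewrite VE => /setU1P[it|//]; move: iZ; rewrite it !inE [ev w t]wt.
    by rewrite oner_eq0 andbF.
  move=> iS; have := subsetP SY i iS; rewrite !inE => /andP[-> ->].
  by rewrite wS // eqxx.
rewrite -vZ face_closure // vZ; have rZ : rk Z = #|S| by rewrite -rk_vert // vZ.
by split=> //; rewrite coversE ZY rZ rY /=.
Qed.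

(** * The double complex of faces and vertex subsets *)

Section DoubleComplex.
Variables (e : nat).
Hypotheses (e_lt : (e < rk setT)%N)
  (low : forall Z, face Z -> (rk Z <= e)%N -> #|vert Z| = rk Z).
Implicit Types (x u : {set I} -> {set I} -> 'F_2).

(** The guards of [Bd] and [Dl] keep values zero unless the second argument consists of vertices of
    [Z]. The empty face and the empty subset are allowed, so both directions are augmented. *)
Definition Bd x Z S := if face Z && (S \subset vert Z) then
  \sum_(Y | face Y && covers Z Y) x Y S else 0.
Definition Dl x Z T := if T \subset vert Z then \sum_(t in T) x Z (T :\ t) else 0.
(** The bidegree is shifted by one from the Hodge degrees: degree [p] and power [q] correspond to
    [a = p.+1] and [b = q.+1]. *)
Definition supp a b x := forall Z S, x Z S != 0 ->
  [&& face Z, rk Z == a, S \subset vert Z & #|S| == b].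

Lemma supp0 a b x Z S : supp a b x ->
  ~~ [&& face Z, rk Z == a, S \subset vert Z & #|S| == b] -> x Z S = 0.
Proof. by move=> sx; apply: contraNeq; exact: sx. Qed.

Lemma BdD x u Z S : Bd (fun Z S => x Z S + u Z S) Z S = Bd x Z S + Bd u Z S.
Proof. by rewrite /Bd; case: ifP; rewrite ?addr0 // big_split. Qed.

Lemma DlD x u Z S : Dl (fun Z S => x Z S + u Z S) Z S = Dl x Z S + Dl u Z S.
Proof. by rewrite /Dl; case: ifP; rewrite ?addr0 // big_split. Qed.

Lemma eq_Bd x u : x =2 u -> Bd x =2 Bd u.
Proof. by move=> xu Z S; rewrite /Bd; under eq_bigr do rewrite xu. Qed.

Lemma eq_Dl x u : x =2 u -> Dl x =2 Dl u.
Proof. by move=> xu Z S; rewrite /Dl; under eq_bigr do rewrite xu. Qed.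

Lemma Bd0 Z S : Bd (fun _ _ => 0) Z S = 0.
Proof. by rewrite /Bd big1 ?if_same. Qed.

Lemma supp_Bd a b x : supp a.+1 b x -> supp a b (Bd x).
Proof.
move=> sx Z S; rewrite /Bd; case: ifP => [/andP[kZ SZ]|_]; last by rewrite eqxx.
rewrite kZ SZ /=; apply: contraR => h0; apply/eqP/big1 => Y.
case/andP => kY /andP[_ /eqP rY]; apply: (supp0 sx).
by rewrite rY eqSS kY /=; apply: contra h0 => /and3P[-> _ ->].
Qed.

Lemma supp_Dl a b x : supp a b x -> supp a b.+1 (Dl x).
Proof.
move=> sx Z T; rewrite /Dl; case: ifP => [TZ|_]; last by rewrite eqxx.
move=> /=; apply: contraR => h0; apply/eqP/big1 => t tT.
apply: (supp0 sx); apply: contra h0 => /and4P[-> -> _ /eqP <-].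
by rewrite (cardsD1 t) tT eqxx.
Qed.

Lemma suppD a b x u : supp a b x -> supp a b u ->
  supp a b (fun Z S => x Z S + u Z S).
Proof.
move=> sx su Z S; apply: contraR => h0.
by rewrite (supp0 sx) // (supp0 su) // addr0.
Qed.

Lemma Dl_Bd x Z T : Dl (Bd x) Z T = Bd (Dl x) Z T.
Proof.
rewrite /Dl /Bd; case: (boolP (T \subset vert Z)) => TZ; last by rewrite andbF.
rewrite andbT; case: (boolP (face Z)) => kZ; last by rewrite big1.
under eq_bigr => t tT do rewrite (subset_trans (subsetDl _ _) TZ).
rewrite exchange_big /=; apply: eq_bigr => Y /andP[kY cZY].
by rewrite (subset_trans TZ (vertS (proper_sub (covers_proper cZY)))).
Qed.

Lemma Bd_Bd x Z S : Bd (Bd x) Z S = 0.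
Proof.
rewrite {1}/Bd; case: ifP => // /andP[kZ SZ].
rewrite -[RHS](coface_coface (fun Y => x Y S) kZ).
apply: eq_bigr => Y /andP[kY cZY]; rewrite /Bd kY.
by rewrite (subset_trans SZ (vertS (proper_sub (covers_proper cZY)))).
Qed.

Lemma Dl_Dl x Z T : Dl (Dl x) Z T = 0.
Proof.
rewrite {1}/Dl; case: ifP => // TZ; rewrite /Dl.
under eq_bigr => t tT do rewrite (subset_trans (subsetDl _ _) TZ).
rewrite pair_big_dep /=.
apply: (@sum_involution _ _ (fun p => (p.2, p.1))).
- move=> [t s] /=; rewrite !inE => /and3P[-> ts ->].
  by rewrite eq_sym ts.
- by case.
- move=> [t s] /=; rewrite !inE => /and3P[_ ts _].
  by apply: contra ts => /eqP[->].
- by move=> [t s] _ /=; congr (x Z _); rewrite !setDDl setUC.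
Qed.

(** The contraction of a row. The vertex [v] depends on [Z], so this does not commute with [Bd]; the
    discrepancy is what the descent passes on. *)
Definition cone_off x Z S := if [pick v in vert Z] is Some v then
  (if v \in S then 0 else x Z (v |: S)) else 0.

Lemma supp_cone_off a b x : supp a b.+1 x -> supp a b (cone_off x).
Proof.
move=> sx Z S; rewrite /cone_off; case: pickP => [v vZ|_]; last by rewrite eqxx.
case: ifPn => vS; first by rewrite eqxx.
case/sx/and4P => -> -> /(subset_trans (subsetUr _ _))-> /=.
by rewrite cardsU1 vS add1n eqSS.
Qed.

Lemma Dl_cone_off a b x : supp a b.+1 x -> (forall Z S, Dl x Z S = 0) ->
  Dl (cone_off x) =2 x.
Proof.
move=> sx Dx Z T; rewrite /Dl; case: ifPn => TZ; last first.
  by rewrite (supp0 sx) // (negPf TZ) !andbF.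
rewrite /cone_off; case: pickP => [v vZ|v0]; last first.
  have T0 : T = set0.
    apply/setP => i; rewrite inE; apply/negP => /(subsetP TZ) iZ.
    by have := v0 i; rewrite iZ.
  by rewrite T0 big_set0 (supp0 sx) // cards0 !andbF.
case: (boolP (v \in T)) => vT.
  rewrite (bigD1 v) //= !inE eqxx /= setD1K // big1 ?addr0 // => t /andP[tT tv].
  by rewrite !inE vT eq_sym tv.
(* Closedness at [v |: T] expresses [x Z T] through the sets containing [v]. *)
have := Dx Z (v |: T); rewrite /Dl subUset sub1set vZ TZ /=.
rewrite big_setU1 //= setU1K // => /eqP; rewrite addr_eq0 F2_opp => /eqP->.
apply: eq_bigr => t tT; rewrite !inE (negPf vT) andbF; congr (x Z _).
rewrite setDUl; congr (_ :|: _); apply/esym/setDidPl.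
by rewrite disjoint_sym disjoints1 inE; apply: contraNneq vT => <-.
Qed.

(** On the diagonal [x Z] lives only on the full vertex set of a simplex, which contains [v];
    removing [v] moves the coefficient without changing the total. *)
Lemma sum_cone_off b x Z : (b < e)%N -> supp b.+1 b.+1 x ->
  \sum_S cone_off x Z S = \sum_T x Z T.
Proof.
move=> be sx; rewrite /cone_off; case: pickP => [v vZ|v0]; last first.
  rewrite big1 // big1 // => T _; apply: (supp0 sx).
  apply/negP => /and4P[kZ _ TZ]; suff -> : T = set0 by rewrite cards0.
  apply/setP => i; rewrite inE; apply/negP => /(subsetP TZ) iZ.
  by have := v0 i; rewrite iZ.
rewrite [RHS](bigID (fun T : {set I} => v \in T)) /= [X in _ = _ + X]big1; last first.
  move=> T vT; apply: (supp0 sx); apply: contra vT.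
  case/and4P => kZ /eqP rZ TZ /eqP cT; suff -> : T = vert Z by [].
  by apply/eqP; rewrite eqEcard TZ cT low ?rZ /=.
rewrite addr0 [RHS](reindex_onto (fun S => v |: S) (fun T => T :\ v)) /=; last first.
  by move=> T vT; exact: setD1K.
rewrite [RHS]big_mkcond; apply: eq_bigr => S _; rewrite setU11 /=.
case: (boolP (v \in S)) => vS; last by rewrite setU1K // eqxx.
by case: eqP => // SE; move: vS; rewrite -SE !inE eqxx.
Qed.

(** Each [S] obtained by omitting one vertex of a simplex [Y] is the vertex set of exactly one facet
    of [Y], so each coefficient of [y] is counted once. *)
Lemma sum_Bd b (y : {set I} -> {set I} -> 'F_2) : (b < e)%N -> supp b.+1 b y ->
  \sum_Z \sum_S Bd y Z S = \sum_Y \sum_S y Y S.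
Proof.
move=> be sy; rewrite exchange_big [RHS]exchange_big /=; apply: eq_bigr => S _.
under eq_bigr => Z _ do rewrite /Bd.
rewrite -big_mkcond (exchange_big_dep xpredT) //=; apply: eq_bigr => Y _.
case: (eqVneq (y Y S) 0) => [->|/sy /and4P[kY /eqP rY SY /eqP cS]].
  exact: big1.
have sYr : #|vert Y| = rk Y by rewrite low // rY.
have rYS : rk Y = #|S|.+1 by rewrite cS.
have [kc cc rc] := simplex_facet kY sYr SY rYS.
rewrite (big_pred1 (closure S)) // => Z; rewrite kY /=.
apply/idP/eqP => [/andP[/andP[kZ SZ] cZ]|->].
  rewrite -(face_closure kZ); congr closure; apply/esym/eqP.
  rewrite eqEcard SZ cS; case/andP: cZ => _; rewrite rY eqSS => /eqP rZ.
  by rewrite low // -?rZ ?leqnn // ltnW.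
rewrite kc cc andbT sub_vert; have := SY; rewrite sub_vert => /andP[_ ->].
by rewrite andbT; apply/subsetP => i iS; rewrite inE mem_fspan.
Qed.

(** The total over a simplex [Z] is the value of [Dl x] at its full vertex set. With [sum_Bd] this
    makes the total vanish on boundaries. *)
Lemma sum_closed b x Z : (b < e)%N -> supp b.+1 b x ->
  (forall Z S, Dl x Z S = 0) -> \sum_S x Z S = 0.
Proof.
move=> be sx Dx; case: (boolP (face Z && (rk Z == b.+1))) => [/andP[kZ /eqP rZ]|h0].
  have cW : #|vert Z| = b.+1 by rewrite low ?rZ.
  have := Dx Z (vert Z); rewrite /Dl subxx => D0; apply: etrans D0.
  rewrite (bigID (fun S => S \in [set vert Z :\ t | t in vert Z])) /= [X in _ + X]big1.
    rewrite addr0 big_imset //= => t t' tZ t'Z tt'.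
    apply: contraTeq tZ => tn; have := congr1 (fun S : {set I} => t \in S) tt'.
    by rewrite !in_setD1 eqxx tn /= => <-.
  move=> S /imsetP Sn; apply: (supp0 sx); apply/negP => /and4P[_ _ SZ /eqP cS].
  have [t tZ tS] : exists2 t, t \in vert Z & t \notin S.
    apply/subsetPn; apply/negP => /subset_leq_card.
    by rewrite cW cS ltnn.
  apply: Sn; exists t => //; apply/eqP; rewrite eqEcard.
  rewrite [X in _ && (X <= _)%N](_ : _ = b) ?cS ?leqnn ?andbT; last first.
    by have := cardsD1 t (vert Z); rewrite tZ cW add1n => -[<-].
  apply/subsetP => i iS; rewrite !in_setD1 (subsetP SZ) // andbT.
  by apply: contraNneq tS => <-.
rewrite big1 // => S _; apply: (supp0 sx); apply: contra h0.
by case/and4P => -> ->.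
Qed.

(** A set [S] that carries a nonzero coefficient lies in a proper face, so the cone of functionals
    vanishing on [S] is nontrivial and [coface_exact] applies. Fillings are chosen for each [S]
    separately and truncated to the bidegree. *)
Lemma column_exact (i j : nat) (y : {set I} -> {set I} -> 'F_2) : (i < e)%N -> supp i j y ->
  (forall Z S, Bd y Z S = 0) ->
  exists u, supp i.+1 j u /\ Bd u =2 y.
Proof.
move=> ie sy By.
have /choice[g gE] : forall S, exists g : {set I} -> 'F_2, forall Z,
    face Z -> S \subset Z -> y Z S = \sum_(Y | face Y && covers Z Y) g Y.
  move=> S.
  case: (boolP [exists Z, y Z S != 0]) => [/existsP[Z yZ]|/existsPn y0]; last first.
    exists (fun=> 0) => Z _ _; rewrite big1 //.
    by have := y0 Z; rewrite negbK => /eqP.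
  have /and4P[kZ /eqP rZ SZ cS] := sy Z S yZ.
  have [|||g gE] := @coface_exact _ _ _ l setT S (fun Y => y Y S).
  - exact: subsetT.
  - case/keyP: (kZ) => w wZ; exists w; split.
    + exact: covector_nonneg wZ.
    + move=> s /(subsetP SZ); rewrite inE => /andP[sZ _].
      by case: wZ => _ w0 _; exact: w0.
    + have /subsetPn[a _ aZ] : ~~ (setT \subset Z).
        apply/negP => /(rkS l); rewrite rZ => h2.
        by move: (leq_trans e_lt h2); rewrite ltnNge ltnW.
      by exists a; rewrite ?inE // (covector_eq0 wZ) ?inE.
  - move=> X kX SX; have := By X S; rewrite /Bd kX sub_vert SX.
    by have := SZ; rewrite sub_vert => /andP[_ ->].
  - by exists g.
exists (fun Z S => if [&& face Z, rk Z == i.+1, S \subset vert Z & #|S| == j]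
  then g S Z else 0); split=> Z S; first by case: ifP; rewrite ?eqxx.
rewrite /Bd; case: ifPn => [/andP[kZ SZ]|h0]; last first.
  rewrite (supp0 sy) //; apply: contra h0 => /and4P[-> _ -> _] //.
case: (boolP ((rk Z == i) && (#|S| == j))) => [/andP[/eqP rZ cS]|h0].
  have := SZ; rewrite sub_vert => /andP[S1 S2].
  rewrite (gE S Z) //; apply: eq_bigr => Y /andP[kY cZY].
  case/andP: (cZY) => ZY /eqP ->.
  by rewrite kY rZ eqxx cS (subset_trans SZ (vertS ZY)).
rewrite (supp0 sy); last by apply: contra h0 => /and4P[_ -> _ ->].
apply: big1 => Y /andP[kY /andP[ZY /eqP ->]]; rewrite eqSS.
by case: ifP => // /and4P[_ rZ _ cS]; rewrite rZ cS in h0.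
Qed.

Theorem double_complex_exact (j i : nat) x : (j <= i)%N -> (i < e)%N -> supp i j x ->
  (forall Z S, Dl x Z S = 0) -> (forall Z S, Bd x Z S = 0) ->
  (i = j -> \sum_Z \sum_S x Z S = 0) ->
  exists u, [/\ supp i.+1 j u, forall Z S, Dl u Z S = 0 & Bd u =2 x].
Proof.
elim: j i x => [|j IH] i x ji ie sx Dx Bx sumx.
  (* For [j = 0], evaluating [Dl] at a single vertex kills [x] on every nonempty face; on the empty
     face the coefficient equals the total. *)
  have x0 Z S : Z != set0 -> x Z S = 0.
    move=> Z0; apply/eqP; apply: contraT => xZ.
    have /and4P[kZ _ SZ /eqP/cards0_eq S0] := sx _ _ xZ.
    have /set0Pn[v vZ] := face_vertex kZ Z0.
    have := Dx Z [set v]; rewrite /Dl sub1set vZ big_set1 setDv -S0 => x0.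
    by rewrite x0 eqxx in xZ.
  have x00 : x set0 set0 = 0.
    apply/eqP; apply: contraT => xn; have /and4P[_ /eqP r0 _ _] := sx _ _ xn.
    rewrite rk0 in r0; case/eqP: xn; rewrite -[RHS]sumx // (bigD1 set0) //=.
    rewrite [X in _ + X]big1 => [|Z Z0]; last by apply: big1 => S _; exact: x0.
    rewrite addr0 (bigD1 set0) //= big1 ?addr0 // => S S0.
    by rewrite (supp0 sx) // cards_eq0 (negPf S0) !andbF.
  exists (fun _ _ => 0); split=> [Z S|Z S|Z S]; first by rewrite eqxx.
    by rewrite /Dl big1 ?if_same.
  rewrite Bd0; case: (eqVneq Z set0) => [->|/x0->//].
  case: (eqVneq S set0) => [->//|S0].
  by rewrite (supp0 sx) // cards_eq0 (negPf S0) !andbF.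
case: i ji ie sx sumx => // i; rewrite ltnS => ji ie sx sumx.
(* [Bd y] is closed and a cycle, so induction gives a closed [w] with [Bd w = Bd y]. Then [y + w] is
   a column cycle [Bd u0] whose [Dl] is still [x], and [Dl u0] is the filling. *)
pose y := cone_off x.
have sy : supp i.+1 j y := supp_cone_off sx.
have Dy : Dl y =2 x := Dl_cone_off sx Dx.
have [||||||w [sw Dw Bw]] := IH i (Bd y).
- by [].
- exact: ltnW.
- exact: supp_Bd.
- by move=> Z S; rewrite Dl_Bd (eq_Bd Dy).
- exact: Bd_Bd.
- move=> ij; rewrite ij in sy sx ie sumx.
  rewrite (sum_Bd (ltnW ie) sy); apply: etrans (sumx (erefl _)).
  by apply: eq_bigr => Z _; exact: sum_cone_off (ltnW ie) sx.
have [||u0 [su0 Bu0]] := @column_exact i.+1 j (fun Z S => y Z S + w Z S) ie.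
- exact: suppD.
- by move=> Z S; rewrite BdD Bw F2_addrr.
exists (Dl u0); split=> [|Z S|Z S]; first exact: supp_Dl.
  exact: Dl_Dl.
by rewrite -Dl_Bd (eq_Dl Bu0) DlD Dy Dw addr0.
Qed.
End DoubleComplex.
End Vertices.

(** * Exterior powers over F_2 *)

Section AlternatingSums.
Variables (I : finType) (q : nat).
Implicit Types (S T : {set I}) (p k : {ffun 'I_q -> I}).
Implicit Types (m : 'I_q -> I -> 'F_2).

Definition inj_into S p := injectiveb p && [forall i, p i \in S].

(* When [#|S| = q.+1] this is, mod 2, the determinant of the matrix obtained
   from the columns of [m] in [S] by adding a row of ones: it does not depend
   on an order of [S], and is invariant under adding constants to the rows. *)
Definition alt S m : 'F_2 := \sum_(p | inj_into S p) \prod_i m i (p i).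

Lemma inj_intoP S p : reflect (injective p /\ forall i, p i \in S) (inj_into S p).
Proof.
apply: (iffP andP) => [[/injectiveP pi /forallP pS]|[pi pS]]; split=> //.
  exact/injectiveP.
exact/forallP.
Qed.

Lemma card_inj_image p : injective p -> #|[set p i | i : 'I_q]| = q.
Proof. by move=> pi; rewrite card_imset // card_ord. Qed.

Lemma eq_alt S m m' : (forall i s, s \in S -> m i s = m' i s) ->
  alt S m = alt S m'.
Proof.
move=> mm; apply: eq_bigr => p /inj_intoP[_ pS]; apply: eq_bigr => i _.
exact: mm.
Qed.

Lemma alt_row S m m1 m2 i0 :
  (forall i s, i != i0 -> m1 i s = m i s /\ m2 i s = m i s) ->
  (forall s, s \in S -> m i0 s = m1 i0 s + m2 i0 s) ->
  alt S m = alt S m1 + alt S m2.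
Proof.
move=> off on; rewrite /alt -big_split /=; apply: eq_bigr => p /inj_intoP[_ pS].
rewrite !(bigD1 i0 (P := xpredT)) //= on // mulrDl; congr (_ * _ + _ * _).
  by apply: eq_bigr => i /off-/(_ (p i))[-> _].
by apply: eq_bigr => i /off-/(_ (p i))[_ ->].
Qed.

Lemma alt_scale_row S m m1 i0 a :
  (forall i s, i != i0 -> m1 i s = m i s) ->
  (forall s, s \in S -> m i0 s = a * m1 i0 s) ->
  alt S m = a * alt S m1.
Proof.
move=> off on; rewrite /alt mulr_sumr; apply: eq_bigr => p /inj_intoP[_ pS].
rewrite !(bigD1 i0 (P := xpredT)) //= on // mulrA; congr (_ * _).
by apply: eq_bigr => i /off-/(_ (p i))->.
Qed.

(** An injection into [S] misses one element; exchanging it with the value at [i0] is an involution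
    preserving the product, since row [i0] is constant. *)
Lemma alt_const S m i0 c : #|S| = q.+1 -> (forall s, s \in S -> m i0 s = c) ->
  alt S m = 0.
Proof.
move=> cS mc; pose im p := [set p i | i : 'I_q].
have imS p : inj_into S p -> im p \subset S.
  by case/inj_intoP => _ pS; apply/subsetP => s /imsetP[i _ ->].
have cD p : inj_into S p -> #|S :\: im p| = 1%N.
  move=> pP; rewrite cardsD (setIidPr (imS p pP)) cS card_inj_image ?subSn //.
    by rewrite subnn.
  by case/inj_intoP: pP.
pose other p := odflt (p i0) [pick s in S :\: im p].
have otherP p : inj_into S p -> other p \in S :\: im p.
  move=> pP; rewrite /other; case: pickP => [s //|none].
  have /eqP/cards1P[s sE] := cD p pP; have := none s.
  by rewrite sE set11.
have otherE p s : inj_into S p -> s \in S :\: im p -> s = other p.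
  move=> pP sD; have := otherP p pP; have /eqP/cards1P[r rE] := cD p pP.
  by rewrite rE in sD *; move: sD => /set1P-> /set1P->.
pose t p := [ffun i => if i == i0 then other p else p i].
have tP p : inj_into S p -> inj_into S (t p).
  move=> pP; have := otherP p pP; rewrite inE => /andP[oi oS].
  case/inj_intoP: pP => pi pS; apply/inj_intoP; split=> [i j|i]; last first.
    by rewrite ffunE; case: eqP.
  have nim a : p a != other p.
    by apply: contra oi => /eqP<-; apply/imsetP; exists a.
  rewrite !ffunE; case: eqP => [->|_]; case: eqP => [->|_] //.
  - by move/eqP; rewrite eq_sym (negPf (nim j)).
  - by move/eqP; rewrite (negPf (nim i)).
  - exact: pi.
apply: (@sum_involution _ _ t) => // p pP.
- have /inj_intoP[pi pS] := pP; have := otherP p pP; rewrite inE => /andP[oi oS].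
  have oE : p i0 = other (t p).
    apply: otherE; first exact: tP.
    rewrite inE pS andbT; apply/imsetP => -[i _]; rewrite ffunE.
    case: eqP => [_ e|ii0 /pi/esym//]; case/negP: oi; rewrite -e.
    by apply/imsetP; exists i0.
  by apply/ffunP => i; rewrite !ffunE -oE; case: eqP => // ->.
- have := otherP p pP; rewrite inE => /andP[oi oS].
  apply: contra oi => /eqP/ffunP/(_ i0); rewrite ffunE eqxx => ->.
  by apply/imsetP; exists i0.
- have := otherP p pP; rewrite inE => /andP[oi oS].
  have /inj_intoP[pi pS] := pP.
  rewrite !(bigD1 i0 (P := xpredT)) //= ffunE eqxx !mc //; congr (_ * _).
  by apply: eq_bigr => i /negPf ii; rewrite ffunE ii.
Qed.

(** Rows are shifted one at a time ([mn n] has the first [n] shifted); each step changes the sum by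
    an [alt] with a constant row. *)
Lemma alt_shift S m m' : #|S| = q.+1 ->
  (forall i, exists c, forall s, s \in S -> m' i s = m i s + c) ->
  alt S m' = alt S m.
Proof.
move=> cS mm; pose mn n (i : 'I_q) s := if (i < n)%N then m' i s else m i s.
suff E n : alt S (mn n) = alt S m.
  by rewrite -(E q); apply: eq_alt => i s _; rewrite /mn ltn_ord.
elim: n => [|n IH]; first exact: eq_alt.
case: (ltnP n q) => nq; last first.
  rewrite -IH; apply: eq_alt => i s _.
  by rewrite /mn !(leq_trans (ltn_ord i)) // (leq_trans nq).
pose i0 := Ordinal nq; have [c cE] := mm i0.
rewrite (@alt_row S (mn n.+1) (mn n) (fun i s => if i == i0 then c else mn n i s) i0).
- rewrite IH [X in _ + X](@alt_const S _ i0 c) ?addr0 // => s _.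
  by rewrite eqxx.
- move=> i s ii0; rewrite (negPf ii0); suff E : (i < n.+1)%N = (i < n)%N.
    by rewrite /mn E.
  rewrite ltnS leq_eqVlt; case: eqP => // ein; case/eqP: ii0; exact: val_inj.
- by move=> s sS; rewrite /mn /= ltnSn ltnn eqxx cE.
Qed.

Lemma alt_eq_rows S m i j : i != j -> (forall s, m i s = m j s) -> alt S m = 0.
Proof.
move=> ij mij; pose t p : {ffun 'I_q -> I} := [ffun a => p (tperm i j a)].
apply: (@sum_involution _ _ t) => p /inj_intoP[pi pS].
- apply/inj_intoP; split=> [a b|a]; rewrite !ffunE //.
  by move/pi/perm_inj.
- by apply/ffunP => a; rewrite !ffunE tpermK.
- apply/eqP => /ffunP/(_ i); rewrite ffunE tpermL => /pi/esym/eqP.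
  by rewrite (negPf ij).
- rewrite (reindex_inj (@perm_inj _ (tperm i j))) /=; apply: eq_bigr => a _.
  rewrite ffunE tpermK; case: tpermP => [->|->|//]; first by rewrite mij.
  by rewrite -mij.
Qed.

(** An injection of [q] indices into [q.+2] elements avoids exactly two of them, so its product
    occurs twice. *)
Lemma alt_closed T m : #|T| = q.+2 -> \sum_(t in T) alt (T :\ t) m = 0.
Proof.
move=> cT; rewrite /alt (exchange_big_dep (inj_into T)) /=; last first.
  move=> t p tT /inj_intoP[pi pS]; apply/inj_intoP; split=> // i.
  by have := pS i; rewrite inE => /andP[].
apply: big1 => p /inj_intoP[pi pT]; rewrite sumr_const.
have -> : #|[pred t in T | inj_into (T :\ t) p]| = 2%N; last first.
  by rewrite mulr2n F2_addrr.
rewrite (eq_card (B := T :\: [set p i | i : 'I_q])).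
  rewrite cardsD (setIidPr _); first by rewrite cT card_inj_image // -addn2 addKn.
  by apply/subsetP => s /imsetP[i _ ->].
move=> t; rewrite !inE andbC; congr (_ && _); apply/inj_intoP/negP.
  by move=> [_ pt] /imsetP[i _ ti]; have := pt i; rewrite !inE ti eqxx.
move=> h; split=> // i; rewrite !inE pT andbT; apply/eqP => e.
by apply: h; apply/imsetP; exists i.
Qed.

Lemma alt_delta S m k : (forall i s, s \in S -> m i s = (k i == s)%:R) ->
  alt S m = (inj_into S k)%:R.
Proof.
move=> mE; rewrite /alt big_mkcond (bigD1 k) //= [X in _ + X]big1 ?addr0.
  case: ifP => // /inj_intoP[_ kS].
  by rewrite big1 // => i _; rewrite mE // eqxx.
move=> p pk; case: ifP => // /inj_intoP[_ pS].
have [i ki] : exists i, k i != p i.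
  apply/existsP; apply: contraNT pk => /existsPn h; apply/eqP/ffunP => i.
  by have := h i; rewrite negbK => /eqP.
by rewrite (bigD1 i) //= mE // (negPf ki) mul0r.
Qed.
End AlternatingSums.

(** * Exterior powers: symmetry, generators, universal property *)

Section ExteriorPowerMaps.
Variables (q : nat) (vT : vectType 'F_2).
Implicit Types (t : tuples q vT) (i j : 'I_q) (u v : vT).

Lemma wedge_multilinear t i (a : 'F_2) u v :
  wedge (upd t i (a *: u + v)) = a *: wedge (upd t i u) + wedge (upd t i v).
Proof.
apply/eqP; rewrite -subr_eq0 /wedge -linearP -linearB -memv_ker lker_quot_pi.
apply: (subvP (addvSl _ _)).
rewrite memvE /multilinear_rel (sumv_sup t) // (sumv_sup i) //.
rewrite (sumv_sup a) // (sumv_sup (u : finvect_type vT)) //.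
by rewrite (sumv_sup (v : finvect_type vT)).
Qed.

Lemma wedge_alternating t i j : i != j -> t i = t j -> wedge t = 0.
Proof.
move=> ij tij; apply/eqP; rewrite /wedge -memv_ker lker_quot_pi.
apply: (subvP (addvSr _ _)); rewrite memvE (sumv_sup t) //.
by apply/existsP; exists i; apply/existsP; exists j; rewrite ij tij eqxx.
Qed.

Lemma upd_id t i : upd t i (t i) = t.
Proof. by apply/ffunP => k; rewrite ffunE; case: eqP => // ->. Qed.

(** Expand the vanishing wedge with [t i + t j] in both slots; mod 2 no sign remains. *)
Lemma wedge_tperm t i j : wedge [ffun k => t (tperm i j k)] = wedge t.
Proof.
case: (eqVneq i j) => [->|ij].
  by congr wedge; apply/ffunP => k; rewrite ffunE tperm1 perm1.
pose w u v := wedge (upd (upd t i u) j v).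
have wE u v : w u v = wedge (upd (upd t j v) i u).
  congr wedge; apply/ffunP => k; rewrite !ffunE.
  by case: eqP => // ->; rewrite eq_sym (negPf ij).
have w0 u : w u u = 0.
  by apply: (wedge_alternating ij); rewrite !ffunE !eqxx (negPf ij).
have wr u v v' : w u (v + v') = w u v + w u v'.
  by rewrite /w -[X in upd _ _ (X + _)]scale1r wedge_multilinear scale1r.
have wl u u' v : w (u + u') v = w u v + w u' v.
  by rewrite !wE -[X in upd _ _ (X + _)]scale1r wedge_multilinear scale1r.
have -> : wedge t = w (t i) (t j).
  congr wedge; rewrite upd_id; apply/ffunP => k; rewrite !ffunE.
  by case: eqP => // ->.
have -> : wedge [ffun k => t (tperm i j k)] = w (t j) (t i).
  congr wedge; apply/ffunP => k; rewrite !ffunE.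
  case: tpermP => [->|->|/eqP ki /eqP kj]; rewrite ?eqxx ?(negPf ij) //.
  by rewrite (negPf ki) (negPf kj).
have := w0 (t i + t j); rewrite wr !wl !w0 add0r addr0 => /eqP.
rewrite addr_eq0 => /eqP->.
by rewrite -scaleN1r F2_opp scale1r.
Qed.

Lemma wedge_perm t (s : 'S_q) : wedge [ffun k => t (s k)] = wedge t.
Proof.
have [ts -> _] := prod_tpermP s; elim: ts t => [|[i j] ts IH] t.
  by rewrite big_nil; congr wedge; apply/ffunP => k; rewrite ffunE perm1.
rewrite big_cons -[RHS]IH -[RHS](wedge_tperm _ i j); congr wedge.
by apply/ffunP => k; rewrite !ffunE permM.
Qed.

Lemma ext_generated (wT : vectType 'F_2) (f g : 'Hom(ext q vT, wT)) :
  (forall t, f (wedge t) = g (wedge t)) -> f = g.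
Proof.
move=> fg; have E : (f \o quot_pi (ext_rel q vT) = g \o quot_pi (ext_rel q vT))%VF.
  apply: free_on_ext => t; rewrite [LHS]comp_lfunE [RHS]comp_lfunE; exact: fg.
apply/lfunP => x; rewrite -(quot_piK x) -[LHS]comp_lfunE -[RHS]comp_lfunE.
by have := congr1 (fun F : 'Hom(_, _) => F (vsval x)) E.
Qed.

(** Slots are freed one at a time: those below [n] are arbitrary, the others lie in [X], and
    linearity in one slot passes from [X] to its span. *)
Lemma ext_generated_span (wT : vectType 'F_2) (X : seq vT)
    (f g : 'Hom(ext q vT, wT)) : <<X>>%VS = fullv ->
  (forall t, (forall i, (t i : vT) \in X) -> f (wedge t) = g (wedge t)) -> f = g.
Proof.
move=> spanX fg; apply: ext_generated => t.
suff E n t' : (forall i : 'I_q, (n <= i)%N -> (t' i : vT) \in X) ->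
    f (wedge t') = g (wedge t').
  by apply: (E q) => i; rewrite leqNgt ltn_ord.
elim: n t' => [|n IH] {}t tX; first by apply: fg => i; exact: tX.
case: (ltnP n q) => nq; last first.
  by apply: IH => i ni; have := ltn_ord i; rewrite ltnNge (leq_trans nq ni).
pose i0 := Ordinal nq; rewrite -(upd_id t i0); move: (t i0 : vT) => v.
pose D u := f (wedge (upd t i0 u)) - g (wedge (upd t i0 u)).
have DX u : u \in X -> D u = 0.
  move=> uX; apply/eqP; rewrite subr_eq0; apply/eqP/IH => i ni.
  rewrite ffunE; case: eqP => // /eqP ii0; apply: tX; rewrite ltn_neqAle ni andbT.
  by apply: contra ii0 => /eqP e; apply/eqP/val_inj.
have DP a u u' : D (a *: u + u') = a *: D u + D u'.
  by rewrite /D wedge_multilinear [f _]linearP [g _]linearP /= opprD addrACA scalerBr.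
have D0 : D 0 = 0.
  have := DP 1 0 0; rewrite !scale1r addr0 => /eqP.
  by rewrite -subr_eq0 opprD addrA subrr sub0r oppr_eq0 => /eqP.
suff : D v = 0 by move/eqP; rewrite subr_eq0 => /eqP.
have /coord_span -> : v \in <<in_tuple X>>%VS by rewrite spanX memvf.
elim/big_ind: _ => [//|u u' du du'|k _].
  by rewrite -[u]scale1r DP du du' scaler0 addr0.
rewrite -[_ *: _]addr0 DP D0 addr0 DX ?scaler0 //.
by apply: mem_nth; exact: ltn_ord.
Qed.

Definition ext_lift_fun (wT : vectType 'F_2) (m : tuples q vT -> wT)
  (x : free_on q vT) : wT := \sum_(t : tuples q vT) x t *: m t.

Fact ext_lift_linear (wT : vectType 'F_2) (m : tuples q vT -> wT) :
  linear (ext_lift_fun m).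
Proof.
move=> a x y; rewrite /ext_lift_fun scaler_sumr -big_split /=.
by apply: eq_bigr => t _; rewrite !ffunE scalerDl scalerA.
Qed.

HB.instance Definition _ (wT : vectType 'F_2) (m : tuples q vT -> wT) :=
  GRing.isLinear.Build 'F_2 (free_on q vT) wT _ (ext_lift_fun m)
    (ext_lift_linear m).

(** Evaluates [m] on the representative chosen by the quotient, so it is the map of the universal
    property once [m] is multilinear and alternating. *)
Definition ext_lift (wT : vectType 'F_2) (m : tuples q vT -> wT) :
    'Hom(ext q vT, wT) :=
  (linfun (ext_lift_fun m) \o linfun (vsval : ext q vT -> free_on q vT))%VF.

Lemma ext_lift_wedge (wT : vectType 'F_2) (m : tuples q vT -> wT) :
  (forall t i (a : 'F_2) u v,
     m (upd t i (a *: u + v)) = a *: m (upd t i u) + m (upd t i v)) ->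
  (forall t i j, i != j -> t i = t j -> m t = 0) ->
  forall t, ext_lift m (wedge t) = m t.
Proof.
move=> mm ma t; pose L := linfun (ext_lift_fun m).
have -> : ext_lift m (wedge t) = L (vsval (wedge t)).
  by rewrite [LHS]comp_lfunE; congr (L _); rewrite lfunE.
have Lg s : L (gen s) = m s.
  rewrite lfunE /= /ext_lift_fun (bigD1 s) //= big1 ?addr0 => [|r rs].
    by rewrite ffunE eqxx scale1r.
  by rewrite ffunE (negPf rs) scale0r.
have Lr : (ext_rel q vT <= lker L)%VS.
  rewrite /ext_rel subv_add; apply/andP; split; last first.
    apply/subv_sumP => s /existsP[i /existsP[j /andP[ij /eqP sij]]].
    rewrite -memvE memv_ker; apply/eqP; apply: etrans (ma s i j ij sij); exact: Lg.
  apply/subv_sumP => s _; apply/subv_sumP => i _; apply/subv_sumP => a _.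
  apply/subv_sumP => u _; apply/subv_sumP => v _.
  rewrite -memvE memv_ker linearB linearD linearZ /=; apply/eqP.
  rewrite -(subrr (m (upd s i (a *: u + v)))) {2}mm.
  by congr (_ - (_ *: _ + _)); exact: Lg.
have := subvP Lr _ (quot_piE (ext_rel q vT) (gen t)).
rewrite memv_ker linearB subr_eq0 => /eqP Le.
by apply: etrans (Lg t); exact: esym Le.
Qed.
End ExteriorPowerMaps.

(** * Alternating forms as coordinates on exterior powers *)

Section AlternatingForms.
Variables (I : finType) (q : nat).
Implicit Types (S T U : {set I}).

Definition alt_form (vT : vectType 'F_2) (c : I -> 'Hom(vT, ('F_2)^o)) S :
    'Hom(ext q vT, ('F_2)^o) :=
  ext_lift (fun t => alt S (fun i s => c s (t i)) : ('F_2)^o).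

Lemma alt_form_wedge (vT : vectType 'F_2) (c : I -> 'Hom(vT, ('F_2)^o)) S t :
  alt_form c S (wedge t) = alt S (fun i s => c s (t i)).
Proof.
apply: ext_lift_wedge => {t} [t i a u v|t i j ij tij]; last first.
  by apply: (alt_eq_rows _ ij) => s; rewrite tij.
pose m0 w (k : 'I_q) s : 'F_2 := c s (upd t i w k).
rewrite -[LHS]/(alt S (m0 _)).
rewrite (@alt_row _ _ S _ (fun k s => if k == i then a * m0 u k s else m0 u k s)
  (m0 v) i).
- congr (_ + _); apply: (@alt_scale_row _ _ S _ (m0 u) i) => [k s /negPf->|s _] //.
  by rewrite eqxx.
- by move=> k s ki; rewrite /m0 !ffunE (negPf ki).
- by move=> s _; rewrite /m0 !ffunE eqxx linearP.
Qed.

(** Coordinates only have to match up to a constant for each vector, which [alt_shift] absorbs. *)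
Lemma alt_form_map (vT wT : vectType 'F_2) (c : I -> 'Hom(vT, ('F_2)^o))
    (c' : I -> 'Hom(wT, ('F_2)^o)) (g : 'Hom(vT, wT)) S y : #|S| = q.+1 ->
  (forall x, exists k : 'F_2, forall s, s \in S -> c' s (g x) = c s x + k) ->
  alt_form c' S (ext_map q g y) = alt_form c S y.
Proof.
move=> cS h; rewrite -comp_lfunE; congr (fun_of_lfun _ y).
apply: ext_generated => t; rewrite comp_lfunE ext_map_wedge !alt_form_wedge.
apply: alt_shift => // i; have [k kE] := h (t i).
by exists k => s sS; rewrite ffunE kE.
Qed.

Lemma alt_form_closed (vT : vectType 'F_2) (c : I -> 'Hom(vT, ('F_2)^o)) T x :
  #|T| = q.+2 -> \sum_(t in T) alt_form c (T :\ t) x = 0.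
Proof.
move=> cT; suff : \sum_(t in T) alt_form c (T :\ t) = 0.
  by move=> /(congr1 (fun F : 'Hom(_, _) => F x)); rewrite sum_lfunE zero_lfunE.
apply: ext_generated => t; rewrite sum_lfunE zero_lfunE.
under eq_bigr do rewrite alt_form_wedge.
exact: alt_closed.
Qed.

Section Simplex.
(** The model is [F_2^W] modulo the all-ones vector: [e u] is the class of a unit vector, [c v] a
    coordinate known up to a common constant, and [c u + c v0] the honest coordinate on the basis
    indexed by [W :\ v0]. *)
Variables (vT : vectType 'F_2) (c : I -> 'Hom(vT, ('F_2)^o)) (e : I -> vT).
Variables (W : {set I}) (v0 : I).
Hypothesis v0W : v0 \in W.
Hypothesis dual : forall u, u \in W :\ v0 -> exists k : 'F_2,
  forall v, v \in W -> c v (e u) = (u == v)%:R + k.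
Hypothesis gen_e : forall x, x = \sum_(u in W :\ v0) (c u x + c v0 x) *: e u.

Let wedge_e (k : {ffun 'I_q -> I}) : ext q vT := wedge [ffun i => e (k i)].

(** The enumeration of [U] is arbitrary, since [wedge_perm] makes the wedge independent of it. *)
Let wedge_set U : ext q vT :=
  if [pick k | inj_into U k] is Some k then wedge_e k else 0.

Lemma alt_form_basis S (k : {ffun 'I_q -> I}) : S \subset W -> #|S| = q.+1 ->
  (forall i, k i \in W :\ v0) -> alt_form c S (wedge_e k) = (inj_into S k)%:R.
Proof.
move=> SW cS kW; rewrite alt_form_wedge.
rewrite -(@alt_delta _ _ S (fun i s => (k i == s)%:R)) //.
apply: alt_shift => // i; have [a aE] := dual (kW i).
by exists a => s sS; rewrite ffunE aE // (subsetP SW).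
Qed.

Lemma wedge_set_image (k : {ffun 'I_q -> I}) : injective k ->
  wedge_set [set k i | i : 'I_q] = wedge_e k.
Proof.
move=> ki; rewrite /wedge_set; case: pickP => [k' /inj_intoP[ki' kS]|/(_ k)]; last first.
  by case/inj_intoP; split=> // i; apply/imsetP; exists i.
have ex i : exists j, k' i = k j by have /imsetP[j _ e'] := kS i; exists j.
have [f fE] := fin_all_exists ex.
have fi : injective f by move=> i j fij; apply: ki'; rewrite !fE fij.
rewrite /wedge_e -[RHS](wedge_perm _ (perm fi)); congr wedge.
by apply/ffunP => i; rewrite !ffunE permE fE.
Qed.

Lemma inj_into_U1 U (k : {ffun 'I_q -> I}) : (forall i, k i \in W :\ v0) ->
  inj_into (v0 |: U) k = inj_into U k.
Proof.
move=> kW; rewrite /inj_into; congr (_ && _); apply: eq_forallb => i.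
by have := kW i; rewrite !inE => /andP[/negPf->].
Qed.

Lemma inj_into_card U (k : {ffun 'I_q -> I}) : #|U| = q -> inj_into U k ->
  U = [set k i | i : 'I_q].
Proof.
move=> cU /inj_intoP[ki kU]; apply/esym/eqP.
rewrite eqEcard card_inj_image // cU leqnn andbT.
by apply/subsetP => s /imsetP[i _ ->].
Qed.

Let top U := (U \subset W :\ v0) && (#|U| == q).

(** The wedges over [q]-subsets [U] of [W :\ v0] are dual to the forms on [v0 |: U]: the extra
    element [v0] only borders the minor ([inj_into_U1]). By linearity it suffices to check wedges of
    the [e u]. *)
Lemma ext_simplex_expansion x :
  x = \sum_(U | top U) alt_form c (v0 |: U) x *: wedge_set U.
Proof.
pose g x := \sum_(U | top U) alt_form c (v0 |: U) x *: wedge_set U.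
have gL : linear g.
  move=> a y z; rewrite /g scaler_sumr -big_split /=; apply: eq_bigr => U _.
  by rewrite linearP scalerDl scalerA.
pose gl := GRing.isLinear.Build 'F_2 (ext q vT) (ext q vT) _ g gL.
pose G : {linear ext q vT -> ext q vT} := HB.pack g gl.
rewrite -/(g x) -[g x](lfunE G) -[LHS](id_lfunE x); congr (fun_of_lfun _ x).
apply: (@ext_generated_span _ _ _ [seq e u | u <- enum (W :\ v0)]).
  apply/eqP; rewrite eqEsubv subvf /=; apply/subvP => y _; rewrite (gen_e y).
  apply: memv_suml => u uW; apply/memvZ/memv_span/map_f.
  by rewrite mem_enum.
move=> t tX; have ex i : exists u, u \in W :\ v0 /\ (t i : vT) = e u.
  by have /mapP[u uW ->] := tX i; exists u; rewrite mem_enum in uW.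
have [k0 k0E] := fin_all_exists ex; pose k : {ffun 'I_q -> I} := [ffun i => k0 i].
have kW i : k i \in W :\ v0 by rewrite ffunE; case: (k0E i).
have -> : wedge t = wedge_e k.
  by congr wedge; apply/ffunP => i; rewrite !ffunE; case: (k0E i).
rewrite id_lfunE lfunE /= /g.
have formE U : top U ->
    alt_form c (v0 |: U) (wedge_e k) = (inj_into U k)%:R.
  case/andP => UW /eqP cU; rewrite alt_form_basis ?inj_into_U1 //.
    by rewrite subUset sub1set v0W (subset_trans UW (subD1set _ _)).
  rewrite cardsU1 cU; case: (boolP (v0 \in U)) => // /(subsetP UW).
  by rewrite !inE eqxx.
case: (boolP (injectiveb k)) => [/injectiveP ki|nki].
  rewrite (bigD1 [set k i | i : 'I_q]) /=; last first.
    rewrite /top card_inj_image // eqxx andbT.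
    by apply/subsetP => s /imsetP[i _ ->].
  rewrite formE; last first.
    rewrite /top card_inj_image // eqxx andbT.
    by apply/subsetP => s /imsetP[i _ ->].
  rewrite wedge_set_image //.
  have -> : inj_into [set k i | i : 'I_q] k.
    by apply/inj_intoP; split=> // i; apply/imsetP; exists i.
  rewrite scale1r big1 ?addr0 // => U /andP[tU Uk]; rewrite formE //.
  case: (boolP (inj_into U k)) => [|_]; last by rewrite scale0r.
  by case/andP: (tU) => _ /eqP cU /(inj_into_card cU) UE; rewrite UE eqxx in Uk.
rewrite big1 => [|U tU]; last by rewrite formE // /inj_into (negPf nki) scale0r.
have [i [j [ij kij]]] : exists i j, i != j /\ k i = k j.
  apply/not_existsP => h; case/injectiveP: nki => i j kij; apply/eqP.
  by apply: contraT => ij; case: (h i); exists j.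
by apply: (wedge_alternating ij); rewrite [LHS]ffunE [RHS]ffunE kij.
Qed.

Lemma alt_form_inj x :
  (forall S, S \subset W -> #|S| = q.+1 -> alt_form c S x = 0) -> x = 0.
Proof.
move=> x0; rewrite (ext_simplex_expansion x) big1 // => U /andP[UW /eqP cU].
rewrite x0 ?scale0r //.
  by rewrite subUset sub1set v0W (subset_trans UW (subD1set _ _)).
rewrite cardsU1 cU; case: (boolP (v0 \in U)) => // /(subsetP UW).
by rewrite !inE eqxx.
Qed.

(** Values on sets through [v0] can be prescribed by that duality. The other sets reduce to these,
    because [f] and the forms are both closed at [v0 |: S]. *)
Lemma alt_form_surj (f : {set I} -> 'F_2) :
  (forall T, T \subset W -> #|T| = q.+2 -> \sum_(t in T) f (T :\ t) = 0) ->
  exists x, forall S, S \subset W -> #|S| = q.+1 -> alt_form c S x = f S.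
Proof.
move=> f0; pose x := \sum_(U | top U) f (v0 |: U) *: wedge_set U.
have on S : S \subset W -> #|S| = q.+1 -> v0 \in S -> alt_form c S x = f S.
  move=> SW cS v0S; have cU : #|S :\ v0| = q.
    by have := cardsD1 v0 S; rewrite v0S cS add1n => -[<-].
  have tU : top (S :\ v0) by rewrite /top cU eqxx setSD.
  have setE U : top U -> alt_form c S (wedge_set U) = (U == S :\ v0)%:R.
    case/andP => UW /eqP cU'; rewrite /wedge_set; case: pickP => [k kU|none].
      have /inj_intoP[ki kUi] := kU.
      have kW i : k i \in W :\ v0 by apply: (subsetP UW).
      rewrite alt_form_basis // -[S in inj_into S k](setD1K v0S) inj_into_U1 //.
      congr (_%:R); congr nat_of_bool; apply/idP/eqP => [kS|<-//].
      by rewrite (inj_into_card cU' kU) (inj_into_card cU kS).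
    pose k : {ffun 'I_q -> I} := [ffun i => enum_val (cast_ord (esym cU') i)].
    have := none k; rewrite (_ : inj_into U k) //; apply/inj_intoP.
    split=> [i j|i]; rewrite !ffunE; last exact: enum_valP.
    by move=> /enum_val_inj/cast_ord_inj.
  rewrite /x linear_sum (bigD1 _ tU) /= linearZ /= setE // eqxx.
  rewrite big1 => [|U /andP[tU' /negPf UE]]; last by rewrite linearZ /= setE // UE scaler0.
  by rewrite addr0 setD1K // [_ *: _]mulr1.
exists x => S SW cS; case: (boolP (v0 \in S)) => v0S; first exact: on.
have cT : #|v0 |: S| = q.+2 by rewrite cardsU1 v0S cS add1n.
have TW : v0 |: S \subset W by rewrite subUset sub1set v0W.
have := alt_form_closed c x cT; have := f0 _ TW cT.
rewrite !big_setU1 //= !setU1K //.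
move=> /eqP; rewrite addr_eq0 F2_opp => /eqP-> /eqP.
rewrite addr_eq0 [X in _ == X]F2_opp => /eqP->; apply: eq_bigr => t tS.
apply: on.
- by apply: subset_trans (subD1set _ _) TW.
- by have := cardsD1 t (v0 |: S); rewrite setU1r // cT add1n => -[<-].
- by rewrite !inE eqxx andbT; apply: contraNneq v0S => ->.
Qed.
End Simplex.
End AlternatingForms.


From mathcomp Require Import finmap.
From mathcomp Require Import all_classical all_reals all_analysis.
From mathcomp Require Import zify.

Import numFieldNormedType.Exports.

Local Open Scope classical_set_scope.
Local Open Scope ring_scope.

(** * Faces and normal cones of a lattice polytope *)

Section DotProduct.
Variables (K : comNzRingType) (d : nat).
Implicit Types (x y z : 'rV[K]_d).

Definition dot x y : K := \sum_(i < d) x 0 i * y 0 i.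

Lemma dotC x y : dot x y = dot y x.
Proof. by apply: eq_bigr => i _; rewrite mulrC. Qed.

Lemma dotDr x y z : dot x (y + z) = dot x y + dot x z.
Proof. by rewrite /dot -big_split; apply: eq_bigr => i _; rewrite mxE mulrDr. Qed.

Lemma dotZr a x y : dot x (a *: y) = a * dot x y.
Proof. by rewrite /dot mulr_sumr; apply: eq_bigr => i _; rewrite mxE mulrCA. Qed.

Lemma dotDl x y z : dot (x + y) z = dot x z + dot y z.
Proof. by rewrite dotC dotDr !(dotC z). Qed.

Lemma dotZl a x y : dot (a *: x) y = a * dot x y.
Proof. by rewrite dotC dotZr dotC. Qed.

Lemma dotNr x y : dot x (- y) = - dot x y.
Proof. by rewrite -scaleN1r dotZr mulN1r. Qed.

Lemma dotNl x y : dot (- x) y = - dot x y.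
Proof. by rewrite -scaleN1r dotZl mulN1r. Qed.

Lemma dotBr x y z : dot x (y - z) = dot x y - dot x z.
Proof. by rewrite dotDr dotNr. Qed.

Lemma dotBl x y z : dot (x - y) z = dot x z - dot y z.
Proof. by rewrite dotDl dotNl. Qed.

Lemma dot0r x : dot x 0 = 0.
Proof. by rewrite /dot big1 // => i _; rewrite mxE mulr0. Qed.

Lemma dot_sumr (J : Type) (r : seq J) (P : pred J) (F : J -> 'rV[K]_d) x :
  dot x (\sum_(j <- r | P j) F j) = \sum_(j <- r | P j) dot x (F j).
Proof.
elim/big_rec2: _ => [|j a y _ <-]; first exact: dot0r.
by rewrite dotDr.
Qed.

Lemma dot_suml (J : Type) (r : seq J) (P : pred J) (F : J -> 'rV[K]_d) x :
  dot (\sum_(j <- r | P j) F j) x = \sum_(j <- r | P j) dot (F j) x.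
Proof. by rewrite dotC dot_sumr; apply: eq_bigr => j _; rewrite dotC. Qed.

End DotProduct.

Lemma dot_map (K K' : comNzRingType) (d : nat) (f : {rmorphism K -> K'})
    (x y : 'rV[K]_d) :
  dot (map_mx f x) (map_mx f y) = f (dot x y).
Proof.
by rewrite rmorph_sum; apply: eq_bigr => i _; rewrite !mxE rmorphM.
Qed.

Lemma pairing_dot (R : realType) (d : nat) (x y : 'rV[R]_d) :
  pairing x y = dot x y.
Proof. by []. Qed.

Lemma dot_xx_gt0 (R : realDomainType) (d : nat) (x : 'rV[R]_d) :
  x != 0 -> 0 < dot x x.
Proof.
move=> x0; have [i xi] : exists i, x 0 i != 0.
  apply/existsP; apply: contraNT x0 => /existsPn h; apply/eqP/rowP => i.
  by have := h i; rewrite negbK mxE => /eqP.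
rewrite /dot (bigD1 i) //= ltr_wpDr ?sumr_ge0 //.
  by move=> j _; rewrite -expr2 sqr_ge0.
by rewrite -expr2 exprn_even_gt0.
Qed.

Section Orthogonal.
Variables (R : realFieldType) (d : nat).
Implicit Types (U : {vspace 'rV[R]_d}) (x n : 'rV[R]_d).

Definition dots_fun U n : 'rV[R]_(\dim U) := \row_i dot (vbasis U)`_i n.

Fact dots_linear U : linear (dots_fun U).
Proof. by move=> a x y; apply/rowP => i; rewrite !mxE dotDr dotZr. Qed.

HB.instance Definition _ U := GRing.isLinear.Build R 'rV[R]_d
  'rV[R]_(\dim U) _ (dots_fun U) (dots_linear U).

Definition orthogonal U : {vspace 'rV[R]_d} := lker (linfun (dots_fun U)).

Lemma mem_orthogonal U n :
  n \in orthogonal U <-> forall x, x \in U -> dot x n = 0.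
Proof.
rewrite memv_ker lfunE /=; split=> [/eqP n0 x xU|n0].
  rewrite (coord_vbasis xU) dot_suml big1 // => i _; rewrite dotZl.
  by have /rowP/(_ i) := n0; rewrite !mxE => ->; rewrite mulr0.
apply/eqP/rowP => i; rewrite !mxE; apply/n0/vbasis_mem/mem_nth.
by rewrite size_tuple.
Qed.

Lemma dim_orthogonal U : (\dim (orthogonal U) + \dim U = d)%N.
Proof.
have dimd : \dim {: 'rV[R]_d} = d.
 by rewrite dimvf dim_matrix mul1r.
apply/eqP; rewrite eqn_leq; apply/andP; split.
  rewrite -[leqRHS]dimd -dimv_disjoint_sum ?dimvS ?subvf //.
  apply/eqP; rewrite -subv0; apply/subvP => x; rewrite memv_cap.
  case/andP => /mem_orthogonal x0 xU; rewrite memv0; apply: contraT => xn.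
  by have := dot_xx_gt0 xn; rewrite x0 // ltxx.
rewrite -[leqLHS]dimd -(limg_ker_dim (linfun (dots_fun U))) capfv leq_add2l.
apply: leq_trans (dimvS (subvf _)) _.
by rewrite dimvf dim_matrix mul1r.
Qed.
End Orthogonal.

(** * Homogenization: affine functions as functionals *)

Section PolytopePoints.
Variables (R : realType) (d : nat) (A : {fset 'rV[int]_d}).
Local Notation I := (fset_sub_type A).
Implicit Types (Z : {set I}) (i j : I) (n : 'rV[R]_d) (c : R).
Local Notation Delta := (@lattice_hull R d A).

Definition homog : vectType R := ('rV[R]_d * R^o)%type.

Definition lattice_point (i : I) : 'rV[R]_d := lat_real R (val i).
Local Notation pos := lattice_point.
(** At height 1 affine functions become linear functionals, and [rk] of a nonempty face becomes its
    dimension plus one. *)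
Definition lift1 (i : I) : homog := (pos i, 1).

Definition affine_fun n c (v : homog) : R^o := dot v.1 n + v.2 * c.

Fact affine_linear n c : linear (affine_fun n c).
Proof.
move=> a x y; rewrite /affine_fun /= dotDl dotZl mulrDl scalerDr /= addrACA.
by rewrite [_ *: (_ * _)]mulrA.
Qed.

HB.instance Definition _ n c := GRing.isLinear.Build R homog R^o _
  (affine_fun n c) (affine_linear n c).

Definition affine n c : 'Hom(homog, R^o) := linfun (affine_fun n c).

Lemma affineE n c (v : homog) : affine n c v = dot v.1 n + v.2 * c.
Proof. by rewrite lfunE. Qed.

Lemma ev_affine n c i : ev lift1 (affine n c) i = dot (pos i) n + c.
Proof. by rewrite ev_app affineE /= mul1r. Qed.

Lemma affine_surj (w : 'Hom(homog, R^o)) : exists n c, w = affine n c.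
Proof.
exists (\row_j w (delta_mx 0 j, 0)), (w (0, 1)); apply/lfunP => -[x t].
rewrite affineE /=.
have -> : (x, t) = \sum_j x 0 j *: (delta_mx 0 j, 0 : R^o) + t *: (0, 1) :> homog.
  rewrite [RHS]surjective_pairing /=; congr (_, _).
    by rewrite raddf_sum /= scaler0 addr0 {1}(row_sum_delta x).
  rewrite raddf_sum /= big1 => [|j _]; last by rewrite scaler0.
  by rewrite add0r [_ *: _]mulr1.
rewrite linearD linearZ linear_sum /=; congr (_ + _).
by apply: eq_bigr => j _; rewrite linearZ mxE.
Qed.
End PolytopePoints.

Section FacesAndNormalCones.
Variables (R : realType) (d : nat) (A : {fset 'rV[int]_d}).
Local Notation I := (fset_sub_type A).
Implicit Types (Z : {set I}) (i j : I) (n x : 'rV[R]_d) (c : R).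
Local Notation Delta := (@lattice_hull R d A).
Local Notation pos := (@lattice_point R d A).
Local Notation lift1 := (@lift1 R d A).
Local Notation face := (key lift1 [set: I]%SET).
Local Notation rk := (rk lift1).
Local Notation covers := (covers lift1).

Lemma hullP x : Delta x <-> exists w : I -> R,
  [/\ forall i, 0 <= w i, \sum_i w i = 1 & x = \sum_i w i *: pos i].
Proof.
split=> [[w [w0 w1 ->]]|[w [w0 w1 ->]]].
  exists (fun i => w (val i)); split=> [i||].
  - exact/w0/fsvalP.
  - by rewrite -w1 big_seq_fsetE.
  - by rewrite big_seq_fsetE.
pose w' a : R := if insub a is Some i then w i else 0.
have w'E i : w' (val i) = w i by rewrite /w' valK.
exists w'; split.
- by move=> a _; rewrite /w'; case: insubP.
- by rewrite big_seq_fsetE /= -w1; apply: eq_bigr => i _; rewrite w'E.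
- by rewrite big_seq_fsetE /=; apply: eq_bigr => i _; rewrite w'E.
Qed.

Lemma hull_pos i : Delta (pos i).
Proof.
apply/hullP; exists (fun j => (j == i)%:R); split=> [j||].
- exact: ler0n.
- by rewrite (bigD1 i) //= eqxx big1 ?addr0 // => j /negPf->.
- rewrite (bigD1 i) //= eqxx scale1r big1 ?addr0 // => j /negPf->.
  by rewrite scale0r.
Qed.

Lemma covector_affine Z n c : covector lift1 [set: I]%SET Z (affine n c) <->
  (forall i, 0 <= dot (pos i) n + c) /\
  (forall i, (dot (pos i) n + c == 0) = (i \in Z)).
Proof.
split=> [h|[n0 nZ]]; last first.
  split; first exact: finset.subsetT.
  - by move=> i; rewrite -nZ ev_affine => /eqP.
  - by move=> i _; rewrite -nZ ev_affine lt_def n0 => ->.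
split=> i.
  by have := covector_nonneg h (finset.in_setT i); rewrite ev_affine.
by rewrite -(covector_eq0 h (finset.in_setT i)) ev_affine.
Qed.

Lemma faceP Z : face Z <-> exists n c,
  (forall i, 0 <= dot (pos i) n + c) /\
  (forall i, (dot (pos i) n + c == 0) = (i \in Z)).
Proof.
split=> [/keyP[w]|[n [c h]]].
  by have [n [c ->]] := affine_surj w; move=> /covector_affine h; exists n, c.
by apply/keyP; exists (affine n c); apply/covector_affine.
Qed.

(** For empty [Z] this is the whole space, so the lemmas below ask for nonempty faces. *)
Definition ncone Z : set 'rV[R]_d :=
  [set n | forall i, i \in Z -> forall j, dot (pos i) n <= dot (pos j) n].

(** Inverse of [ncone] on nonempty faces. *)
Definition cone_face (s : set 'rV[R]_d) : {set I} :=
  finset (fun i => `[< forall n, s n -> forall j, dot (pos i) n <= dot (pos j) n >]).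

Lemma ncone_const Z n i j : ncone Z n -> i \in Z -> j \in Z ->
  dot (pos i) n = dot (pos j) n.
Proof. by move=> sn iZ jZ; apply/eqP; rewrite eq_le !sn. Qed.

Lemma ncone_affine Z n c : (forall i, 0 <= dot (pos i) n + c) ->
  (forall i, i \in Z -> dot (pos i) n + c = 0) -> ncone Z n.
Proof.
by move=> n0 nZ i /nZ iZ j; rewrite -(lerD2r c) iZ.
Qed.

Lemma cone_face_ncone Z : face Z -> Z != finset.set0 -> cone_face (ncone Z) = Z.
Proof.
move=> /faceP[n [c [n0 nZ]]] /set0Pn[k kZ]; apply/setP => i; rewrite inE.
apply/asboolP/idP => [h|iZ m sm j]; last exact: sm.
rewrite -nZ eq_le n0 andbT; have /eqP <- : dot (pos k) n + c == 0 by rewrite nZ.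
rewrite lerD2r; apply: h; apply: (@ncone_affine _ _ c) => // a.
by rewrite -nZ => /eqP.
Qed.

Lemma cone_faceS s t : s `<=` t -> cone_face t \subset cone_face s.
Proof.
move=> st; apply/fintype.subsetP => i; rewrite !inE => /asboolP h; apply/asboolP.
by move=> n /st; exact: h.
Qed.

Lemma ncone_face (X Z : {set I}) : face X -> face Z ->
  X != finset.set0 -> Z != finset.set0 ->
  is_face (ncone X) (ncone Z) <-> Z \subset X.
Proof.
move=> kX kZ X0 Z0; split=> [[u [c [_ e]]]|ZX].
  rewrite -(cone_face_ncone kX X0) -(cone_face_ncone kZ Z0).
  by apply: cone_faceS; rewrite e => n [].
have /set0Pn[a aZ] := Z0.
(* On the cone of [Z] every difference [pos b - pos a] pairs nonnegatively, so the sum vanishes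
   exactly when all points of [X] are minimal. *)
exists (\sum_(b in X) (pos b - pos a)), 0.
have pE n : pairing n (\sum_(b in X) (pos b - pos a)) =
    \sum_(b in X) (dot (pos b) n - dot (pos a) n).
  rewrite pairing_dot dot_sumr; apply: eq_bigr => b _.
  by rewrite dotBr !(dotC n).
split=> [n sn|].
  by rewrite pE sumr_ge0 // => b _; rewrite subr_ge0 sn.
apply/seteqP; split=> n /=.
  move=> sn; split; first by move=> i /(fintype.subsetP ZX); exact: sn.
  rewrite pE big1 // => b bX; apply/eqP; rewrite subr_eq0; apply/eqP.
  by apply: (ncone_const sn) => //; exact: fintype.subsetP aZ.
move=> [sn]; rewrite pE => /eqP; rewrite psumr_eq0 => [/allP e i iX j|b _]; last first.
  by rewrite subr_ge0 sn.
have := e i; rewrite mem_index_enum iX subr_eq0 => /(_ isT)/eqP->.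
exact: sn.
Qed.

(** Where a valid inequality is tight, it is tight at every point of positive weight. *)
Lemma face_combination F x : is_face F Delta -> F x -> exists w : I -> R,
  [/\ forall i, 0 <= w i, \sum_i w i = 1, x = \sum_i w i *: pos i &
      forall i, w i != 0 -> F (pos i)].
Proof.
move=> [u [c [uc FE]]]; rewrite FE => -[/hullP[w [w0 w1 ->]]].
rewrite pairing_dot dot_suml => wc; exists w; split=> // i wi.
have : \sum_j w j * (dot (pos j) u - c) = 0.
  under eq_bigr do rewrite mulrBr -dotZl.
  by rewrite big_split /= wc sumrN -mulr_suml w1 mul1r subrr.
move/eqP; rewrite psumr_eq0 => [/allP/(_ i)|j _]; last first.
  by rewrite mulr_ge0 // subr_ge0; exact/uc/hull_pos.
rewrite mem_index_enum mulf_eq0 (negPf wi) subr_eq0 => /(_ isT)/eqP wE.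
by split; [exact: hull_pos|].
Qed.

Lemma inner_normal_coneE F : is_face F Delta -> F !=set0 ->
  let Z := finset (fun i => `[< F (pos i) >]) in
  [/\ face Z, Z != finset.set0 & inner_normal_cone Delta F = ncone Z].
Proof.
move=> FD [x Fx] Z; have [u [c [uc FE]]] := FD.
have FiE i : F (pos i) <-> dot (pos i) u = c.
  by rewrite FE; split=> [[]//|]; split=> //; exact: hull_pos.
have uci i : c <= dot (pos i) u by exact/uc/hull_pos.
have Z0 : Z != finset.set0.
  have [w [w0 w1 _ wF]] := face_combination FD Fx.
  have [i wi] : exists i, w i != 0.
    apply/existsP; apply: contraT => /existsPn h; move/eqP: w1.
    rewrite big1 => [|i _]; first by rewrite eq_sym oner_eq0.
    by have := h i; rewrite negbK => /eqP.
  by apply/set0Pn; exists i; rewrite inE; exact/asboolP/wF.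
split=> //.
  apply/faceP; exists u, (- c); split=> i; first by rewrite subr_ge0.
  by rewrite inE subr_eq0; apply/eqP/asboolP => /FiE.
apply/seteqP; split=> n /= h.
  move=> i; rewrite inE => /asboolP Fi j.
  by have := h _ _ (hull_pos j) Fi; rewrite !pairing_dot.
move=> m m' /hullP[w [w0 w1 ->]] Fm'.
have [w' [w'0 w'1 -> w'F]] := face_combination FD Fm'.
rewrite !pairing_dot !dot_suml.
rewrite -[leLHS]mul1r -w1 mulr_suml; apply: ler_sum => j _.
rewrite dotZl ler_wpM2l // -[leRHS]mul1r -w'1 mulr_suml.
apply: ler_sum => i _; rewrite dotZl; case: (eqVneq (w' i) 0) => [->|wi].
  by rewrite !mul0r.
by rewrite ler_wpM2l //; apply: h; rewrite inE; exact/asboolP/w'F.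
Qed.

Lemma face_of_key Z : face Z -> Z != finset.set0 -> exists F,
  [/\ is_face F Delta, F !=set0 & forall i, F (pos i) <-> i \in Z].
Proof.
case/faceP => n [c [n0 nZ]] /set0Pn[k kZ].
have E i : Delta (pos i) /\ pairing (pos i) n = - c <-> i \in Z.
  rewrite -nZ addr_eq0; split=> [[_]|/eqP e]; first by rewrite pairing_dot => ->.
  by split; [exact: hull_pos|].
exists [set x | Delta x /\ pairing x n = - c]; split=> //.
- exists n, (- c); split=> // x /hullP[w [w0 w1 ->]].
  rewrite pairing_dot dot_suml -[leLHS]mul1r -w1 mulr_suml; apply: ler_sum => i _.
  by rewrite dotZl ler_wpM2l // -subr_ge0 opprK.
- by exists (pos k); apply/E.
Qed.

Lemma normal_fan_cone s : s \in normal_fan Delta ->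
  [/\ face (cone_face s), cone_face s != finset.set0 & s = ncone (cone_face s)].
Proof.
move=> sN; have : normal_fan_cones Delta s.
  by rewrite -normal_fanE //; exists A.
case=> F [FD F0 ->]; have [kZ Z0 e] := inner_normal_coneE FD F0.
by rewrite e cone_face_ncone.
Qed.

Lemma ncone_normal_fan Z : face Z -> Z != finset.set0 ->
  ncone Z \in normal_fan Delta.
Proof.
move=> kZ Z0; have [F [FD F0 FZ]] := face_of_key kZ Z0.
suff : [set` normal_fan Delta] (ncone Z) by [].
rewrite normal_fanE; last by exists A.
exists F; split=> //; have [_ _ ->] := inner_normal_coneE FD F0.
by congr ncone; apply/setP => i; rewrite inE; apply/idP/asboolP => /FZ.
Qed.

(** The direction space of the affine hull of [Z], obtained as the height 0 part of the span of the
    lifted points. *)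
Definition directions Z : {vspace 'rV[R]_d} :=
  (linfun (fst : homog R d -> 'rV[R]_d) @:
   (fspan lift1 Z :&: lker (linfun (snd : homog R d -> R^o))))%VS.

Lemma mem_directions Z i j : i \in Z -> j \in Z -> pos i - pos j \in directions Z.
Proof.
move=> iZ jZ; have -> : pos i - pos j = linfun (fst : homog R d -> 'rV[R]_d)
    (lift1 i - lift1 j) by rewrite lfunE.
apply: memv_img; rewrite memv_cap memv_ker lfunE /= subrr eqxx andbT.
by rewrite memvB // mem_fspan.
Qed.

Lemma directions_orthogonal Z n : n \in orthogonal (directions Z) <->
  forall i j, i \in Z -> j \in Z -> dot (pos i) n = dot (pos j) n.
Proof.
split=> [/mem_orthogonal h i j iZ jZ|h].
  by apply/eqP; rewrite -subr_eq0 -dotBl; apply/eqP/h/mem_directions.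
apply/mem_orthogonal => x /memv_imgP[v]; rewrite memv_cap memv_ker lfunE /=.
case/andP => vZ /eqP v2 ->; rewrite lfunE /=.
case: (set_0Vmem Z) => [Z0|[k kZ]].
  move: vZ; rewrite /fspan Z0 big_set0 memv0 => /eqP->.
  by rewrite dotC dot0r.
have := @span_ev0 _ _ _ lift1 Z (affine n (- dot (pos k) n)) v.
rewrite affineE v2 mul0r addr0; apply=> // i iZ.
by rewrite ev_affine (h i k) // subrr.
Qed.

Lemma dim_directions Z : Z != finset.set0 -> (\dim (directions Z)).+1 = rk Z.
Proof.
case/set0Pn => k kZ; rewrite rkE -(limg_ker_dim (linfun (snd : homog R d -> R^o))).
have -> : \dim (directions Z) =
    \dim (fspan lift1 Z :&: lker (linfun (snd : homog R d -> R^o)))%VS.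
  apply: limg_dim_eq; apply/eqP; rewrite -subv0; apply/subvP => -[x t].
  rewrite !memv_cap !memv_ker !lfunE /= memv0 => /andP[/andP[_ /eqP->] /eqP->].
  exact: eqxx.
rewrite -addn1; congr (_ + _)%N; apply/esym/eqP; rewrite eqn_leq; apply/andP; split.
  by apply: leq_trans (dimvS (subvf _)) _; rewrite dimvf.
rewrite lt0n dimv_eq0; apply/eqP => e.
have : linfun (snd : homog R d -> R^o) (lift1 k) \in
    (linfun (snd : homog R d -> R^o) @: fspan lift1 Z)%VS.
  by apply: memv_img; exact: mem_fspan.
by rewrite e memv0 lfunE /= oner_eq0.
Qed.

(** A vector [n] constant on [Z] enters the cone after adding a large multiple of [m], the linear
    part of an affine function vanishing exactly on [Z]. *)
Lemma lspan_ncone Z : face Z -> Z != finset.set0 ->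
  lspan (ncone Z) = orthogonal (directions Z).
Proof.
move=> kZ /set0Pn[k kk]; apply/eqP; rewrite eqEsubv; apply/andP; split.
  apply: (lspanP _).2 => n sn; apply/directions_orthogonal => i j iZ jZ.
  exact: ncone_const sn iZ jZ.
apply/subvP => n /directions_orthogonal nZ.
have /faceP[m [c mZ]] := kZ; have mcov := (covector_affine Z m c).2 mZ.
pose y := affine n (- dot (pos k) n).
have y0 i : i \in Z -> ev lift1 y i = 0.
  by move=> iZ; rewrite ev_affine (nZ i k) // subrr.
have [i|a a0 aP] := @dominate _ _ _ lift1 (~: Z) (affine m c) y.
  by rewrite inE => iZ; case: mcov => _ _; apply.
have sm : m \in lspan (ncone Z).
  apply: (lspanP _).1; case: mZ => m0 mZ; apply: (ncone_affine m0) => i.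
  by rewrite -mZ => /eqP.
suff sam : a *: m + n \in lspan (ncone Z).
  by rewrite -(addKr (a *: m) n) memvD // memvN memvZ.
apply: (lspanP _).1; apply: (@ncone_affine _ _ (a * c - dot (pos k) n)).
  move=> i; have evE' : ev lift1 (a *: affine m c + y) i =
      dot (pos i) (a *: m + n) + (a * c - dot (pos k) n).
    by rewrite evD evZ !ev_affine dotDr dotZr mulrDr addrACA.
  rewrite -evE'; case: (boolP (i \in Z)) => iZ; last first.
    by apply/ltW/aP; rewrite inE.
  rewrite evD evZ y0 // addr0; case: mcov => _ m0 _.
  by rewrite m0 ?mulr0.
move=> i iZ; rewrite dotDr dotZr addrACA -mulrDr (nZ i k) // subrr addr0.
by have /eqP -> : dot (pos i) m + c == 0; [rewrite mZ.2|rewrite mulr0].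
Qed.

Lemma cone_dim_ncone Z : face Z -> Z != finset.set0 ->
  (cone_dim (ncone Z) + rk Z = d.+1)%N.
Proof.
move=> kZ Z0; rewrite /cone_dim lspan_ncone // -dim_directions // addnS.
by rewrite dim_orthogonal.
Qed.
End FacesAndNormalCones.

(** * Reflexive polytopes and independence mod 2 *)

Section IndependenceMod2.
Variables (d : nat) (J : finType) (a : J -> 'rV[int]_d).
Implicit Types (W : {set J}).

Definition indep2 W := forall b : J -> 'F_2,
  \sum_(v in W) b v *: lat_mod2 (a v) = 0 -> forall v, v \in W -> b v = 0.

Lemma indep2S W W' : W' \subset W -> indep2 W -> indep2 W'.
Proof.
move=> W'W iW b b0 v vW'.
pose b' u := if u \in W' then b u else 0.
have <- : b' v = b v by rewrite /b' vW'.
apply: iW; last exact: fintype.subsetP W'W v vW'.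
rewrite -[RHS]b0 big_mkcond [RHS]big_mkcond; apply: eq_bigr => u _.
rewrite /b'; case: (boolP (u \in W')) => [/(fintype.subsetP W'W)->//|_].
by rewrite scale0r if_same.
Qed.

(* Integral vectors independent mod 2 have a dual family of integral vectors,
   up to an odd factor: the determinant of a lift of the mod 2 duality. *)
Lemma dual_lift W : indep2 W -> exists (D : int) (r : J -> 'rV[int]_d),
  D%:~R = 1 :> 'F_2 /\
  forall u v, u \in W -> v \in W -> dot (a v) (r u) = if u == v then D else 0.
Proof.
move=> iW; pose Q : 'M[int]_(#|W|, d) := \matrix_i a (enum_val i).
pose Q2 : 'M['F_2]_(#|W|, d) := map_mx intr Q.
have /row_freeP[B QB] : row_free Q2.
  apply: inj_row_free => x xQ.
  pose b u : 'F_2 := \sum_(i | enum_val i == u) x 0 i.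
  have bE i : b (enum_val i) = x 0 i.
    rewrite /b (big_pred1 i) // => j; apply/eqP/eqP => [/enum_val_inj//|->//].
  apply/rowP => i; rewrite -bE mxE; apply: iW; last exact: enum_valP.
  rewrite big_enum_val -[RHS]xQ mulmx_sum_row; apply: eq_bigr => j _.
  rewrite bE; congr (_ *: _); apply/rowP => k; rewrite !mxE //.
pose B' : 'M[int]_(d, #|W|) := map_mx (fun y : 'F_2 => (y : nat)%:Z) B.
have B'E : map_mx intr B' = B.
  by apply/matrixP => i j; rewrite !mxE -pmulrn natr_Zp.
pose P := B' *m \adj (Q *m B'); pose D := \det (Q *m B').
have QP : Q *m P = D%:M by rewrite mulmxA mul_mx_adj.
exists D, (fun u => \sum_(i | enum_val i == u) (col i P)^T); split.
  by rewrite -[LHS](det_map_mx intr) map_mxM B'E /= QB det1.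
move=> u v uW vW; pose i := enum_rank_in uW u; pose j := enum_rank_in uW v.
have iE : enum_val i = u by exact: enum_rankK_in.
have jE : enum_val j = v by exact: enum_rankK_in.
rewrite (big_pred1 i) => [|k]; last first.
  by rewrite -iE; apply/eqP/eqP => [/enum_val_inj//|->//].
have /matrixP/(_ j i) := QP; rewrite !mxE => e.
transitivity (\sum_k Q j k * P k i).
  by apply: eq_bigr => k _; rewrite !mxE jE.
rewrite e -iE -jE eq_sym (inj_eq (@enum_val_inj _ _)).
by case: eqP.
Qed.

Lemma regular_indep2 (R : realType) (s : set 'rV[R]_d) W :
  injective a -> Z2_regular s ->
  (forall v, v \in W -> primitive_ray_generators s (a v)) -> indep2 W.
Proof.
move=> a_inj [X [uX XE /basis_free fX]] WX b b0 v vW.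
have aX u : u \in W -> a u \in X.
  by move=> uW; have : [set` X] (a u) by rewrite XE; exact: WX.
pose k x : 'F_2 := \sum_(u in W | a u == x) b u.
have kE u : u \in W -> k (a u) = b u.
  move=> uW; rewrite /k (big_pred1 u) // => u'.
  by rewrite /= (inj_eq a_inj); case: eqP => [->|]; rewrite ?uW ?andbF.
have ks : \sum_(x <- X) k x *: lat_mod2 x = 0.
  rewrite -[RHS]b0; under eq_bigr do rewrite scaler_suml.
  rewrite (exchange_big_dep (fun u => u \in W)) => [|x u _ /andP[]] //=.
  apply: eq_bigr => u uW; rewrite -big_filter.
  rewrite (_ : [seq x <- X | _] = [:: a u]) ?big_seq1 //.
  rewrite (eq_filter (a2 := pred1 (a u))) => [|x]; last by rewrite uW /= eq_sym.
  by rewrite filter_pred1_uniq // aX.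
have /freeP fP : free (in_tuple [seq lat_mod2 x | x <- X]) := fX.
have lt_i : (index (a v) X < size [seq lat_mod2 x | x <- X])%N.
  by rewrite size_map index_mem aX.
have := fP (fun i => k X`_i) _ (Ordinal lt_i); rewrite /= nth_index ?aX // kE //.
apply; rewrite -[RHS]ks (big_nth 0) big_mkord.
rewrite -(big_mkord xpredT (fun i => k X`_i *: [seq lat_mod2 x | x <- X]`_i)).
rewrite -(big_mkord xpredT (fun i => k X`_i *: lat_mod2 X`_i)) size_map.
rewrite big_nat_cond [RHS]big_nat_cond; apply: eq_bigr => i.
by rewrite andbT => /andP[_ iX]; rewrite (nth_map 0).
Qed.
End IndependenceMod2.

(** * Face cones and primitive vertices *)

Section Reflexive.
Variables (R : realType) (d : nat) (A : {fset 'rV[int]_d}).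
Local Notation I := (fset_sub_type A).
Implicit Types (Z : {set I}) (i j v : I) (n x : 'rV[R]_d) (c : R).
Local Notation Delta := (@lattice_hull R d A).
Local Notation pos := (@lattice_point R d A).
Local Notation lift1 := (@lift1 R d A).
Local Notation face := (key lift1 [set: I]%SET).
Local Notation rk := (rk lift1).
Local Notation covers := (covers lift1).
Local Notation verts := (vertices lift1).
Local Notation vert := (vert lift1).

Hypothesis int0 : interior Delta 0.

(** A small multiple of [- n] lies in the polytope and pairs negatively with [n]; so does some point
    in its convex combination. *)
Lemma interior_neg n : n != 0 -> exists i, dot (pos i) n < 0.
Proof.
move=> n0; have /nbhs_ballP[e /= e0 eD] : nbhs (0 : 'rV[R]_d) Delta by [].
(* [m] exceeds every coordinate of [n] in absolute value, so [t *: n] stays in the sup-norm ball of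
   radius [e]. *)
pose m := 1 + \sum_j `|n 0 j|; have m0 : 0 < m.
  by rewrite ltr_pwDl // sumr_ge0.
pose t := e / m; have t0 : 0 < t by rewrite divr_gt0.
have : Delta (- t *: n).
  apply: eD; split=> // i j; rewrite -ball_normE /= !mxE sub0r mulNr opprK.
  rewrite normrM gtr0_norm // /t mulrAC ltr_pdivrMr // ltr_pM2l //.
  rewrite (ord1 i) /m (bigD1 j) //= addrCA ltrDl.
  by rewrite ltr_pwDl // sumr_ge0.
case/hullP => w [w0 w1 wE]; apply/existsP; apply: contraT => /existsPn h.
have := dot_xx_gt0 n0; rewrite -(pmulr_rgt0 _ t0) -oppr_lt0 -mulNr -dotZl wE.
rewrite dot_suml ltNge sumr_ge0 // => i _; rewrite dotZl mulr_ge0 //.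
by have := h i; rewrite -leNgt.
Qed.

(** [c] is the value of the supporting affine function at the origin, an interior point. *)
Lemma face_height Z n c : (forall i, 0 <= dot (pos i) n + c) ->
  (forall i, (dot (pos i) n + c == 0) = (i \in Z)) ->
  Z != finset.set0 -> Z != [set: I]%SET -> 0 < c.
Proof.
move=> n0 nZ /set0Pn[k kZ] ZT; case: (eqVneq n 0) => [n00|nn].
  case/eqP: ZT; apply/setP => i; rewrite finset.in_setT -nZ.
  by have := nZ k; rewrite n00 !dot0r kZ.
have [i ni] := interior_neg nn; have := n0 i.
rewrite -lerBlDr sub0r => h; rewrite -oppr_lt0; exact: le_lt_trans ni.
Qed.

Lemma rk_setT : rk [set: I]%SET = d.+1.
Proof.
have dimh : \dim {: homog R d} = d.+1.
  rewrite dimvf; have -> : dim (homog R d) = (dim 'rV[R]_d + 1)%N by [].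
  by rewrite dim_matrix mul1r addn1.
suff : fspan lift1 [set: I]%SET = fullv by rewrite rkE => ->.
apply/eqP; rewrite eqEsubv subvf /=; apply/subvP => u _; apply: contraT.
case/separate_vector => w [w0 wu]; have [n [c wE]] := affine_surj w.
have nc i : dot (pos i) n = - c.
  apply/eqP; rewrite -addr_eq0 -ev_affine -wE; apply/eqP/w0.
  by apply: mem_fspan; rewrite finset.in_setT.
have [k _] : exists k : I, True.
  have /hullP[f [f0 f1 _]] : Delta 0 by exact: nbhs_singleton int0.
  apply: contrapT => none; move/eqP: f1; rewrite big1 ?(eq_sym 0) ?oner_eq0 //.
  by move=> i _; case: none; exists i.
case: (eqVneq n 0) => [n0|nn].
  have c0 : c = 0 by have := nc k; rewrite n0 dot0r => /eqP; rewrite eq_sym oppr_eq0 => /eqP.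
  have := wu; rewrite wE affineE n0 c0 dot0r mulr0 addr0 => /esym/eqP.
  by rewrite oner_eq0.
have [i] := interior_neg nn; rewrite nc oppr_lt0 => c0.
have [|j] := @interior_neg (- n); first by rewrite oppr_eq0.
by rewrite dotNr nc opprK => c0'; have := lt_trans c0 c0'; rewrite ltxx.
Qed.

Lemma lift1_inj : injective lift1.
Proof.
move=> i j [] /rowP e; apply: val_inj; apply/rowP => k.
by have := e k; rewrite !mxE => /intr_inj.
Qed.

Lemma ev_affine01 i : ev lift1 (affine 0 1) i = 1.
Proof. by rewrite ev_affine dot0r add0r. Qed.

Section Cone.
Variables (Z : {set I}) (F : set 'rV[R]_d).
Hypotheses (kZ : face Z) (Z0 : Z != finset.set0) (ZT : Z != [set: I]%SET).
Hypotheses (FD : is_face F Delta) (FZ : forall i, F (pos i) <-> i \in Z).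

Lemma lspan_cone_over :
  lspan (cone_over F) = (linfun (fst : homog R d -> 'rV[R]_d) @: fspan lift1 Z)%VS.
Proof.
have posE i : pos i = linfun (fst : homog R d -> 'rV[R]_d) (lift1 i).
  by rewrite lfunE.
apply/eqP; rewrite eqEsubv; apply/andP; split.
  apply: (lspanP _).2 => y [x Fx [t _ ->]]; apply: memvZ.
  have [w [_ _ -> wF]] := face_combination FD Fx; apply: memv_suml => i _.
  case: (eqVneq (w i) 0) => [->|/wF/FZ iZ]; first by rewrite scale0r mem0v.
  by apply: memvZ; rewrite posE; apply/memv_img/mem_fspan.
rewrite limg_sum; apply/subv_sumP => i iZ; rewrite limg_line -posE -memvE.
apply: (lspanP _).1; exists (pos i); first exact/FZ.
by exists 1; rewrite ?scale1r.
Qed.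

(** The affine hull of the face misses the origin, so forgetting the height is injective on the span
    of the lifted points. *)
Lemma cone_dim_cone_over : cone_dim (cone_over F) = rk Z.
Proof.
have /faceP[n [c [n0 nZ]]] := kZ; have c0 := face_height n0 nZ Z0 ZT.
rewrite /cone_dim lspan_cone_over rkE; apply: limg_dim_eq.
apply/eqP; rewrite -subv0; apply/subvP => -[x t].
rewrite memv_cap memv_ker lfunE /= memv0 => /andP[xZ /eqP x0].
have := @span_ev0 _ _ _ lift1 Z (affine n c) (x, t) _ xZ.
rewrite affineE /= x0 dotC dot0r add0r => h.
have /eqP : t * c = 0 by apply: h => i; rewrite -nZ ev_affine => /eqP.
by rewrite mulf_eq0 (gt_eqF c0) orbF => /eqP->; rewrite eqxx.
Qed.

Lemma vertex_ray v : v \in vert Z -> is_ray (cone_over [set pos v]) (cone_over F).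
Proof.
rewrite finset.in_setI inE => /andP[vZ /faceP[m [b [m0 mv]]]].
have /faceP[n [c [n0 nZ]]] := kZ; have c0 := face_height n0 nZ Z0 ZT.
have ZE i : i \in Z -> dot (pos i) n = - c.
  by rewrite -nZ addr_eq0 => /eqP.
split; last first.
  have pv : pos v != 0.
    apply/eqP => p0; have := ZE v vZ; rewrite p0 dotC dot0r => /eqP.
    by rewrite eq_sym oppr_eq0 (gt_eqF c0).
  rewrite /cone_dim (_ : lspan _ = <[pos v]>%VS) ?dim_vline ?pv //.
  apply/eqP; rewrite eqEsubv; apply/andP; split.
    by apply: (lspanP _).2 => y [_ -> [t _ ->]]; apply/memvZ/memv_line.
  rewrite -memvE; apply: (lspanP _).1; exists (pos v) => //.
  by exists 1; rewrite ?scale1r.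
(* On [F] the functional [n] is constantly [- c], so [u] agrees there with the affine function
   [m + b] that exposes [v]. *)
pose u := m - (b / c) *: n.
have uE i : i \in Z -> dot (pos i) u = dot (pos i) m + b.
  by move=> iZ; rewrite dotBr dotZr ZE // mulrN opprK divfK // gt_eqF.
have uF x : F x -> exists w : I -> R, [/\ forall i, 0 <= w i, \sum_i w i = 1,
    x = \sum_i w i *: pos i,
    dot x u = \sum_i w i * (dot (pos i) m + b) &
    forall i, w i != 0 -> i \in Z].
  move=> /(face_combination FD)[w [w0 w1 xE wF]]; exists w; split=> //.
    rewrite xE dot_suml; apply: eq_bigr => i _; rewrite dotZl.
    by case: (eqVneq (w i) 0) => [->|/wF/FZ/uE->//]; rewrite !mul0r.
  by move=> i /wF/FZ.
exists u, 0; split=> [y [x /uF[w [w0 w1 xE xu _]] [t t0 ->]]|].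
  rewrite pairing_dot dotZl mulr_ge0 // xu sumr_ge0 // => i _.
  by rewrite mulr_ge0.
apply/seteqP; split=> y /=.
  case=> _ -> [t t0 ->]; split; first by exists (pos v); [exact/FZ|exists t].
  rewrite pairing_dot dotZl uE //.
  by have /eqP-> : dot (pos v) m + b == 0; [rewrite mv set11|rewrite mulr0].
case=> -[x /uF[w [w0 w1 xE xu wZ]] [t t0 ->]]; rewrite pairing_dot dotZl => /eqP txu.
exists (pos v) => //; move: txu; rewrite mulf_eq0 => /orP[/eqP->|].
  by exists 0; rewrite ?scale0r.
rewrite xu psumr_eq0 => [/allP wv|i _]; last by rewrite mulr_ge0.
exists t => //; congr (_ *: _).
have {}wv i : i != v -> w i = 0.
  move=> iv; have := wv i; rewrite mem_index_enum mulf_eq0 mv finset.in_set1 (negPf iv) orbF.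
  by move/(_ isT)/eqP.
rewrite xE (bigD1 v) //= big1 => [|i /wv->]; last by rewrite scale0r.
move: w1; rewrite (bigD1 v) //= big1 => [|i /wv//].
by rewrite !addr0 => ->; rewrite scale1r.
Qed.
End Cone.

(** Scaled into the polar, the supporting functional pairs to -1 with [v]. It is a convex
    combination of lattice points pairing to at least -1, so one of these attains -1, a value
    divisible by any integer factor of [v]. *)
Lemma vertex_primitive v : lattice_polytope (polar Delta) -> v \in verts ->
  (0 < d)%N -> primitive (val v).
Proof.
move=> [A' A'E] vv d0; have vT : [set v]%SET != [set: I]%SET.
  apply/eqP => e; have := rk_card lift1 [set v]%SET.
  by rewrite [in X in (X <= _)%N]e rk_setT cards1 ltnS leqNgt d0.
have v0 : [set v]%SET != finset.set0 by apply/set0Pn; exists v; rewrite finset.in_set1.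
have /faceP[n [c [n0 nv]]] : face [set v]%SET by move: vv; rewrite inE.
have c0 := face_height n0 nv v0 vT.
have : polar Delta (c^-1 *: n).
  move=> x /hullP[w [w0 w1 ->]]; rewrite pairing_dot dotZr dot_suml.
  rewrite -(ler_pM2l c0) mulrN1 mulVKf ?gt_eqF // -[leLHS]mul1r -w1 mulr_suml.
  by apply: ler_sum => i _; rewrite dotZl ler_wpM2l // -subr_ge0 opprK.
rewrite A'E => /hullP[w [w0 w1 nE]].
have A'v (k : fset_sub_type A') : -1 <= dot (pos v) (lattice_point R k).
  have : polar Delta (lattice_point R k) by rewrite A'E; exact: hull_pos.
  by apply; exact: hull_pos.
have vn : \sum_k w k * (dot (pos v) (lattice_point R k) + 1) = 0.
  under eq_bigr do rewrite mulrDr mulr1 -dotZr.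
  rewrite big_split /= w1 -dot_sumr -nE dotZr.
  have /eqP : dot (pos v) n + c == 0 by rewrite nv finset.in_set1.
  by move/eqP; rewrite addr_eq0 => /eqP->; rewrite mulrN mulVf ?gt_eqF // addNr.
have [k wk] : exists k, w k != 0.
  apply/existsP; apply: contraT => /existsPn h; move/eqP: w1.
  rewrite big1 => [|k _]; first by rewrite eq_sym oner_eq0.
  by have := h k; rewrite negbK => /eqP.
move/eqP: vn; rewrite psumr_eq0 => [/allP/(_ k)|k' _]; last first.
  by rewrite mulr_ge0 // -lerBlDr sub0r.
rewrite mem_index_enum mulf_eq0 (negPf wk) /= => /(_ isT).
rewrite addr_eq0 /lattice_point /lat_real dot_map => vk m y vE.
have {}vk : dot (val v) (val k) = -1.
  by apply: (@intr_inj R); rewrite (eqP vk) rmorphN1.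
move: vk; rewrite [val v]vE -scaler_nat dotZl => /(congr1 absz).
rewrite abszM /= => /eqP; rewrite muln_eq1 => /andP[/eqP].
by rewrite natz.
Qed.
End Reflexive.

Lemma F2_int0 (z : int) : z%:~R = 0 :> 'F_2 -> exists b : int, z = 2 * b.
Proof.
move=> z0; have : (2 %| `|z|)%N.
  rewrite (dvdn_pcharf (pchar_Fp (isT : prime 2))); apply/eqP.
  move: z0; case: z => n; first by [].
  by rewrite NegzE mulrNz => /eqP; rewrite oppr_eq0 => /eqP.
by rewrite -[2%N]/`|2%:Z|%N -dvdzE => /dvdzP[b ->]; exists b; rewrite mulrC.
Qed.

Lemma lat_mod2_surj d (n : 'rV['F_2]_d) : exists m, lat_mod2 m = n.
Proof.
exists (map_mx (fun y : 'F_2 => (y : nat)%:Z) n).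
by apply/rowP => i; rewrite !mxE -pmulrn natr_Zp.
Qed.

(** * Regularity and faces of low rank *)

Section LowFaces.
Variables (R : realType) (d : nat) (A : {fset 'rV[int]_d}).
Local Notation I := (fset_sub_type A).
Implicit Types (W Z : {set I}) (i j v : I).
Local Notation Delta := (@lattice_hull R d A).
Local Notation pos := (@lattice_point R d A).
Local Notation lift1 := (@lift1 R d A).
Local Notation face := (key lift1 [set: I]%SET).
Local Notation rk := (rk lift1).
Local Notation covers := (covers lift1).
Local Notation verts := (vertices lift1).
Local Notation vert := (vert lift1).
Local Notation pt := (val : I -> 'rV[int]_d).
Local Notation ncone := (@ncone R d A).

(** The factor [D] of the dual family is odd, hence nonzero in [R], so independence mod 2 lifts to
    independence over [R]. *)
Lemma indep2_rk W : indep2 pt W -> rk W = #|W|.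
Proof.
case/dual_lift => D [r [D1 rE]].
have D0 : D%:~R != 0 :> R.
  by rewrite intr_eq0; apply: contra_eq_neq D1 => ->; rewrite eq_sym oner_eq0.
suff E n (S : {set I}) : S \subset W -> #|S| = n -> rk S = n by exact: E.
elim: n S => [|n IH] S SW cS; first by rewrite (cards0_eq cS) rk0.
have /set0Pn[v vS] : S != finset.set0 by rewrite -cards_eq0 cS.
have cSv : #|S :\ v| = n by have := cardsD1 v S; rewrite vS cS add1n => -[<-].
have SvW : S :\ v \subset W := fintype.subset_trans (subD1set S v) SW.
have vW := fintype.subsetP SW v vS.
rewrite -(finset.setD1K vS) rkU1_notin ?IH //.
pose w := affine (lat_real R (r v)) 0.
have wE u : u \in W -> ev lift1 w u = if u == v then D%:~R else 0.
  move=> uW; rewrite ev_affine addr0 dot_map rE // eq_sym.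
  by case: eqP; rewrite ?mulr0z.
apply/negP => vspan; have : ev lift1 w v = 0.
  apply: (span_ev0 (l := lift1)) vspan => u; rewrite finset.in_setD1 => /andP[uv uS].
  by rewrite wE ?(negPf uv) // (fintype.subsetP SW).
by rewrite wE // eqxx => /eqP; rewrite (negPf D0).
Qed.

Lemma cone_mod2_const Z n i j : face Z -> Z != finset.set0 ->
  n \in cone_mod2 (ncone Z) -> i \in Z -> j \in Z ->
  dot (lat_mod2 (val i)) n = dot (lat_mod2 (val j)) n.
Proof.
move=> kZ Z0 /mem_cone_mod2[m ml <-] iZ jZ; rewrite !dot_map; congr (_%:~R).
apply: (@intr_inj R); rewrite -!(dot_map intr).
by move: ml; rewrite lspan_ncone // => /directions_orthogonal; apply.
Qed.

(** Converse of [cone_mod2_const]: together they identify [N_sigma] with the vectors whose pairing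
    is constant mod 2 on the vertices. *)
Lemma mem_cone_mod2_ncone Z n : face Z -> Z != finset.set0 ->
  indep2 pt (vert Z) ->
  (forall u v, u \in vert Z -> v \in vert Z ->
    dot (lat_mod2 (val u)) n = dot (lat_mod2 (val v)) n) ->
  n \in cone_mod2 (ncone Z).
Proof.
move=> kZ Z0 /dual_lift[D [r [D1 rE]]] nc; have [m mE] := lat_mod2_surj n.
have /set0Pn[v0 v0Z] := face_vertex (@ev_affine01 R d A) (@lift1_inj R d A) kZ Z0.
pose k := dot (val v0) m.
have /choice[b bE] : forall v, exists b : int, v \in vert Z ->
    dot (val v) m - k = 2 * b.
  move=> v; case: (boolP (v \in vert Z)) => vZ; last by exists 0.
  have [|b bE] := @F2_int0 (dot (val v) m - k); last by exists b.
  apply/eqP; rewrite rmorphB subr_eq0 /k -!(dot_map intr); apply/eqP.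
  by rewrite -/(lat_mod2 m) mE; exact: nc.
(* The dual family removes the even discrepancies [2 * b v] exactly, at the cost of the factor [D],
   which is 1 mod 2. *)
pose n' := D *: m - 2 *: \sum_(v in vert Z) b v *: r v.
have n'E v : v \in vert Z -> dot (val v) n' = D * k.
  move=> vZ; rewrite dotBr !dotZr dot_sumr (bigD1 v) //= big1 => [|u /andP[uZ uv]].
    rewrite dotZr rE // eqxx addr0 mulrA -bE // mulrC -mulrBl.
    by rewrite opprB addrC subrK mulrC.
  by rewrite dotZr rE // (negPf uv) mulr0.
apply/mem_cone_mod2; exists n'; last first.
  rewrite -mE; apply/rowP => i; rewrite !mxE rmorphB !rmorphM /= D1 mul1r.
  by rewrite [2%:~R](_ : _ = 0) ?mul0r ?subr0 //; exact: val_inj.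
rewrite lspan_ncone //; apply/directions_orthogonal => i j iZ jZ.
suff E a : a \in Z -> dot (pos a) (lat_real R n') = (D * k)%:~R by rewrite !E.
move=> aZ; apply/eqP; rewrite -subr_eq0 -ev_affine; apply/eqP.
apply: (span_ev0 (l := lift1) (Z := vert Z)) => [v vZ|].
  by rewrite ev_affine dot_map n'E // subrr.
by rewrite (fspan_vert (@ev_affine01 R d A) (@lift1_inj R d A)) // mem_fspan.
Qed.

Section Regular.
Variable e : nat.
Hypotheses (int0 : interior Delta 0) (polarD : lattice_polytope (polar Delta)).
Hypotheses (e0 : (0 < e)%N) (ed : (e <= d)%N).
Hypothesis hreg : forall s : set 'rV[R]_d,
  s \in face_fan Delta -> cone_dim s = e -> Z2_regular s.

Lemma low_indep2 Z : face Z -> (rk Z <= e)%N -> indep2 pt (vert Z).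
Proof.
(* Regularity is given in dimension [e] alone, so [Z] is enlarged to a face of rank exactly [e];
   [e0] and [ed] make that face nonempty and proper. *)
move=> kZ rZ; have [|Z1 [kZ1 ZZ1 rZ1]] := key_extend (r := e) kZ.
  by rewrite rZ rk_setT // ltnW.
apply: (@indep2S _ _ _ (vert Z1)); first exact: vertS.
have Z0 : Z1 != finset.set0.
  by apply: contraTneq e0 => Z10; rewrite -rZ1 Z10 rk0.
have ZT : Z1 != [set: I]%SET.
  by apply: contraTneq ed => Z1T; rewrite -rZ1 Z1T rk_setT // ltnn.
have [F [FD F0 FZ]] := face_of_key kZ1 Z0.
apply: (@regular_indep2 _ _ _ R (cone_over F)).
- exact: val_inj.
- apply: hreg; last by rewrite (@cone_dim_cone_over R d A int0 Z1) //.
  suff : [set` face_fan Delta] (cone_over F) by [].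
  rewrite face_fanE; last by exists A.
  right; exists F; split=> // FE; case/eqP: ZT; apply/setP => i.
  rewrite finset.in_setT; apply/FZ; rewrite FE; exact: hull_pos.
- move=> v vZ; split.
    apply: (vertex_primitive int0 polarD); last exact: leq_trans ed.
    by move: vZ; rewrite finset.in_setI => /andP[].
  exists (cone_over [set pos v]); first exact: (vertex_ray int0 kZ1).
  by exists (pos v) => //; exists 1; rewrite ?scale1r.
Qed.

Lemma low_card Z : face Z -> (rk Z <= e)%N -> #|vert Z| = rk Z.
Proof.
move=> kZ rZ; rewrite -(indep2_rk (low_indep2 kZ rZ)).
exact: (rk_vert (@ev_affine01 R d A) (@lift1_inj R d A)).
Qed.
End Regular.
End LowFaces.

(** * The Hodge complex *)

Section DotForm.
Variables (d : nat) (U : {vspace 'rV['F_2]_d}).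

(** Pairing with [p] need not descend to the quotient, so the chosen representative is used; the
    ambiguity is a constant common to all points of a face ([stalk_coord_pi]). *)
Definition dot_form_fun (p : 'rV['F_2]_d) (x : quotv U) : ('F_2)^o :=
  dot p (vsval x).

Fact dot_form_linear p : linear (dot_form_fun p).
Proof. by move=> a x y; rewrite /dot_form_fun linearP dotDr dotZr. Qed.

HB.instance Definition _ p := GRing.isLinear.Build 'F_2 (quotv U) ('F_2)^o _
  (dot_form_fun p) (dot_form_linear p).

Definition dot_form (p : 'rV['F_2]_d) : 'Hom(quotv U, ('F_2)^o) :=
  linfun (dot_form_fun p).

Lemma dot_formE p x : dot_form p x = dot p (vsval x).
Proof. by rewrite lfunE. Qed.
End DotForm.

Lemma E_resE (R : realType) (d : nat) (s t : set 'rV[R]_d) (x : E_stalk s) :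
  E_res s t x = quot_pi (cone_mod2 t) (vsval x).
Proof.
rewrite /E_res quot_mapE.
congr (quot_pi _ _).
exact: id_lfunE.
Qed.

(** * Stalks of the cosheaf in vertex coordinates *)

Section Stalks.
Variables (R : realType) (d : nat) (A : {fset 'rV[int]_d}) (q : nat).
Local Notation I := (fset_sub_type A).
Implicit Types (S T X Z : {set I}) (i j v : I) (s t : set 'rV[R]_d).
Local Notation Delta := (@lattice_hull R d A).
Local Notation lift1 := (@lift1 R d A).
Local Notation face := (key lift1 [set: I]%SET).
Local Notation vert := (vert lift1).
Local Notation pt := (val : I -> 'rV[int]_d).
Local Notation ncone := (@ncone R d A).

Definition stalk_coord s v : 'Hom(E_stalk s, ('F_2)^o) :=
  dot_form (cone_mod2 s) (lat_mod2 (val v)).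

Definition stalk_form s S : 'Hom(ext q (E_stalk s), ('F_2)^o) :=
  alt_form q (stalk_coord s) S.

Lemma stalk_coord_pi s Z n : face Z -> Z != finset.set0 -> s = ncone Z ->
  exists k : 'F_2, forall v, v \in Z ->
    stalk_coord s v (quot_pi (cone_mod2 s) n) = dot (lat_mod2 (val v)) n + k.
Proof.
move=> kZ Z0 ->; have /set0Pn[v0 v0Z] := Z0.
pose m := n - vsval (quot_pi (cone_mod2 (ncone Z)) n).
exists (- dot (lat_mod2 (val v0)) m) => v vZ; rewrite /stalk_coord dot_formE.
rewrite -(cone_mod2_const kZ Z0 _ vZ v0Z); last exact: quot_piE.
by rewrite dotBr opprB addrC subrK.
Qed.

Lemma stalk_form_map s t X Z S y : face X -> face Z ->
  X != finset.set0 -> Z != finset.set0 -> s = ncone X -> t = ncone Z ->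
  S \subset Z -> #|S| = q.+1 ->
  stalk_form t S (ext_map q (E_res s t) y) = stalk_form s S y.
Proof.
move=> kX kZ X0 Z0 sX tZ SZ cS; apply: alt_form_map => // x.
have [k kE] := stalk_coord_pi (vsval x) kZ Z0 tZ.
exists k => v vS.
apply: (etrans (congr1 (stalk_coord t v) (E_resE t x))).
apply: (etrans (kE v (fintype.subsetP SZ v vS))).
by congr (_ + k); apply: esym; exact: dot_formE.
Qed.

Section Simplex.
Variables (s : set 'rV[R]_d) (Z : {set I}).
Hypotheses (kZ : face Z) (Z0 : Z != finset.set0) (sZ : s = ncone Z).
Hypothesis iZ : indep2 pt (vert Z).

(** The [b u] are classes of the dual family reduced mod 2. The remainder of the expansion pairs
    equally with all vertices, so [mem_cone_mod2_ncone] kills it in the stalk. *)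
Lemma stalk_basis : exists (v0 : I) (b : I -> E_stalk s), [/\ v0 \in vert Z,
  forall u, u \in vert Z :\ v0 -> exists k : 'F_2, forall v, v \in vert Z ->
    stalk_coord s v (b u) = (u == v)%:R + k &
  forall x, x = \sum_(u in vert Z :\ v0)
    (stalk_coord s u x + stalk_coord s v0 x) *: b u].
Proof.
have [D [r [D1 rE]]] := dual_lift iZ.
have rE2 u v : u \in vert Z -> v \in vert Z ->
    dot (lat_mod2 (val v)) (lat_mod2 (r u)) = (u == v)%:R :> 'F_2.
  by move=> uZ vZ; rewrite dot_map rE //; case: eqP => _; rewrite ?D1.
have /set0Pn[v0 v0Z] := face_vertex (@ev_affine01 R d A) (@lift1_inj R d A) kZ Z0.
pose b u : E_stalk s := quot_pi (cone_mod2 s) (lat_mod2 (r u)).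
exists v0, b; split=> // [u|x].
  rewrite finset.in_setD1 => /andP[_ uZ].
  have [k kE] := stalk_coord_pi (lat_mod2 (r u)) kZ Z0 sZ.
  exists k => v vZ; rewrite kE ?rE2 //.
  by move: vZ; rewrite finset.in_setI => /andP[].
pose c u := stalk_coord s u x + stalk_coord s v0 x.
pose m := \sum_(u in vert Z :\ v0) c u *: lat_mod2 (r u).
have -> : \sum_(u in vert Z :\ v0) c u *: b u = quot_pi (cone_mod2 s) m.
  by rewrite linear_sum; apply: eq_bigr => u _; rewrite linearZ.
rewrite -{1}(quot_piK x); apply/eqP; rewrite -subr_eq0 -linearB -memv_ker.
rewrite lker_quot_pi; have mem_s w : (forall u v, u \in vert Z -> v \in vert Z ->
    dot (lat_mod2 (val u)) w = dot (lat_mod2 (val v)) w) -> w \in cone_mod2 s.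
  by rewrite sZ; exact: mem_cone_mod2_ncone.
apply: mem_s.
suff E v : v \in vert Z -> dot (lat_mod2 (val v)) (vsval x - m) =
    dot (lat_mod2 (val v0)) (vsval x).
  by move=> u v uZ vZ; rewrite !E.
move=> vZ; rewrite dotBr /m dot_sumr.
case: (eqVneq v v0) => [->|vv0].
  rewrite big1 ?subr0 // => u; rewrite finset.in_setD1 => /andP[uv uZ].
  by rewrite dotZr rE2 // (negPf uv) mulr0.
rewrite (bigD1 v) /=; last by rewrite finset.in_setD1 vv0.
rewrite big1 ?addr0 => [|u /andP[]]; last first.
  rewrite finset.in_setD1 => /andP[_ uZ] uv.
  by rewrite dotZr rE2 // (negPf uv) mulr0.
rewrite dotZr rE2 // eqxx mulr1 /c /stalk_coord !dot_formE.
by rewrite opprD addrA subrr add0r F2_opp.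
Qed.

Lemma stalk_form_inj x :
  (forall S, S \subset vert Z -> #|S| = q.+1 -> stalk_form s S x = 0) -> x = 0.
Proof.
have [v0 [b [v0Z bd bg]]] := stalk_basis.
exact: (alt_form_inj v0Z bd bg).
Qed.

Lemma stalk_form_surj (f : {set I} -> 'F_2) :
  (forall T, T \subset vert Z -> #|T| = q.+2 -> \sum_(v in T) f (T :\ v) = 0) ->
  exists x, forall S, S \subset vert Z -> #|S| = q.+1 -> stalk_form s S x = f S.
Proof.
have [v0 [b [v0Z bd bg]]] := stalk_basis.
exact: (alt_form_surj v0Z bd).
Qed.
End Simplex.
End Stalks.

Lemma cyclesP (R : realType) (d : nat) (Sigma : {fset set 'rV[R]_d})
    (F : cosheaf Sigma) p (x : total_chains F) :
  x \in cycles F p <-> x \in chains F p /\ boundary F x = 0.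
Proof.
rewrite /cycles.
split=> [/memv_capP[xc xk]|[xc dx]].
  split; first exact: xc.
  by apply/eqP; rewrite -memv_ker.
apply/memv_capP; split; first exact: xc.
by rewrite memv_ker dx.
Qed.

(** * From Hodge chains to the double complex *)

Section HodgeChains.
Variables (R : realType) (d : nat) (A : {fset 'rV[int]_d}) (q : nat).
Local Notation I := (fset_sub_type A).
Local Notation Delta := (@lattice_hull R d A).
Local Notation Sigma := (fset_sub_type (normal_fan Delta)).
Local Notation lift1 := (@lift1 R d A).
Local Notation face := (key lift1 [set: I]%SET).
Local Notation rk := (rk lift1).
Local Notation covers := (covers lift1).
Local Notation vert := (vert lift1).
Local Notation pt := (val : I -> 'rV[int]_d).
Local Notation ncone := (@ncone R d A).
Local Notation cosh := (ext_cosheaf q (E_cosheaf (normal_fan Delta))).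
Local Notation chain := (total_chains cosh).
Local Notation Bd := (Bd lift1).
Local Notation Dl := (Dl lift1).
Local Notation supp := (supp lift1).
Implicit Types (S T X Z : {set I}) (s t : Sigma) (x y : chain).

Definition face_of s : {set I} := @cone_face R d A (val s).

Lemma face_ofP s : [/\ face (face_of s), face_of s != finset.set0 &
  val s = ncone (face_of s)].
Proof. exact/normal_fan_cone/fsvalP. Qed.

Lemma face_of_inj : injective face_of.
Proof.
move=> s t e; apply: val_inj; case: (face_ofP s) (face_ofP t) => _ _ -> [_ _ ->].
by rewrite e.
Qed.

Lemma face_of_surj Z : face Z -> Z != finset.set0 -> exists s, face_of s = Z.
Proof.
move=> kZ Z0; exists [` ncone_normal_fan kZ Z0]%fset.
exact: cone_face_ncone.
Qed.

Lemma cone_dim_face_of s : (cone_dim (val s) + rk (face_of s) = d.+1)%N.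
Proof. by have [kZ Z0 ->] := face_ofP s; exact: cone_dim_ncone. Qed.

Lemma rk_face_of s p : (rk (face_of s) == p.+1) = (cone_dim (val s) + p == d)%N.
Proof. by have := cone_dim_face_of s; move: (cone_dim _) (rk _) => a b; lia. Qed.

Lemma facet_of_covers s t : facet_of s t = covers (face_of t) (face_of s).
Proof.
have [kX X0 sX] := face_ofP s; have [kZ Z0 tZ] := face_ofP t.
rewrite /facet_of coversE; congr (_ && _).
  by apply/asboolP/idP; rewrite sX tZ; move/(ncone_face kX kZ X0 Z0).
have := cone_dim_face_of s; rewrite -(cone_dim_face_of t).
by move=> e; apply/eqP/eqP => h; move: e; rewrite h; lia.
Qed.

(** The sum has at most one term, by [face_of_inj], and none when [Z] is not the face of a cone, in
    particular for the empty face. *)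
Definition values x Z S : 'F_2 :=
  if (S \subset vert Z) && (#|S| == q.+1) then
    \sum_(s | face_of s == Z) stalk_form q (val s) S (x s) else 0.

Lemma values_face_of x s S : S \subset vert (face_of s) -> #|S| = q.+1 ->
  values x (face_of s) S = stalk_form q (val s) S (x s).
Proof.
move=> SZ cS; rewrite /values SZ cS eqxx /=; apply: big_pred1 => t.
by rewrite /= (inj_eq face_of_inj).
Qed.

Lemma values0 x Z S : ~~ ((S \subset vert Z) && (#|S| == q.+1)) -> values x Z S = 0.
Proof. by rewrite /values => /negPf->. Qed.

Lemma valuesP a x y Z S : values (a *: x + y) Z S = a * values x Z S + values y Z S.
Proof.
rewrite /values; case: ifP => _; last by rewrite mulr0 addr0.
rewrite mulr_sumr -big_split /=; apply: eq_bigr => s _.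
by rewrite dsumDE dsumZE linearP.
Qed.

Lemma values_outside x Z S : (forall s, face_of s != Z) -> values x Z S = 0.
Proof.
move=> nZ; rewrite /values; case: ifP => // _; apply: big1 => s /eqP sZ.
by have := nZ s; rewrite sZ eqxx.
Qed.

Lemma boundaryE x t :
  boundary cosh x t = \sum_(s | facet_of s t) res cosh s t (x s).
Proof. by rewrite /boundary lfunE /= ffunE. Qed.

(** Passing from cones to faces reverses inclusion, and the forms commute with the maps of the
    cosheaf. The empty face causes no trouble: [#|S| = q.+1] forces [Z] to be nonempty. *)
Lemma values_boundary x Z S : values (boundary cosh x) Z S = Bd (values x) Z S.
Proof.
case: (boolP ((S \subset vert Z) && (#|S| == q.+1))) => [/andP[SZ /eqP cS]|h0]; last first.
  rewrite values0 // /Bd; case: ifP => // /andP[kZ SZ]; rewrite big1 // => Y _.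
  by apply: values0; apply: contra h0 => /andP[_ ->]; rewrite SZ.
have Z0 : Z != finset.set0.
  apply: contra_eq_neq cS => Z0; move: SZ; rewrite sub_vert Z0 finset.subset0.
  by move=> /andP[/eqP-> _]; rewrite cards0.
rewrite /Bd SZ andbT; case: (boolP (face Z)) => kZ; last first.
  apply: values_outside => s; apply: contra kZ => /eqP <-.
  by case: (face_ofP s).
have [t tZ] := face_of_surj kZ Z0; rewrite -tZ in SZ *.
rewrite values_face_of // boundaryE linear_sum /=.
transitivity (\sum_(s | covers (face_of t) (face_of s)) values x (face_of s) S).
  apply: eq_big => [s|s cts]; first exact: facet_of_covers.
  rewrite facet_of_covers in cts; have ts := proper_sub (covers_proper cts).
  have [kX X0 sX] := face_ofP s; have [kt t0 tE] := face_ofP t.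
  rewrite values_face_of //; last exact: fintype.subset_trans SZ (vertS _ ts).
  apply: (stalk_form_map _ kX kt) => //.
  by move: SZ; rewrite sub_vert => /andP[].
rewrite [RHS](bigID (fun Y => [exists s, face_of s == Y])) /= [X in _ + X]big1 => [|Y].
  rewrite addr0 (reindex_onto face_of (fun Y => odflt t [pick s | face_of s == Y])).
    apply: eq_bigl => s; have [-> _ _] := face_ofP s.
    have -> : [exists s', face_of s' == face_of s] by apply/existsP; exists s.
    rewrite andbT; case: pickP => [s' /eqP/face_of_inj->|/(_ s)]; last by rewrite eqxx.
    by rewrite eqxx andbT.
  move=> Y /andP[_ /existsP[s sY]].
  by case: pickP => [s' /eqP//|/(_ s)]; rewrite sY.
by case/andP => _ /existsPn h; exact: values_outside.
Qed.

Lemma supp_values p x : x \in chains cosh p -> supp p.+1 q.+1 (values x).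
Proof.
move=> /mem_chains xp Z S; apply: contraR => h0; apply/eqP.
case: (boolP ((S \subset vert Z) && (#|S| == q.+1))) => [/andP[SZ cS]|]; last exact: values0.
case: (boolP [exists s, face_of s == Z]) => [/existsP[s /eqP sZ]|/existsPn]; last first.
  exact: values_outside.
rewrite -sZ in SZ h0 *; rewrite values_face_of //; last exact/eqP.
rewrite xp ?linear0 //; apply: contra h0 => dp.
have [-> _ _] := face_ofP s; rewrite SZ cS !andbT /=.
by rewrite rk_face_of.
Qed.

Lemma Dl_values x Z T : Dl (values x) Z T = 0.
Proof.
rewrite /Dl; case: ifP => // TZ.
case: (boolP (#|T| == q.+2)) => [/eqP cT|cT]; last first.
  apply: big1 => v vT; apply: values0; apply: contra cT => /andP[_ /eqP cTv].
  by rewrite (cardsD1 v) vT cTv.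
case: (boolP [exists s, face_of s == Z]) => [/existsP[s /eqP sZ]|/existsPn h]; last first.
  by apply: big1 => v _; exact: values_outside.
rewrite -[RHS](alt_form_closed (@stalk_coord R d A (val s)) (x s) cT).
rewrite -sZ in TZ *; apply: eq_bigr => v vT; rewrite values_face_of //.
  exact: fintype.subset_trans (subD1set _ _) TZ.
by have := cardsD1 v T; rewrite vT cT add1n => -[<-].
Qed.

Section Low.
Variable e : nat.
Hypotheses (e_lt : (e < rk [set: I]%SET)%N)
  (ind : forall Z, face Z -> (rk Z <= e)%N -> indep2 pt (vert Z))
  (low : forall Z, face Z -> (rk Z <= e)%N -> #|vert Z| = rk Z).

Lemma values_inj s x y : (rk (face_of s) <= e)%N ->
  (forall S, values x (face_of s) S = values y (face_of s) S) -> x s = y s.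
Proof.
move=> re xy; apply/eqP; rewrite -subr_eq0; apply/eqP.
have [kZ Z0 sZ] := face_ofP s.
apply: (stalk_form_inj kZ Z0 sZ (ind kZ re)) => S SZ cS.
apply/eqP; rewrite linearB subr_eq0; apply/eqP.
by have := xy S; rewrite !values_face_of.
Qed.

Lemma values_surj p u : (p < e)%N -> supp p.+1 q.+1 u ->
  (forall Z T, Dl u Z T = 0) ->
  exists x, x \in chains cosh p /\ values x =2 u.
Proof.
move=> pe su Du.
have ex s : exists y : stalk cosh s,
    (rk (face_of s) != p.+1 -> y = 0) /\
    (rk (face_of s) = p.+1 -> forall S, S \subset vert (face_of s) ->
      #|S| = q.+1 -> stalk_form q (val s) S y = u (face_of s) S).
  have [kZ Z0 sZ] := face_ofP s.
  case: (eqVneq (rk (face_of s)) p.+1) => [rs|rs]; last first.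
    by exists 0; split=> // rs'; rewrite rs' eqxx in rs.
  have ri : indep2 pt (vert (face_of s)) by apply: (ind kZ); rewrite rs.
  have [|y yE] := stalk_form_surj kZ Z0 sZ ri (f := u (face_of s)) (q := q).
    by move=> T TZ _; have := Du (face_of s) T; rewrite /Dl TZ.
  by exists y.
have [f fE] := fin_all_exists ex; pose x : chain := [ffun s => f s].
have xE s : x s = f s by rewrite ffunE.
exists x; split.
  apply/mem_chains => s sp; rewrite xE; have [f0 _] := fE s; apply: f0.
  by apply: contra sp; rewrite rk_face_of.
move=> Z S; case: (boolP [&& face Z, rk Z == p.+1, S \subset vert Z & #|S| == q.+1]).
  case/and4P => kZ /eqP rZ SZ /eqP cS.
  have Z0 : Z != finset.set0 by apply: contra_eq_neq rZ => ->; rewrite rk0.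
  have [s sZ] := face_of_surj kZ Z0; rewrite -sZ in rZ SZ *.
  by rewrite values_face_of // xE; have [_ ->] := fE s.
move=> h0; rewrite (supp0 su h0).
case: (boolP ((S \subset vert Z) && (#|S| == q.+1))) => [/andP[SZ cS]|]; last exact: values0.
case: (boolP [exists s, face_of s == Z]) => [/existsP[s /eqP sZ]|/existsPn]; last first.
  exact: values_outside.
rewrite -sZ in SZ h0 *; rewrite values_face_of ?(eqP cS) // xE.
have [f0 _] := fE s; rewrite f0 ?linear0 //; apply: contra h0 => rs.
by have [-> _ _] := face_ofP s; rewrite rs SZ.
Qed.

Lemma boundary_chains p x t : x \in chains cosh p ->
  rk (face_of t) != p -> boundary cosh x t = 0.
Proof.
move=> /mem_chains xp rt; rewrite boundaryE big1 // => s.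
rewrite facet_of_covers => /andP[_ /eqP rs]; rewrite xp ?linear0 //.
apply: contra rt => dp; rewrite -eqSS -rs rk_face_of; exact: dp.
Qed.

(** The filling has rank [p.+2], at most [e], so [values_surj] realizes it by a chain; its boundary
    is compared with [x] through [values_inj] in rank [p.+1], and both vanish in other ranks. *)
Lemma cycle_boundary p x : (q <= p)%N -> (p.+1 < e)%N -> x \in cycles cosh p ->
  (p = q -> \sum_Z \sum_S values x Z S = 0) -> x \in boundaries cosh p.
Proof.
move=> qp pe /cyclesP[xp dx] sx.
have [||||||u [su Du Bu]] := double_complex_exact (@ev_affine01 R d A)
  (@lift1_inj R d A) e_lt low (j := q.+1) (i := p.+1) (x := values x).
- by [].
- by [].
- exact: supp_values.
- exact: Dl_values.
- move=> Z S; rewrite -values_boundary dx /values; case: ifP => // _.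
  by apply: big1 => s _; rewrite dsum0E linear0.
- by case=> /sx.
have [y [yp yu]] := values_surj pe su Du.
have -> : x = boundary cosh y; last exact: memv_img.
apply/dsumP => t; case: (eqVneq (rk (face_of t)) p.+1) => rt.
  apply: values_inj; first by rewrite rt ltnW.
  by move=> S; rewrite values_boundary (eq_Bd lift1 yu) Bu.
rewrite (boundary_chains yp rt); move/mem_chains: xp; apply.
by apply: contra rt; rewrite rk_face_of.
Qed.

Definition total x : ('F_2)^o := \sum_Z \sum_S values x Z S.

Lemma total_linear : linear total.
Proof.
move=> a x y; rewrite /total scaler_sumr -big_split; apply: eq_bigr => Z _.
rewrite /= scaler_sumr -big_split; apply: eq_bigr => S _; exact: valuesP.
Qed.

Lemma total_boundary x : (q.+1 < e)%N -> x \in chains cosh q.+1 ->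
  total (boundary cosh x) = 0.
Proof.
move=> qe /supp_values sx; rewrite /total.
under eq_bigr do under eq_bigr do rewrite values_boundary.
rewrite (sum_Bd (@ev_affine01 R d A) (@lift1_inj R d A) low qe sx).
by apply: big1 => Z _; apply: (sum_closed low Z qe sx); exact: Dl_values.
Qed.

(** The generator sits on one simplex of rank [q.+1] and its full vertex set: closed because no
    larger subset fits, and a cycle because the facets have only [q] vertices. *)
Lemma total_surj : (q.+1 < e)%N -> exists2 x, x \in cycles cosh q & total x = 1.
Proof.
move=> qe; have k0 : face finset.set0.
  apply/faceP; exists 0, 1; split=> i; first by rewrite dot0r add0r ler01.
  by rewrite dot0r add0r oner_eq0 finset.in_set0.
have [|Z0 [kZ0 _ rZ0]] := key_extend (r := q.+1) k0.
  by rewrite rk0 /= ltnW // (ltn_trans qe).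
have cZ0 : #|vert Z0| = q.+1 by rewrite low // rZ0 ltnW.
pose u Z S : 'F_2 := ((Z == Z0) && (S == vert Z0))%:R.
have su : supp q.+1 q.+1 u.
  move=> Z S; case: (boolP ((Z == Z0) && (S == vert Z0))) => [/andP[/eqP-> /eqP->] _|h].
    by rewrite kZ0 rZ0 cZ0 !eqxx subxx.
  by rewrite /u (negPf h) eqxx.
have Du Z T : Dl u Z T = 0.
  rewrite /Dl; case: ifP => // TZ; apply: big1 => v vT; rewrite /u.
  case: (boolP (_ && _)) => // /andP[/eqP ZE /eqP TE]; rewrite ZE in TZ.
  by have := fintype.subsetP TZ v vT; rewrite -TE finset.in_setD1 eqxx.
have [x [xq xu]] := values_surj (ltnW qe) su Du; exists x; last first.
  rewrite /total (bigD1 Z0) //= (bigD1 (vert Z0)) //= xu /u !eqxx.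
  rewrite big1 ?addr0 => [|S /negPf SZ]; last by rewrite xu /u SZ andbF.
  by rewrite big1 ?addr0 // => Z /negPf ZZ; apply: big1 => S _; rewrite xu /u ZZ.
apply/cyclesP; split=> //; apply/dsumP => t; rewrite dsum0E.
case: (eqVneq (rk (face_of t)) q) => rt; last exact: boundary_chains xq rt.
rewrite -(dsum0E (stalk cosh) t); apply: values_inj.
  by rewrite rt ltnW // ltnW.
move=> S; rewrite !values0 //; apply/negP => /andP[/subset_leq_card le /eqP cS].
  by move: le; have [kZ _ _] := face_ofP t; rewrite cS low ?rt ?ltnn // ltnW // ltnW.
by move: le; have [kZ _ _] := face_ofP t; rewrite cS low ?rt ?ltnn // ltnW // ltnW.
Qed.

Lemma Hodge_space_eq0 p (x : Hodge_space (normal_fan Delta) p q) :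
  (q < p)%N -> (p.+1 < e)%N -> x = 0.
Proof.
move=> qp pe; rewrite -(quot_piK x); apply/eqP; rewrite -memv_ker lker_quot_pi.
rewrite -memv_preim lfunE /=; apply: (cycle_boundary (ltnW qp) pe).
  exact: subvsP.
by move=> e'; rewrite e' ltnn in qp.
Qed.

(** [total] kills boundaries ([total_boundary]), detects nonzero classes ([cycle_boundary]) and
    takes the value 1 ([total_surj]); hence evaluating it on representatives is an isomorphism, with
    inverse [c *: y]. *)
Lemma Hodge_space_iso : (q.+1 < e)%N ->
  exists f : {linear Hodge_space (normal_fan Delta) q q -> ('F_2)^o}, bijective f.
Proof.
move=> qe; pose f (x : Hodge_space (normal_fan Delta) q q) : ('F_2)^o :=
  total (vsval (vsval x)).
have fL : linear f by move=> a w z; rewrite /f !linearP total_linear.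
pose fl := GRing.isLinear.Build 'F_2 (Hodge_space (normal_fan Delta) q q)
  ('F_2)^o _ f fL.
pose F : {linear Hodge_space (normal_fan Delta) q q -> ('F_2)^o} := HB.pack f fl.
exists F.
have ker w : f w = 0 -> w = 0.
  move=> fw; rewrite -(quot_piK w); apply/eqP; rewrite -memv_ker lker_quot_pi.
  by rewrite -memv_preim lfunE /=; apply: (cycle_boundary (leqnn q) qe); first exact: subvsP.
have [z zc z1] := total_surj qe.
pose y : Hodge_space (normal_fan Delta) q q := quot_pi _ (vsproj _ z).
have fy : F y = 1.
  have := quot_piE (linfun (vsval : subvs_of (cycles cosh q) -> chain)
           @^-1: boundaries cosh q)%VS (vsproj _ z).
  rewrite -memv_preim lfunE /=. rewrite vsprojK // => /memv_imgP[w wq zw].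
  have := total_boundary qe wq; rewrite -zw [z - _]addrC -scaleN1r total_linear.
  rewrite scaleN1r addrC => /eqP; rewrite subr_eq0 z1 => /eqP e1.
  exact: esym e1.
have fP a v w : f (a *: v + w) = a * f v + f w by exact: fL.
have fy1 : f y = 1 := fy.
exists (fun c => c *: y) => [w|c]; last first.
  by rewrite -[LHS]/(f _) -[c *: y]addr0 fP fy1 mulr1 [f 0](linear0 F) addr0.
apply/eqP; rewrite -subr_eq0 -[- w]scaleN1r addrC; apply/eqP/ker.
rewrite fP -[f w *: y]addr0 fP fy1 mulr1 [f 0](linear0 F) addr0.
by rewrite mulN1r addNr.
Qed.
End Low.
End HodgeChains.

Theorem mainTheorem1 (R : realType) (d e : nat) (Delta : set 'rV[R]_d)
    (hDelta : reflexive_polytope Delta)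
    (he : (e <= d)%N)
    (hreg : forall s : set 'rV[R]_d,
       s \in face_fan Delta -> cone_dim s = e -> Z2_regular s) :
  (forall p q : nat, (q < p)%N -> (p < e.-1)%N ->
     forall x : Hodge_space (normal_fan Delta) p q, x = 0) /\
  (forall q : nat, (q < e.-1)%N ->
     exists f : {linear Hodge_space (normal_fan Delta) q q -> ('F_2)^o},
       bijective f).

Proof.
case: hDelta hreg => -[A ->] int0 polarD {}hreg.
have e_lt : (e < rk (@lift1 R d A) [set: fset_sub_type A]%SET)%N.
  by rewrite rk_setT.
(* [e.-1] is truncated at 0, so the bound forces [e] to be positive, as extension to faces of rank
   [e] demands. *)
have pred_lt p : (p < e.-1)%N -> (0 < e)%N /\ (p.+1 < e)%N by lia.
split=> [p q qp /pred_lt[e0 pe] x|q /pred_lt[e0 qe]].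
  exact: (Hodge_space_eq0 e_lt (low_indep2 int0 polarD e0 he hreg)
    (low_card int0 polarD e0 he hreg) x qp pe).
exact: (Hodge_space_iso e_lt (low_indep2 int0 polarD e0 he hreg)
  (low_card int0 polarD e0 he hreg) qe).
Qed.
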